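(* Let $T$ be a cellular tiling of $(\mathbb{R}^2,d_{euc})$ with finite local complexity with respect to rigid motions, with polygonal $2$-cells and straight-edge $1$-cells, such that all points of local rotational symmetry are contained in the $0$-skeleton. Let $\sigma$ be the $\mathcal{T}_0$-equivariant cellular $0$-chain given by the winding numbers at vertices (as defined in the context), and let $d^2_{2,0}\colon E^2_{2,0}=\ker(d^1_{2,0})\to E^2_{0,1}=\mathrm{coker}(d^1_{1,1})\cong H_0^{\mathcal{T}_0}(\mathbb{R}^2)$ be the second-page differential of the spectral sequence defined in the context. Then (the class of) $\sigma$ is a generator of the image of $d^2_{2,0}$.
   Context: Integer coefficients throughout. $T$ is a tiling by tiles (isometric copies of prototiles, possibly labelled) meeting at most along boundaries, uniformly bounded; $T(U)$ is the set of tiles meeting $U$; cellular means $\mathbb{R}^2$ has a CW-decomposition in which each tile is a subcomplex carrying a congruent copy of a CW-decomposition of its prototile, with $p$-skeleton $T^p$. FLC with respect to rigid motions (orientation-preserving isometries): each ball meets finitely many tiles and for each $r$ there are finitely many patches $T(B(x,r))$ up to rigid motion. $E^+(2)\cong\mathbb{R}^2\rtimes SO(2)$ is the group of rigid motions, with metric $d_E(f,g)=\max_{\|x\|\le1}\|f(x)-g(x)\|$, and $\pi\colon E^+(2)\to\mathbb{R}^2$ sends a motion $x\mapsto Ax+b$ to its translation part $b$; the fibres are circles. For $f,g\in E^+(2)$ and $R>0$, let $(\mathcal{T}_{\mathrm{rot}})^R_{f,g}$ be $\{L_{g f^{-1}}|_{B(f,R)}\}$ (left multiplication by $g\circ f^{-1}$)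 if $f^{-1}(T)$ and $g^{-1}(T)$ have the same patch of tiles within distance $R$ of the origin, and empty otherwise. A singular Borel-Moore chain $\tau=\sum c_i\tau_i$ on $E^+(2)$ (each compact set meets finitely many $\tau_i$ with $c_i\ne0$) is $\mathcal{T}_{\mathrm{rot}}$-equivariant if for some $R$ each $\tau_i$ has image in a ball of radius $R/2$ and $\Phi_*(\tau^f)=\tau^g$ for all $f,g$ and $\Phi\in(\mathcal{T}_{\mathrm{rot}})^R_{f,g}$, where $\tau^f$ is the sum of terms of $\tau$ whose images contain $f$. Let $X_p=\pi^{-1}(T^p)$ and let $H_\bullet^{\mathcal{T}_{\mathrm{rot}}}(X_p,X_{p-1})$ be the homology of the quotient of the complex of $\mathcal{T}_{\mathrm{rot}}$-equivariant chains supported in $X_p$ by those supported in $X_{p-1}$. The spectral sequence is that of the filtration of the $\mathcal{T}_{\mathrm{rot}}$-equivariant chain complex of $E^+(2)$ by chains supported in $X_p$; so $E^1_{p,q}=H_{p+q}^{\mathcal{T}_{\mathrm{rot}}}(X_p,X_{p-1})$. A cellular Borel-Moore $k$-chain of $T$ is $\mathcal{T}_0$-equivariant if there is $R$ such that whenever a rigid motion takes a $k$-cell $c_1$ to a $k$-cell $c_2$ and takes the tiles within distance $R$ of $c_1$ to those within distance $R$ of $c_2$, it carries the (oriented) coefficient at $c_1$ to that at $c_2$. $C_\bullet^{\mathcal{T}_0}(\mathbb{R}^2)$ is the complex of such chains and $H_\bullet^{\mathcal{T}_0}(\mathbb{R}^2)$ its homology. There is an identification of the row $E^1_{\bullet,1}$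 with $C_\bullet^{\mathcal{T}_0}(\mathbb{R}^2)$; in position $(0,1)$ the isomorphism $H_1^{\mathcal{T}_{\mathrm{rot}}}(X_0)\cong C_0^{\mathcal{T}_0}(\mathbb{R}^2)$ assigns to a $1$-cycle its winding number in the circular fibre over each vertex. This gives $\mathrm{coker}(d^1_{1,1})\cong H_0^{\mathcal{T}_0}(\mathbb{R}^2)$; also $\ker(d^1_{2,0})\cong\mathbb{Z}$. Definition of $\sigma$. A vertex type is a vertex together with the tiles containing it, up to rigid motion; an edge type is a $1$-cell with the tiles meeting its interior, up to rigid motion; a face type is a $2$-cell with the tile containing it, up to rigid motion. For each face type choose a direction (an embedding of it in $\mathbb{R}^2$ up to translation). For each edge type choose an ordering of the two $2$-cells bounding it and a rotation (angle in $\mathbb{R}$, determined modulo $2\pi$) which rotates the patch from an orientation in which the first $2$-cell is in its chosen direction to one in which the second is in its chosen direction. For each vertex, start at some $2$-cell containing it and traverse once around the vertex clockwise, crossing each $1$-cell incident to the vertex once; each crossing contributes the chosen rotation of the edge type (or its negative if crossed in the direction opposite to the chosen ordering). The sum of the contributions is a whole number of turns; $\sigma$ assigns to the vertex this integer winding number, with clockwise winding counted positively and anticlockwise negatively. *)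

(* Defs.v *)
From HB Require Import structures.
From mathcomp Require Import all_boot all_order all_algebra.
From mathcomp Require Import all_classical all_reals all_analysis.
From mathcomp Require Import ring lra.

Set Implicit Arguments.
Unset Strict Implicit.
Unset Printing Implicit Defensive.

Import Order.TTheory GRing.Theory Num.Theory.
Import numFieldNormedType.Exports.
Local Open Scope classical_set_scope.
Local Open Scope ring_scope.

(* The plane is R * R: its product topology is the Euclidean one, but the norm
   that the library puts on a product is the sup norm, hence enorm. *)
Section Plane.
Variable R : realType.
Implicit Types x y a b : R * R.

Definition enorm x : R := Num.sqrt (x.1 ^+ 2 + x.2 ^+ 2).

Definition cball x (r : R) : set (R * R) := [set y | enorm (y - x) <= r].

Definition thicken (U : set (R * R)) (r : R) : set (R * R) :=
  [set y | exists2 x, U x & enorm (y - x) <= r].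

Definition bounded_by (U : set (R * R)) (D : R) : Prop :=
  forall x y, U x -> U y -> enorm (x - y) <= D.

Definition frontier (U : set (R * R)) : set (R * R) := closure U `\` interior U.

Definition lerp a b (t : R) : R * R :=
  ((1 - t) * a.1 + t * b.1, (1 - t) * a.2 + t * b.2).
Definition oseg a b : set (R * R) := [set lerp a b t | t in `]0, 1[].
Definition cseg a b : set (R * R) := [set lerp a b t | t in `[0, 1]].

(* Multiplication of complex numbers: for u on the unit circle this is the
   rotation x |-> A x, where u is the first column of A. *)
Definition rotate (u x : R * R) : R * R :=
  (u.1 * x.1 - u.2 * x.2, u.2 * x.1 + u.1 * x.2).

Definition isometry (phi : R * R -> R * R) : Prop :=
  forall x y, enorm (phi x - phi y) = enorm (x - y).

Lemma enorm_ge0 x : 0 <= enorm x.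
Proof. exact: sqrtr_ge0. Qed.

Lemma enorm0 : enorm 0 = 0.
Proof. by rewrite /enorm /= expr0n addr0 sqrtr0. Qed.

Lemma enorm_eq0 x : enorm x = 0 -> x = 0.
Proof.
move=> /eqP; rewrite sqrtr_eq0 => h.
have h1 := sqr_ge0 x.1; have h2 := sqr_ge0 x.2.
have e1 : x.1 ^+ 2 = 0 by lra.
have e2 : x.2 ^+ 2 = 0 by lra.
case: x {h h1 h2} e1 e2 => p q /= /eqP; rewrite sqrf_eq0 => /eqP ->.
by move=> /eqP; rewrite sqrf_eq0 => /eqP ->.
Qed.

Lemma enormN x : enorm (- x) = enorm x.
Proof. by rewrite /enorm /= !sqrrN. Qed.

Lemma enormD x y : enorm (x + y) <= enorm x + enorm y.
Proof.
rewrite /enorm /=.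
set a := x.1; set b := x.2; set c := y.1; set d := y.2.
have pab : 0 <= a ^+ 2 + b ^+ 2 by rewrite addr_ge0 ?sqr_ge0.
have pcd : 0 <= c ^+ 2 + d ^+ 2 by rewrite addr_ge0 ?sqr_ge0.
have s1 := sqrtr_ge0 (a ^+ 2 + b ^+ 2); have s2 := sqrtr_ge0 (c ^+ 2 + d ^+ 2).
rewrite -[leRHS]ger0_norm ?addr_ge0 // -sqrtr_sqr ler_sqrt ?sqr_ge0 //.
rewrite [leRHS]sqrrD !sqr_sqrtr //.
suff: a * c + b * d <=
    Num.sqrt (a ^+ 2 + b ^+ 2) * Num.sqrt (c ^+ 2 + d ^+ 2).
  by move=> h; rewrite !sqrrD mulr2n; lra.
rewrite -sqrtrM // (le_trans (ler_norm _)) // -sqrtr_sqr ler_sqrt ?mulr_ge0 //.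
have := sqr_ge0 (a * d - b * c); nra.
Qed.

Lemma enorm_rotate (u x : R * R) :
  u.1 ^+ 2 + u.2 ^+ 2 = 1 -> enorm (rotate u x) = enorm x.
Proof.
move=> hu; rewrite /enorm /rotate /=; congr Num.sqrt.
transitivity ((u.1 ^+ 2 + u.2 ^+ 2) * (x.1 ^+ 2 + x.2 ^+ 2)); first by ring.
by rewrite hu mul1r.
Qed.

End Plane.

(* The motion x |-> rot * x + trans; the projection to the plane is trans. *)
Record motion (R : realType) := Motion {
  trans : R * R;
  rot : R * R;
  rot_unit : rot.1 ^+ 2 + rot.2 ^+ 2 == 1 }.

HB.instance Definition _ (R : realType) := gen_eqMixin (motion R).
HB.instance Definition _ (R : realType) := gen_choiceMixin (motion R).

Section Motion.
Variable R : realType.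
Implicit Types f g h : motion R.

Definition act g (x : R * R) : R * R := rotate (rot g) x + trans g.

Lemma motion_eq f g : trans f = trans g -> rot f = rot g -> f = g.
Proof.
case: f g => [tf rf uf] [tg rg ug] /= et er; subst.
by rewrite (bool_irrelevance uf ug).
Qed.

Fact mulm_unit f g :
  (rotate (rot f) (rot g)).1 ^+ 2 + (rotate (rot f) (rot g)).2 ^+ 2 == 1.
Proof.
case: f g => [tf rf /eqP uf] [tg rg /eqP ug] /=; apply/eqP.
transitivity ((rf.1 ^+ 2 + rf.2 ^+ 2) * (rg.1 ^+ 2 + rg.2 ^+ 2)); first by ring.
by rewrite uf ug mul1r.
Qed.

(* mulm f g is the composite f \o g. *)
Definition mulm f g : motion R := Motion (act f (trans g)) (mulm_unit f g).

Fact invm_unit f :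
  ((rot f).1, - (rot f).2).1 ^+ 2 + ((rot f).1, - (rot f).2).2 ^+ 2 == 1.
Proof. by rewrite /= sqrrN; exact: rot_unit. Qed.

Definition invm f : motion R :=
  Motion (- rotate ((rot f).1, - (rot f).2) (trans f)) (invm_unit f).

Lemma act_mulm f g x : act (mulm f g) x = act f (act g x).
Proof. by rewrite /act /rotate /=; congr pair => /=; ring. Qed.

Lemma act_invm f : cancel (act f) (act (invm f)).
Proof.
case: f => [[t1 t2] [c s] /= h] [x y]; rewrite /act /rotate /=.
move/eqP: h => /= h; congr pair => /=.
  transitivity ((c ^+ 2 + s ^+ 2) * x); [by ring | by rewrite h mul1r].
transitivity ((c ^+ 2 + s ^+ 2) * y); [by ring | by rewrite h mul1r].
Qed.

Definition dE f g : R :=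
  sup [set enorm (act f x - act g x) | x in [set x | enorm x <= 1]].

Let S f g := [set enorm (act f x - act g x) | x in [set x : R * R | enorm x <= 1]].

Let enorm_act0 f x : enorm x <= 1 -> enorm (act f x) <= 1 + enorm (trans f).
Proof.
move=> hx; apply: (le_trans (enormD _ _)); apply: lerD => //.
by rewrite enorm_rotate //; exact/eqP/rot_unit.
Qed.

Let has_supS f g : has_sup (S f g).
Proof.
split; first by exists (enorm (act f 0 - act g 0)), 0 => //=; rewrite enorm0.
exists ((1 + enorm (trans f)) + (1 + enorm (trans g))) => _ [x /= hx <-].
apply: (le_trans (enormD _ _)); rewrite enormN.
by apply: lerD; exact: enorm_act0.
Qed.

Let dE_ub f g x : enorm x <= 1 -> enorm (act f x - act g x) <= dE f g.
Proof. by move=> hx; apply: ub_le_sup; [case: (has_supS f g)|exists x]. Qed.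

Let dE_le f g b :
  (forall x, enorm x <= 1 -> enorm (act f x - act g x) <= b) -> dE f g <= b.
Proof.
move=> h; apply: ge_sup; first by case: (has_supS f g).
by move=> _ [x /= hx <-]; exact: h.
Qed.

Fact dExx f : dE f f = 0.
Proof.
apply/eqP; rewrite eq_le; apply/andP; split.
  by apply: dE_le => x _; rewrite subrr enorm0.
by apply: le_trans (enorm_ge0 _) (@dE_ub f f 0 _); rewrite enorm0.
Qed.

Fact dE_eq0 f g : dE f g = 0 -> f = g.
Proof.
move=> h.
have e x : enorm x <= 1 -> act f x = act g x.
  move=> hx; apply/eqP; rewrite -subr_eq0; apply/eqP; apply: enorm_eq0.
  by apply/eqP; rewrite eq_le enorm_ge0 andbT -h dE_ub.
have e0 := e 0; have e1 := e (1, 0).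
have n0 : enorm (0 : R * R) <= 1 by rewrite enorm0.
have n1 : enorm ((1, 0) : R * R) <= 1.
  by rewrite /enorm /= expr1n expr0n addr0 sqrtr1.
move: (e0 n0) (e1 n1); rewrite /act /rotate /= !mulr0 !mulr1 !subr0 !addr0.
have -> : ((0, 0) : R * R) = 0 by [].
rewrite !add0r => et; rewrite et => /addIr er.
apply: motion_eq => //; move: er.
by case: (rot f) (rot g) => [? ?] [? ?].
Qed.

Fact dE_sym f g : dE f g = dE g f.
Proof.
rewrite /dE; congr sup; apply/seteqP; split=> _ [x hx <-]; exists x => //;
  by rewrite -enormN opprB.
Qed.

Fact dE_triangle g f h : dE f h <= dE f g + dE g h.
Proof.
apply: dE_le => x hx.
have -> : act f x - act h x = (act f x - act g x) + (act g x - act h x).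
  by rewrite addrA subrK.
by apply: (le_trans (enormD _ _)); apply: lerD; exact: dE_ub.
Qed.

End Motion.

(* This makes motion R a topological space whose balls are the open dE-balls. *)
HB.instance Definition _ (R : realType) :=
  isMetric.Build R (motion R) (@dExx R) (@dE_eq0 R) (@dE_sym R) (@dE_triangle R).

(* A CW-decomposition K of the plane is given by its open cells: K k e says
   that the set e is an open k-cell. *)
Section CW.
Variable R : realType.
Definition cells := nat -> set (set (R * R)).
Implicit Types K : cells.

(* The closed k-disc is modelled by the cube [-1, 1]^k. *)
Definition cdisc k : set 'rV[R]_k := [set x | forall i, `|x 0 i| <= 1].
Definition odisc k : set 'rV[R]_k := [set x | forall i, `|x 0 i| < 1].
Arguments cdisc k : clear implicits.
Arguments odisc k : clear implicits.

Definition characteristic_map K k (e : set (R * R)) (Phi : 'rV[R]_k -> R * R) :=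
  [/\ {within cdisc k, continuous Phi},
      Phi @` odisc k = e,
      exists2 Psi : R * R -> 'rV[R]_k,
        {within e, continuous Psi} & {in odisc k, cancel Phi Psi} &
      exists2 F : set (set (R * R)), finite_set F &
        (forall e', F e' -> exists2 j, (j < k)%N & K j e') /\
        Phi @` (cdisc k `\` odisc k) `<=` \bigcup_(e' in F) e'].

Definition CW_decomposition K : Prop :=
  [/\ forall x, exists k, exists2 e, K k e & e x,
      forall k e k' e', K k e -> K k' e' -> e `&` e' !=set0 ->
        k = k' /\ e = e',
      forall k e, K k e -> exists Phi, @characteristic_map K k e Phi &
      forall A : set (R * R),
        (forall k e, K k e -> closed (A `&` closure e)) -> closed A].

Definition subcomplex K (A : set (R * R)) : Prop :=
  closed A /\ forall k e, K k e -> e `&` A !=set0 -> e `<=` A.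

Definition cells_in K (A : set (R * R)) k : set (set (R * R)) :=
  [set e | K k e /\ e `<=` A].

(* Indexed by int so that negative skeleta are available (and empty). *)
Definition skeleton K (p : int) : set (R * R) :=
  [set x | exists k, exists2 e, K k e & k%:Z <= p /\ e x].

Definition vertex K (v : R * R) : Prop := K 0 [set v].

Definition edge K (a b : R * R) : Prop := a != b /\ K 1 (oseg a b).

Definition straight_edges K : Prop :=
  forall e, K 1 e ->
    exists a b, [/\ vertex K a, vertex K b, edge K a b & e = oseg a b].

(* The corners p 0, ..., p n.-1 of a simple closed polygon, in cyclic order. *)
Definition simple_polygon n (p : nat -> R * R) : Prop :=
  let side i := cseg (p i) (p (i.+1 %% n)%N) in
  [/\ (3 <= n)%N,
      forall i j, (i < n)%N -> (j < n)%N -> p i = p j -> i = j &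
      forall i j x, (i < j < n)%N -> side i x -> side j x ->
        (j = i.+1 /\ x = p j) \/ [/\ i = 0%N, j = n.-1 & x = p 0%N]].

(* A bounded open set whose frontier is a simple closed polygonal curve is the
   region enclosed by that curve. *)
Definition polygonal (c : set (R * R)) : Prop :=
  [/\ open c, exists D, bounded_by c D &
      exists n p, simple_polygon n p /\
        frontier c = \bigcup_(i in [set i | (i < n)%N]) cseg (p i) (p (i.+1 %% n)%N)].

Definition polygonal_faces K : Prop := forall c, K 2 c -> polygonal c.

End CW.

Record prototile (R : realType) := Prototile {
  pshape : set (R * R);
  pcells : cells R }.

(* Prototiles are indexed by labels, so the label of a tile records which
   prototile it is a copy of. *)
Record tile (R : realType) (L : Type) := Tile {
  shape : set (R * R);
  label : L }.

Section Tiling.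
Variables (R : realType) (L : Type).
Variables (P : L -> prototile R) (T : set (tile R L)) (K : cells R).

Definition mtile (g : motion R) (t : tile R L) : tile R L :=
  Tile (act g @` shape t) (label t).

Definition patch (S : set (tile R L)) (U : set (R * R)) : set (tile R L) :=
  [set t | S t /\ shape t `&` U !=set0].

Definition is_tiling : Prop :=
  [/\ forall t, T t -> exists2 phi, isometry phi &
        shape t = phi @` pshape (P (label t)),
      forall x, exists2 t, T t & shape t x,
      forall t t', T t -> T t' -> t <> t' ->
        shape t `&` shape t' `<=` frontier (shape t) `&` frontier (shape t') &
      exists D, forall t, T t -> bounded_by (shape t) D].

(* The last clause says that the decomposition of a tile is determined by the
   tile, so that a motion matching two patches also matches their cells; it
   only has content for prototiles having a non-trivial self-isometry. *)
Definition cellular : Prop :=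
  [/\ CW_decomposition K,
      forall t, T t -> subcomplex K (shape t),
      forall t, T t -> exists phi, [/\ isometry phi,
        shape t = phi @` pshape (P (label t)) &
        forall k, cells_in K (shape t) k =
          [set phi @` e | e in pcells (P (label t)) k]] &
      forall (g : motion R) t t', T t -> T t' -> mtile g t = t' ->
        forall k, cells_in K (shape t') k =
          [set act g @` e | e in cells_in K (shape t) k]].

Definition rigid_flc : Prop :=
  (forall x r, finite_set (patch T (cball x r))) /\
  (forall r, exists2 C : set (R * R), finite_set C &
    forall x, exists2 y, C y & exists g : motion R,
      mtile g @` patch T (cball y r) = patch T (cball x r)).

(* Local rotational symmetry at x: for small r the patch consists of the tiles
   containing x. *)
Definition local_symmetry (x : R * R) : Prop :=
  exists2 r : R, 0 < r & exists g : motion R,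
    [/\ act g x = x, rot g <> (1, 0) &
        mtile g @` patch T (cball x r) = patch T (cball x r)].

Definition chain0 := R * R -> int.

(* b x y is the coefficient of the edge between x and y, oriented from x to
   y; reversing the orientation changes the sign. *)
Definition chain1 := R * R -> R * R -> int.

Definition C0 : set chain0 := [set a |
  (forall v, a v != 0 -> vertex K v) /\
  exists2 r : R, 0 < r & forall (g : motion R) v,
    vertex K v -> vertex K (act g v) ->
    mtile g @` patch T (thicken [set v] r) =
      patch T (thicken [set act g v] r) ->
    a (act g v) = a v].

Definition C1 : set chain1 := [set b |
  [/\ forall x y, b y x = - b x y,
      forall x y, b x y != 0 -> edge K x y &
      exists2 r : R, 0 < r & forall (g : motion R) x y,
        edge K x y -> edge K (act g x) (act g y) ->
        mtile g @` patch T (thicken (oseg x y) r) =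
          patch T (thicken (oseg (act g x) (act g y)) r) ->
        b (act g x) (act g y) = b x y]].

Definition bd1 (b : chain1) : chain0 :=
  fun v => \sum_(u \in [set u | edge K u v]) b u v.

(* The class of a 0-chain modulo boundaries, an element of H_0 when the chain
   lies in C0. *)
Definition H0_class (a : chain0) : set chain0 :=
  [set a' | exists2 b, C1 b & a' - a = bd1 b].

(* A face is a 2-cell together with the tile containing it. *)
Definition facet := (set (R * R) * tile R L)%type.

Definition is_face (X : facet) : Prop :=
  [/\ K 2 X.1, T X.2 & X.1 `<=` shape X.2].

Definition mface (g : motion R) (X : facet) : facet :=
  (act g @` X.1, mtile g X.2).

(* dir X is a copy of X placed in the direction chosen for the type of X; its
   position is immaterial. *)
Definition face_directions (dir : facet -> facet) : Prop :=
  (forall X, is_face X -> exists g, mface g X = dir X) /\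
  (forall X g, is_face X -> is_face (mface g X) -> dir (mface g X) = dir X).

Variable dir : facet -> facet.

(* rho is an angle, in radians and anticlockwise, of the rotation from the
   chosen direction of c1 to the chosen direction of c2. *)
Definition edge_rotation (c1 c2 : set (R * R)) (rho : R) : Prop :=
  exists t1 t2 (h1 h2 : motion R),
    [/\ is_face (c1, t1), is_face (c2, t2),
        mface h1 (c1, t1) = dir (c1, t1), mface h2 (c2, t2) = dir (c2, t2) &
        rot (mulm h2 (invm h1)) = (cos rho, sin rho)].

(* For each edge type, an order (c1 e, c2 e) of the two 2-cells bounding a
   1-cell e of that type, and a rotation rho e. *)
Definition edge_choices (c1 c2 : set (R * R) -> set (R * R))
    (rho : set (R * R) -> R) : Prop :=
  (forall e, K 1 e ->
    [/\ K 2 (c1 e), K 2 (c2 e), c1 e <> c2 e,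
        e `<=` closure (c1 e) `&` closure (c2 e) &
        edge_rotation (c1 e) (c2 e) (rho e)]) /\
  (forall (g : motion R) e, K 1 e -> K 1 (act g @` e) ->
    mtile g @` patch T e = patch T (act g @` e) ->
    [/\ c1 (act g @` e) = act g @` c1 e, c2 (act g @` e) = act g @` c2 e &
        rho (act g @` e) = rho e]).

Variables (c1 c2 : set (R * R) -> set (R * R)) (rho : set (R * R) -> R).

(* c lies just to the left (s = 1) or right (s = -1) of the segment from v to
   w, tested at its midpoint. *)
Definition beside (s : R) (v w : R * R) (c : set (R * R)) : Prop :=
  exists2 d : R, 0 < d & forall t, 0 < t < d ->
    c (lerp v w 2^-1 + rotate (0, s * t) (w - v)).

(* One clockwise traversal around v: the 1-cells crossed are those from v to
   w_0, ..., w_(n-1), and the crossing of the i-th leads from the 2-cell c_i to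
   c_(i+1), indices modulo n. Moving clockwise around v, one crosses from the
   left to the right of an edge directed away from v. *)
Definition clockwise_tour (v : R * R) (ws : seq (R * R))
    (cs : nat -> set (R * R)) : Prop :=
  [/\ uniq ws,
      forall w, (w \in ws) <-> edge K v w &
      forall i, (i < size ws)%N ->
        [/\ K 2 (cs i), beside 1 v (nth 0 ws i) (cs i) &
            beside (-1) v (nth 0 ws i) (cs (i.+1 %% size ws)%N)]].

Definition contribution (v w : R * R) (c : set (R * R)) : R :=
  if `[< c = c1 (oseg v w) >] then rho (oseg v w) else - rho (oseg v w).

(* The angles rho are measured anticlockwise, whereas sigma counts clockwise
   turns. *)
Definition winding_chain (sigma : chain0) : Prop :=
  (forall v, ~ vertex K v -> sigma v = 0) /\
  (forall v, vertex K v -> exists ws cs, clockwise_tour v ws cs /\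
    2 * pi * (sigma v)%:~R =
      - \sum_(i < size ws) contribution v (nth 0 ws i) (cs i)).

End Tiling.

(* C is a chain complex with boundary bd and F p n is the p-th filtration step
   in degree n. The terms of the spectral sequence are indexed by (p, n), where
   n = p + q is the total degree. *)
Section SpectralSequence.
Variables (C : nat -> zmodType) (bd : forall n, C n.+1 -> C n).
Variable F : int -> forall n, set (C n).

Definition bdry n : C n -> C n.-1 :=
  match n with 0%N => fun=> 0 | m.+1 => @bd m end.

Definition Zterm (r : nat) (p : int) n : set (C n) :=
  [set z | F p z /\ F (p - r%:Z) (bdry z)].

Definition Bterm (r : nat) (p : int) n : set (C n) :=
  [set x | exists y z, [/\ Zterm r.-1 (p + r%:Z - 1) y,
    Zterm r.-1 (p - 1) z & x = bd y + z]].

Definition coset_mod (V : zmodType) (B : set V) (z : V) : set V :=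
  [set z' | B (z' - z)].

(* E^r = Z^r / B^r, for r > 0, as the set of its cosets. *)
Definition Eterm (r : nat) (p : int) n : set (set (C n)) :=
  [set coset_mod (Bterm r p (n := n)) z | z in Zterm r p (n := n)].

(* The differential from E^r at (p, n) to E^r at (p - r, n - 1), sending the
   class of z to the class of the boundary of z. *)
Definition dterm (r : nat) (p : int) n (X : set (C n)) : set (C n.-1) :=
  \bigcup_(z in X) coset_mod (Bterm r (p - r%:Z) (n := n.-1)) (bdry z).

End SpectralSequence.

Section Singular.
Variable R : realType.

Definition std_simplex n : set 'rV[R]_n.+1 :=
  [set x | (forall i, 0 <= x 0 i) /\ \sum_i x 0 i = 1].
Arguments std_simplex n : clear implicits.

Fact corner_subproof n (i : 'I_n.+1) :
  (\row_j (j == i)%:R : 'rV[R]_n.+1) \in std_simplex n.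
Proof.
apply/mem_set; split=> [j|]; first by rewrite mxE ler0n.
rewrite (bigD1 i) //= mxE eqxx big1 ?addr0 // => j ji.
by rewrite mxE (negbTE ji).
Qed.

Definition corner n (i : 'I_n.+1) : std_simplex n :=
  exist (fun x => x \in std_simplex n) _ (@corner_subproof n i).

Fact coface_subproof n (i : 'I_n.+2) (x : std_simplex n) :
  (\row_j (if unlift i j is Some k then (val x : 'rV[R]_n.+1) 0 k else 0))
    \in std_simplex n.+1.
Proof.
case: x => /= x /set_mem [x0 x1]; apply/mem_set; split=> [j|].
  by rewrite mxE; case: unliftP => // k _; exact: x0.
rewrite (bigD1_ord i) //= mxE unlift_none add0r -[RHS]x1.
by apply: eq_bigr => k _; rewrite mxE liftK.
Qed.

(* The inclusion of the i-th face, opposite to the i-th corner. *)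
Definition coface n (i : 'I_n.+2) (x : std_simplex n) : std_simplex n.+1 :=
  exist (fun y => y \in std_simplex n.+1) _ (@coface_subproof n i x).

(* Coefficients are attached to all maps; chains are required below to vanish
   on discontinuous ones. *)
Definition smap n := std_simplex n -> motion R.
Definition schain n := smap n -> int.

Definition sbd n (c : schain n.+1) : schain n :=
  fun u => \sum_(i < n.+2)
    \sum_(s \in [set s : smap n.+1 | s \o coface i = u]) (-1) ^+ i * c s.

Definition borel_moore n (c : schain n) : Prop :=
  (forall s, c s != 0 -> continuous s) /\
  (forall A : set (motion R), compact A ->
    finite_set [set s | c s != 0 /\ range s `&` A !=set0]).

Definition pushforward n (Phi : motion R -> motion R) (c : schain n) : schain n :=
  fun u => \sum_(s \in [set s : smap n | Phi \o s = u]) c s.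

(* The terms of c whose images contain f. *)
Definition star n (c : schain n) (f : motion R) : schain n :=
  fun s => if `[< range s f >] then c s else 0.

(* The winding of the path of rotation parts of s, in radians and
   anticlockwise, measured along a continuous choice of angle. *)
Definition turning (s : smap 1) (w : R) : Prop :=
  exists theta : std_simplex 1 -> R,
    [/\ continuous theta,
        forall x, rot (s x) = (cos (theta x), sin (theta x)) &
        w = theta (corner ord_max) - theta (corner ord0)].

Definition fibre (v : R * R) : set (motion R) := [set f | trans f = v].

End Singular.

Section Equivariant.
Variables (R : realType) (L : Type) (T : set (tile R L)) (K : cells R).

(* Members are total left translations instead of their restrictions to the
   ball of radius r about f; they are only applied to chains supported there. *)
Definition Trot (r : R) (f g : motion R) : set (motion R -> motion R) :=
  [set Phi | Phi = mulm (mulm g (invm f)) /\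
    patch (mtile (invm f) @` T) (cball 0 r) =
    patch (mtile (invm g) @` T) (cball 0 r)].

Definition equivariant n (c : schain R n) : Prop :=
  exists2 r : R, 0 < r &
    (forall s, c s != 0 -> exists f : motion R, range s `<=` ball f (r / 2)) /\
    (forall f g Phi, Trot r f g Phi ->
      pushforward Phi (star c f) = star c g).

Definition Xskel (p : int) : set (motion R) := (@trans R) @^-1` skeleton K p.

Definition Frot (p : int) n : set (schain R n) := [set c |
  [/\ borel_moore c, equivariant c &
      forall s, c s != 0 -> range s `<=` Xskel p]].

Definition schain_zmod n : zmodType := schain R n.

(* E^r_{p,q} of the filtration of the equivariant chains, with n = p + q. *)
Definition Erot (r : nat) (p : int) n : set (set (schain R n)) :=
  @Eterm schain_zmod (@sbd R) Frot r p n.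

Definition drot (r : nat) (p : int) n : set (schain R n) -> set (schain R n.-1) :=
  @dterm schain_zmod (@sbd R) Frot r p n.

(* w v is the winding number of z in the fibre over the vertex v. *)
Definition winding_numbers (z : schain R 1) (w : chain0 R) : Prop :=
  (forall v, ~ vertex K v -> w v = 0) /\
  (forall v, vertex K v -> exists turn : smap R 1 -> R,
    (forall s, z s != 0 -> range s `<=` fibre v -> turning s (turn s)) /\
    2 * pi * (w v)%:~R =
      \sum_(s \in [set s : smap R 1 | range s `<=` fibre v]) (z s)%:~R * turn s).

(* The identification of E^2_{0,1} with H_0 induced by winding numbers. *)
Definition winding_iso (X : set (schain R 1)) : set (chain0 R) :=
  [set a | exists z w, [/\ X z, winding_numbers z w & H0_class T K w a]].

End Equivariant.

Arguments Erot {R L} T K r p n.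
Arguments drot {R L} T K r p n X.

(* Main.v *)
(* A class in H_0 is read off from winding numbers, so the differential of a class z is
   the winding of bd z over the vertices. Push each singular 1-simplex of motions to an
   edge path of T, equivariantly, by choosing vertices in the frame of the motion: the
   degree m of z over the faces is the same for all of them. By the absence of symmetry
   off the vertices, the chosen direction of a face is attained by a unique motion, whose
   rotation is a reference angle for motions over that face. Stokes' theorem against
   integer cochains built from the edge paths and these angles shows that the winding of
   bd z is m sigma plus the boundary of an equivariant 1-chain. Finally m vanishes on
   chains over the 1-skeleton, and coning the faces at their chosen directions, with strips
   over the edges turning by rho, gives a class with m = 1. *)
Require Import Defs.
From mathcomp Require Import all_boot all_order all_algebra.
From mathcomp Require Import all_classical all_reals all_analysis.
From mathcomp Require Import ring lra zify.

Set Implicit Arguments.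
Unset Strict Implicit.
Unset Printing Implicit Defensive.

Import Order.TTheory GRing.Theory Num.Theory.
Import numFieldNormedType.Exports.
Import Defs.
Local Open Scope classical_set_scope.
Local Open Scope ring_scope.


(** * Angles in the plane *)

Section Plane.
Variable R : realType.
Implicit Types x y z p q u w a b : R * R.

Definition conjp u : R * R := (u.1, - u.2).
Definition expi (t : R) : R * R := (cos t, sin t).

Lemma pairE x : x = (x.1, x.2). Proof. by case: x. Qed.

Lemma rotateC x y : rotate x y = rotate y x.
Proof. by rewrite /rotate; congr pair; ring. Qed.

Lemma rotateA x y z : rotate x (rotate y z) = rotate (rotate x y) z.
Proof. by rewrite /rotate /=; congr pair; ring. Qed.

Lemma rotateDr u x y : rotate u (x + y) = rotate u x + rotate u y.
Proof. by rewrite /rotate /=; congr pair => /=; ring. Qed.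

Lemma rotateN u x : rotate u (- x) = - rotate u x.
Proof. by rewrite /rotate /=; congr pair => /=; ring. Qed.

Lemma rotateBr u x y : rotate u (x - y) = rotate u x - rotate u y.
Proof. by rewrite rotateDr rotateN. Qed.

Lemma rotate1 x : rotate (1, 0) x = x.
Proof. by rewrite [RHS]pairE /rotate /=; congr pair; ring. Qed.

Lemma rotate0 u : rotate u 0 = 0.
Proof. by rewrite /rotate /=; congr pair; ring. Qed.

Lemma enorm_sqr x : enorm x ^+ 2 = x.1 ^+ 2 + x.2 ^+ 2.
Proof. by rewrite sqr_sqrtr // addr_ge0 ?sqr_ge0. Qed.

Lemma enormM u x : enorm (rotate u x) = enorm u * enorm x.
Proof.
rewrite /enorm -sqrtrM ?addr_ge0 ?sqr_ge0 //; congr Num.sqrt.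
by rewrite /rotate /=; ring.
Qed.

Lemma enorm_conj u : enorm (conjp u) = enorm u.
Proof. by rewrite /enorm /= sqrrN. Qed.

Lemma conjpK u : rotate (conjp u) u = (enorm u ^+ 2, 0).
Proof. by rewrite enorm_sqr /rotate /=; congr pair; ring. Qed.

Lemma enorm_expi t : enorm (expi t) = 1.
Proof. by rewrite /enorm /= cos2Dsin2 sqrtr1. Qed.

Lemma expiD s t : expi (s + t) = rotate (expi s) (expi t).
Proof. by rewrite /expi cosD sinD /rotate /=; congr pair; ring. Qed.

Lemma expiN t : expi (- t) = conjp (expi t).
Proof. by rewrite /expi cosN sinN. Qed.

Lemma expi0 : expi 0 = (1, 0).
Proof. by rewrite /expi cos0 sin0. Qed.

Lemma enorm_fst x : `|x.1| <= enorm x.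
Proof.
by rewrite -sqrtr_sqr /enorm ler_sqrt ?addr_ge0 ?sqr_ge0 // lerDl sqr_ge0.
Qed.

Lemma enorm_snd x : `|x.2| <= enorm x.
Proof.
by rewrite -sqrtr_sqr /enorm ler_sqrt ?addr_ge0 ?sqr_ge0 // lerDr sqr_ge0.
Qed.

Lemma enorm_le x : enorm x <= `|x.1| + `|x.2|.
Proof.
rewrite -[leRHS]ger0_norm ?addr_ge0 // -sqrtr_sqr /enorm ler_sqrt ?sqr_ge0 //.
rewrite sqrrD !real_normK ?num_real //; have := normr_ge0 x.1; have := normr_ge0 x.2; nra.
Qed.

Lemma enormB x y : enorm (x - y) = enorm (y - x).
Proof. by rewrite -enormN opprB. Qed.

Lemma enorm_tri x y z : enorm (x - z) <= enorm (x - y) + enorm (y - z).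
Proof. by rewrite -[x - z](subrKA y) enormD. Qed.

Lemma enorm_gt0 x : x != 0 -> 0 < enorm x.
Proof. by move=> x0; rewrite lt0r enorm_ge0 andbT; apply: contra x0 => /eqP/enorm_eq0 ->. Qed.

Lemma nbhs_enorm x (A : set (R * R)) :
  nbhs x A <-> exists2 e : R, 0 < e & forall y, enorm (y - x) < e -> A y.
Proof.
split.
  rewrite -nbhs_ballE => -[e /= e0 h]; exists e => // y hy; apply: h.
  by split; apply: le_lt_trans hy; rewrite distrC; [exact: enorm_fst (y - x)|exact: enorm_snd (y - x)].
move=> [e e0 h]; rewrite -nbhs_ballE; exists (e / 2); first by rewrite /= divr_gt0.
move=> y [/= h1 h2]; apply: h; apply: (le_lt_trans (enorm_le _)) => /=.
have e1 : `|y.1 - x.1| < e / 2 by rewrite distrC; exact: h1.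
have e2 : `|y.2 - x.2| < e / 2 by rewrite distrC; exact: h2.
by lra.
Qed.

Lemma open_enorm (A : set (R * R)) : open A ->
  forall x, A x -> exists2 e : R, 0 < e & forall y, enorm (y - x) < e -> A y.
Proof. by move=> oA x /oA /nbhs_enorm. Qed.

Lemma closure_enorm (A : set (R * R)) x :
  closure A x <-> forall e : R, 0 < e -> exists2 y, A y & enorm (y - x) < e.
Proof.
split.
  move=> cA e e0; have /cA[y [Ay hy]] : nbhs x [set y | enorm (y - x) < e].
    by apply/nbhs_enorm; exists e.
  by exists y.
by move=> h B /nbhs_enorm[e e0 hB]; have [y Ay hy] := h e e0; exists y; split => //; exact: hB.
Qed.

Lemma cvg_fst_pair (T : Type) (F : set_system T) {FF : Filter F} (f : T -> R * R) a :
  f @ F --> a -> (fun t => (f t).1) @ F --> a.1.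
Proof. by move=> fa; apply: cvg_comp fa _; case: a => a1 a2; exact: cvg_fst. Qed.

Lemma cvg_snd_pair (T : Type) (F : set_system T) {FF : Filter F} (f : T -> R * R) a :
  f @ F --> a -> (fun t => (f t).2) @ F --> a.2.
Proof. by move=> fa; apply: cvg_comp fa _; case: a => a1 a2; exact: cvg_snd. Qed.

Lemma cvg_pairP (T : Type) (F : set_system T) {FF : Filter F} (f : T -> R * R) a :
  (fun t => (f t).1) @ F --> a.1 -> (fun t => (f t).2) @ F --> a.2 -> f @ F --> a.
Proof.
move=> h1 h2; have h := @cvg_pair _ _ _ F _ _ _ _ _ _ _ h1 h2.
have -> : f = fun t => ((f t).1, (f t).2) by apply/funext => t; rewrite -pairE.
by case: a h1 h2 h => a1 a2 h1 h2; apply.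
Qed.

Lemma cvg_rotate (T : Type) (F : set_system T) {FF : Filter F} (f g : T -> R * R) a b :
  f @ F --> a -> g @ F --> b -> (fun t => rotate (f t) (g t)) @ F --> rotate a b.
Proof.
move=> fa gb; have f1 := @cvg_fst_pair _ _ FF _ _ fa; have f2 := @cvg_snd_pair _ _ FF _ _ fa.
have g1 := @cvg_fst_pair _ _ FF _ _ gb; have g2 := @cvg_snd_pair _ _ FF _ _ gb.
apply: cvg_pairP; rewrite /rotate /=.
  by apply: cvgB; apply: cvgM.
by apply: cvgD; apply: cvgM.
Qed.

Lemma cvg_conjp (T : Type) (F : set_system T) {FF : Filter F} (f : T -> R * R) a :
  f @ F --> a -> (fun t => conjp (f t)) @ F --> conjp a.
Proof.
move=> fa; apply: cvg_pairP; rewrite /conjp /=; first exact: cvg_fst_pair.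
by apply: cvgN; exact: cvg_snd_pair.
Qed.

Lemma cvg_enorm (T : Type) (F : set_system T) {FF : Filter F} (f : T -> R * R) a :
  f @ F --> a -> (fun t => enorm (f t)) @ F --> enorm a.
Proof.
move=> fa; have f1 := @cvg_fst_pair _ _ FF _ _ fa; have f2 := @cvg_snd_pair _ _ FF _ _ fa.
apply: (@continuous_cvg _ _ _ _ _ _ (@Num.sqrt R)); first exact: sqrt_continuous.
apply: cvgD; apply: (@continuous_cvg _ _ _ _ _ _ (fun t : R => t ^+ 2)) => //;
  exact: exprn_continuous.
Qed.

Lemma expi_continuous : continuous expi.
Proof. by move=> t; apply: cvg_pairP; [exact: continuous_cos|exact: continuous_sin]. Qed.

(* The half-angle formula for the principal argument; arg 0 = 0. *)
Definition arg (w : R * R) : R :=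
  if (w.2 == 0) && (w.1 < 0) then pi else 2 * atan (w.2 / (enorm w + w.1)).

Lemma argE w : 0 < enorm w + w.1 -> arg w = 2 * atan (w.2 / (enorm w + w.1)).
Proof.
rewrite /arg; case: ifP => // /andP[/eqP h1 h2].
by rewrite /enorm h1 expr0n addr0 sqrtr_sqr ltr0_norm // addNr ltxx.
Qed.

Lemma slitN w : ~~ (0 < enorm w + w.1) -> w.2 = 0 /\ w.1 <= 0.
Proof.
rewrite -leNgt => h; have := enorm_sqr w; have := enorm_ge0 w.
move: (enorm w) h => r h r0 e.
have h1 : w.1 <= 0 by lra.
have : w.2 ^+ 2 <= 0 by nra.
by rewrite le_eqVlt ltNge sqr_ge0 orbF sqrf_eq0 => /eqP.
Qed.

Lemma cos_2atan (t : R) : cos (2 * atan t) = (1 - t ^+ 2) / (1 + t ^+ 2).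
Proof.
have h : 0 < 1 + t ^+ 2 by rewrite ltr_wpDr ?sqr_ge0.
rewrite mulr_natl cos_mulr2n cos_atan exprVn sqr_sqrtr ?ltW //.
by field; rewrite gt_eqF.
Qed.

Lemma sin_2atan (t : R) : sin (2 * atan t) = 2 * t / (1 + t ^+ 2).
Proof.
have h : 0 < 1 + t ^+ 2 by rewrite ltr_wpDr ?sqr_ge0.
have c0 : cos (atan t) != 0 by rewrite cos_atan invr_eq0 sqrtr_eq0 -ltNge.
have -> : sin (2 * atan t) = 2 * (tan (atan t) * cos (atan t) ^+ 2).
  by rewrite mulr_natl sin_mulr2n /tan; field.
rewrite atanK cos_atan exprVn sqr_sqrtr ?ltW //.
by field; rewrite gt_eqF.
Qed.

Lemma argK w : w = rotate (enorm w, 0) (expi (arg w)).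
Proof.
have [h|/slitN[w2 w1]] := boolP (0 < enorm w + w.1).
  rewrite argE // /rotate /expi /= cos_2atan sin_2atan.
  have := enorm_sqr w; have := enorm_ge0 w.
  move: (enorm w) h => r h r0 e.
  have r1 : r != 0.
    apply/eqP => r1; have w1 : w.1 ^+ 2 <= 0.
      by have := sqr_ge0 w.2; rewrite r1 in e; lra.
    by rewrite r1 add0r in h; have := exprn_gt0 2 h; lra.
  have e1 : 1 + (w.2 / (r + w.1)) ^+ 2 = 2 * r / (r + w.1).
    transitivity ((r ^+ 2 + 2 * r * w.1 + (w.1 ^+ 2 + w.2 ^+ 2)) / (r + w.1) ^+ 2).
      by field; rewrite gt_eqF.
    by rewrite -e; field; rewrite gt_eqF.
  have e2 : 1 - (w.2 / (r + w.1)) ^+ 2 = 2 * w.1 / (r + w.1).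
    transitivity ((r ^+ 2 + 2 * r * w.1 + w.1 ^+ 2 - w.2 ^+ 2) / (r + w.1) ^+ 2).
      by field; rewrite gt_eqF.
    by rewrite e; field; rewrite gt_eqF.
  rewrite e1 e2 [LHS]pairE; congr pair; field; rewrite r1 gt_eqF //.
have ew : enorm w = - w.1.
  by rewrite /enorm w2 expr0n addr0 sqrtr_sqr ler0_norm.
rewrite /arg w2 eqxx /=; case: ltP => w0.
  by rewrite /expi cospi sinpi /rotate /= ew [LHS]pairE w2; congr pair; ring.
have -> : w = 0 by rewrite [LHS]pairE w2; congr pair; lra.
by rewrite enorm0 /rotate /=; congr pair; ring.
Qed.

Lemma expi_arg u : enorm u = 1 -> expi (arg u) = u.
Proof. by move=> h; rewrite [RHS]argK h rotate1. Qed.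

Lemma arg_gt w : - pi < arg w.
Proof.
have := pi_gt0 R; rewrite /arg; case: ifP => _; first by lra.
by have := atan_gtNpi2 (w.2 / (enorm w + w.1)); lra.
Qed.

Lemma arg_le w : arg w <= pi.
Proof.
have := pi_gt0 R; rewrite /arg; case: ifP => _; first by lra.
by have := atan_ltpi2 (w.2 / (enorm w + w.1)); lra.
Qed.

Lemma arg_right w : 0 < w.1 -> - (pi / 2) < arg w < pi / 2.
Proof.
move=> h; have h1 : 0 < enorm w + w.1 by have := enorm_ge0 w; lra.
rewrite argE //; have h2 : `|w.2 / (enorm w + w.1)| < 1.
  rewrite normrM normfV (gtr0_norm h1) ltr_pdivrMr // mul1r.
  by have := enorm_snd w; lra.
move: h2; rewrite ltr_norml => /andP[h2 h3].
have := lt_atan h2; have := lt_atan h3; rewrite atanN atan1; have := pi_gt0 R.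
by move=> *; apply/andP; split; lra.
Qed.

Lemma arg_scale (r : R) w : 0 < r -> arg (rotate (r, 0) w) = arg w.
Proof.
move=> r0; rewrite /arg enormM /rotate /=.
have -> : enorm (r, 0) = r.
  by rewrite /enorm /= expr0n addr0 sqrtr_sqr gtr0_norm.
rewrite mul0r add0r mul0r subr0 mulf_eq0 gt_eqF //= pmulr_rlt0 //.
by case: ifP => // _; rewrite -mulrDr -mulf_div divff ?gt_eqF // mul1r.
Qed.

Lemma cvg_arg (T : Type) (F : set_system T) {FF : Filter F} (f : T -> R * R) a :
  0 < enorm a + a.1 -> f @ F --> a -> (fun t => arg (f t)) @ F --> arg a.
Proof.
move=> a0 fa; have f1 := @cvg_fst_pair _ _ FF _ _ fa; have f2 := @cvg_snd_pair _ _ FF _ _ fa.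
have fs : (fun t => enorm (f t) + (f t).1) @ F --> enorm a + a.1.
  by apply: cvgD => //; exact: cvg_enorm.
have nz : \forall t \near F, 0 < enorm (f t) + (f t).1.
  by apply: (cvgr_gt _ fs).
have : (fun t => 2 * atan ((f t).2 / (enorm (f t) + (f t).1))) @ F --> arg a.
  rewrite argE //; apply: cvgM; first exact: cvg_cst.
  apply: (@continuous_cvg _ _ _ _ _ _ (@atan R)); first exact: continuous_atan.
  by apply: cvgM => //; apply: cvgV => //; rewrite gt_eqF.
apply: cvg_trans; apply: near_eq_cvg; near=> t; rewrite argE //; near: t.
exact: nz.
Unshelve. all: by end_near. Qed.

Definition cong (s t : R) : Prop := exists k : int, s - t = 2 * pi * k%:~R.

Lemma cong_refl s : cong s s.
Proof. by exists 0; rewrite subrr mulr0. Qed.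

Lemma cong_sym s t : cong s t -> cong t s.
Proof. by move=> [k e]; exists (- k); rewrite mulrNz mulrN -e opprB. Qed.

Lemma cong_trans s t r : cong s t -> cong t r -> cong s r.
Proof.
by move=> [k e] [l e']; exists (k + l); rewrite mulrzDr_tmp mulrDr -e -e' subrKA.
Qed.

Lemma congD s t s' t' : cong s t -> cong s' t' -> cong (s + s') (t + t').
Proof.
by move=> [k e] [l e']; exists (k + l); rewrite mulrzDr_tmp mulrDr -e -e'; ring.
Qed.

Lemma congN s t : cong s t -> cong (- s) (- t).
Proof. by move=> [k e]; exists (- k); rewrite mulrNz mulrN -e; ring. Qed.

Lemma congB s t s' t' : cong s t -> cong s' t' -> cong (s - s') (t - t').
Proof. by move=> h h'; apply: congD => //; exact: congN. Qed.

Lemma congMz s t (k : int) : cong s t -> cong (k%:~R * s) (k%:~R * t).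
Proof. by move=> [l e]; exists (k * l); rewrite intrM -mulrBr e; ring. Qed.

Lemma cong_eq s t : cong s t -> `|s - t| < 2 * pi -> s = t.
Proof.
move=> [k e]; rewrite e normrM gtr0_norm ?mulr_gt0 ?pi_gt0 //.
rewrite -[ltRHS]mulr1 ltr_pM2l ?mulr_gt0 ?pi_gt0 //.
rewrite -intr_norm ltrz1 => k1; apply/eqP; rewrite -subr_eq0 e.
by rewrite (_ : k = 0) ?mulr0 //; lia.
Qed.

Lemma expi_period s (k : int) : expi (s + 2 * pi * k%:~R) = expi s.
Proof.
have ee (m : nat) t : expi (t + 2 * pi * m%:R) = expi t.
  have -> : 2 * pi * m%:R = pi *+ 2 *+ m :> R by rewrite mulr_natr mulr_natl.
  by rewrite /expi (periodicn (@cosD2pi R)) (periodicn (@sinD2pi R)).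
case: k => m; first exact: ee.
by rewrite -(ee m.+1 (s + _)) NegzE mulrNz mulrN addrNK.
Qed.

Lemma expi_cong s t : expi s = expi t <-> cong s t.
Proof.
split=> [e|[k e]].
  have c1 : cos (s - t) = 1.
    by case: e => ec es; rewrite cosB ec es -!expr2 cos2Dsin2.
  set d := s - t in c1; pose k := Num.floor (d / (2 * pi)).
  have p0 : 0 < 2 * pi :> R by rewrite mulr_gt0 ?pi_gt0.
  have := floor_itv (d / (2 * pi)); rewrite -/k => /andP[k1 k2].
  rewrite ler_pdivlMr // in k1; rewrite ltr_pdivrMr // in k2.
  exists k; rewrite -/d.
  set r := d - 2 * pi * k%:~R; suff : r = 0 by rewrite /r; lra.
  have r0 : 0 <= r by rewrite /r; lra.
  have r1 : r < 2 * pi by rewrite /r; rewrite intrD mulrDl mul1r in k2; lra.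
  have cr : cos r = 1.
    by rewrite -c1; have [] := expi_period r k; rewrite /r subrK.
  have [rp|rp] := leP r pi.
    by apply: cos_inj; rewrite ?in_itv /= ?r0 ?lexx ?pi_ge0 ?cos0.
  have := @cos_inj R (2 * pi - r) 0; rewrite !in_itv /= lexx pi_ge0.
  rewrite cos0 cosB mulr_natl cos2pi sin2pi cr mul0r addr0 mulr1.
  by move=> h; have := h _ isT erefl; lra.
by rewrite -(expi_period t k) -e addrC subrK.
Qed.

Definition ang z a b : R := arg (rotate (b - z) (conjp (a - z))).

Lemma arg_cong x y : x != 0 -> y != 0 ->
  cong (arg (rotate y (conjp x))) (arg y - arg x).
Proof.
move=> x0 y0; apply/expi_cong; rewrite expiD expiN.
have nx := enorm_gt0 x0; have ny := enorm_gt0 y0.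
have := argK (rotate y (conjp x)).
rewrite enormM enorm_conj.
have -> : rotate y (conjp x) = rotate (enorm y * enorm x, 0)
    (rotate (expi (arg y)) (conjp (expi (arg x)))).
  by rewrite {1}(argK y) {1}(argK x) /rotate /conjp /=; congr pair; ring.
set e := rotate (expi _) _; set e' := expi _; rewrite /rotate /= => -[].
have n0 : enorm y * enorm x != 0 by rewrite mulf_neq0 // gt_eqF.
rewrite !mul0r !add0r !subr0 => /(mulfI n0) e1 /(mulfI n0) e2.
by rewrite /e' /expi -e1 -e2 /e /rotate /conjp /expi.
Qed.

Lemma ang_cong z a b : a != z -> b != z -> cong (ang z a b) (arg (b - z) - arg (a - z)).
Proof. by move=> az bz; apply: arg_cong; rewrite subr_eq0. Qed.

Lemma angxx z a : ang z a a = 0.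
Proof.
rewrite /ang rotateC conjpK /arg /= eqxx /= ltNge sqr_ge0 /=.
by rewrite mul0r atan0 mulr0.
Qed.

Lemma arg_conj w : 0 < enorm w + w.1 -> arg (conjp w) = - arg w.
Proof.
by move=> h; rewrite !argE ?enorm_conj //= mulNr atanN mulrN.
Qed.

Lemma ang_slit z a b : ~ cseg a b z ->
  0 < enorm (rotate (b - z) (conjp (a - z))) + (rotate (b - z) (conjp (a - z))).1.
Proof.
move=> h; apply/negPn/negP => /slitN[]; rewrite /rotate /=.
move=> h1 h2; apply: h; rewrite /cseg /=.
have [az|az] := eqVneq a z.
  exists 0; first by rewrite /= in_itv /= lexx ler01.
  by rewrite az /lerp [RHS]pairE; congr pair; ring.
have p0 : 0 < (a.1 - z.1) ^+ 2 + (a.2 - z.2) ^+ 2.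
  by have := exprn_gt0 2 (enorm_gt0 (_ : a - z != 0)); rewrite subr_eq0 enorm_sqr; apply.
set N := _ + _ in p0.
set d := (b.1 - z.1) * (a.1 - z.1) - (b.2 - z.2) * - (a.2 - z.2) in h2.
have D0 : 0 < N - d by lra.
exists (N / (N - d)).
  by rewrite /= in_itv /= divr_ge0 ?(ltW p0) ?(ltW D0) //= ler_pdivrMr // mul1r; lra.
have e : 1 - N / (N - d) = - d / (N - d) by field; rewrite gt_eqF.
have q1 : N * (b.1 - z.1) = d * (a.1 - z.1).
  rewrite /N /d; transitivity ((b.1 - z.1) * (a.1 - z.1) ^+ 2 + (a.2 - z.2) * ((a.2 - z.2) * (b.1 - z.1))); first by ring.
  have -> : (a.2 - z.2) * (b.1 - z.1) = (b.2 - z.2) * (a.1 - z.1) by lra.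
  by ring.
have q2 : N * (b.2 - z.2) = d * (a.2 - z.2).
  rewrite /N /d; transitivity ((b.2 - z.2) * (a.2 - z.2) ^+ 2 + (a.1 - z.1) * ((b.2 - z.2) * (a.1 - z.1))); first by ring.
  have -> : (b.2 - z.2) * (a.1 - z.1) = (a.2 - z.2) * (b.1 - z.1) by lra.
  by ring.
rewrite /lerp e [RHS]pairE; congr pair.
  transitivity ((- d * (a.1 - z.1) + N * (b.1 - z.1)) / (N - d) + z.1); first by field; rewrite gt_eqF.
  by rewrite q1; field; rewrite gt_eqF.
transitivity ((- d * (a.2 - z.2) + N * (b.2 - z.2)) / (N - d) + z.2); first by field; rewrite gt_eqF.
by rewrite q2; field; rewrite gt_eqF.
Qed.

Lemma angN z a b : ~ cseg a b z -> ang z b a = - ang z a b.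
Proof.
move=> h; rewrite /ang -arg_conj ?ang_slit //; congr arg.
by rewrite /rotate /conjp /=; congr pair; ring.
Qed.

Lemma cvg_ang (T : Type) (F : set_system T) {FF : Filter F} (f : T -> R * R) z a b :
  ~ cseg a b z -> f @ F --> z -> (fun t => ang (f t) a b) @ F --> ang z a b.
Proof.
move=> h fz; apply: cvg_arg; first exact: ang_slit.
apply: cvg_rotate; first by apply: cvgB => //; exact: cvg_cst.
by apply: cvg_conjp; apply: cvgB => //; exact: cvg_cst.
Qed.

Lemma act_sub (g : motion R) x y : act g x - act g y = rotate (rot g) (x - y).
Proof. by rewrite /act rotateBr; ring. Qed.

Lemma rot_norm (g : motion R) : enorm (rot g) = 1.
Proof. by have /eqP h := rot_unit g; rewrite /enorm h sqrtr1. Qed.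

Lemma enorm_act (g : motion R) x y : enorm (act g x - act g y) = enorm (x - y).
Proof. by rewrite act_sub enormM rot_norm mul1r. Qed.

Lemma ang_act (g : motion R) z a b : ang (act g z) (act g a) (act g b) = ang z a b.
Proof.
rewrite /ang !act_sub; congr arg.
have /eqP h := rot_unit g.
transitivity (rotate (rotate (conjp (rot g)) (rot g)) (rotate (b - z) (conjp (a - z)))).
  by rewrite /rotate /conjp /=; congr pair; ring.
by rewrite conjpK rot_norm expr1n rotate1.
Qed.

Lemma ang_halfplane z n a b :
  0 < (rotate (a - z) (conjp n)).1 -> 0 < (rotate (b - z) (conjp n)).1 ->
  ang z a b = arg (rotate (b - z) (conjp n)) - arg (rotate (a - z) (conjp n)).
Proof.
set p := rotate (a - z) _; set q := rotate (b - z) _ => p1 q1.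
have p0 : p != 0 by apply/eqP => e; rewrite e ltxx in p1.
have q0 : q != 0 by apply/eqP => e; rewrite e ltxx in q1.
have n0 : 0 < enorm n ^+ 2.
  rewrite exprn_gt0 // enorm_gt0 //; apply/eqP => e; move: p1.
  by rewrite /p e /rotate /conjp /= oppr0 !mulr0 subrr ltxx.
have -> : ang z a b = arg (rotate q (conjp p)).
  rewrite /ang -(arg_scale _ n0); congr arg.
  by rewrite enorm_sqr /p /q /rotate /conjp /=; congr pair; ring.
apply: cong_eq; first exact: arg_cong.
have /andP[h1 h2] := arg_right p1; have /andP[h3 h4] := arg_right q1.
have h5 := arg_gt (rotate q (conjp p)); have h6 := arg_le (rotate q (conjp p)).
by rewrite ltr_norml; apply/andP; split; lra.
Qed.

Lemma locally_constant (Q : R -> Prop) :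
  (forall t : R, 0 <= t <= 1 -> exists2 d : R, 0 < d &
     forall t' : R, 0 <= t' <= 1 -> `|t' - t| < d -> (Q t' <-> Q t)) ->
  Q 0 -> Q 1.
Proof.
move=> loc q0.
have cl (P : R -> Prop) : (forall t : R, 0 <= t <= 1 -> exists2 d : R, 0 < d &
     forall t' : R, 0 <= t' <= 1 -> `|t' - t| < d -> (P t' <-> P t)) ->
    exists2 U : set R, open U & [set t : R | 0 <= t <= 1 /\ P t] = `[0, 1]%classic `&` U.
  move=> lP; exists [set t : R | exists t0 : R, [/\ 0 <= t0 <= 1, P t0 & exists2 d : R, `|t - t0| < d &
      forall t' : R, 0 <= t' <= 1 -> `|t' - t0| < d -> P t']].
    rewrite openE => t [t0 [t01 Pt [d h1 h2]]]; rewrite /interior /= -nbhs_ballE.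
    exists (d - `|t - t0|); first by rewrite /= subr_gt0.
    move=> u /=; rewrite /ball /= => hu; exists t0; split => //; exists d => //.
    by have := ler_distD t u t0; rewrite (distrC u t); lra.
  apply/seteqP; split=> t /=; rewrite in_itv /=.
    move=> [t01 Pt]; split => //; exists t; split => //.
    have [d d0 hd] := lP t t01; exists d; first by rewrite subrr normr0.
    by move=> t' h1 h2; apply/hd.
  by move=> [t01 [t0 [_ _ [d h1 h2]]]]; split => //; exact: h2.
have [U oU eU] := cl Q loc.
have [V oV eV] : exists2 V : set R, open V & [set t : R | 0 <= t <= 1 /\ ~ Q t] = `[0, 1]%classic `&` V.
  apply: cl => t t01; have [d d0 hd] := loc t t01; exists d => // t' h1 h2.
  by have := hd t' h1 h2; tauto.
suff e : [set t : R | 0 <= t <= 1 /\ Q t] = `[0, 1]%classic.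
  have : `[0, 1]%classic (1 : R) by rewrite /= in_itv /= ler01 lexx.
  by rewrite -e => -[].
apply: (@segment_connected R 0 1 [set t : R | 0 <= t <= 1 /\ Q t]).
- by exists 0; rewrite /= lexx ler01.
- by exists U.
exists (~` V); first exact: open_closedC.
apply/seteqP; split=> t /=; rewrite in_itv /=.
  move=> [t01 Qt]; split => // Vt; have : (`[0, 1]%classic `&` V) t by split; rewrite //= in_itv.
  by rewrite -eV => -[].
move=> [t01 nV]; split => //; apply: contrapT => nQ; apply: nV.
by have : [set t : R | 0 <= t <= 1 /\ ~ Q t] t by []; rewrite eV => -[].
Qed.

End Plane.

(** * Lifting angles *)

Section Lift.
Variable R : realType.

Lemma cvg_within_comp (X : Type) (Y Z : topologicalType) (F : set_system X)
    {FF : Filter F} (C : set Y) (m : X -> Y) (f : Y -> Z) (y : Y) (l : Z) :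
  F [set t | C (m t)] -> m @ F --> y -> f @ within C (nbhs y) --> l ->
  (fun t => f (m t)) @ F --> l.
Proof.
move=> Cm my fl A hA; have h1 : nbhs y [set z | C z -> A (f z)] := fl _ hA.
have h2 : F [set t | C (m t) -> A (f (m t))] := my _ h1.
apply: (@filterS2 _ _ FF _ _ _ _ Cm h2) => t Ct h; exact: h.
Qed.

Lemma continuous_within_comp (X Y Z : topologicalType) (C : set Y) (m : X -> Y)
    (f : Y -> Z) (x : X) :
  (forall t, C (m t)) -> {for x, continuous m} ->
  f @ within C (nbhs (m x)) --> f (m x) -> {for x, continuous (fun t => f (m t))}.
Proof.
move=> Cm cm cf; apply: (cvg_within_comp (FF := nbhs_filter x) _ cm cf).
exact: nearW.
Qed.

Lemma uniform_nonzero (V : normedModType R) (C : set V) (g : V -> R * R) :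
  compact C -> {within C, continuous g} -> (forall x, C x -> g x != 0) ->
  exists2 d : R, 0 < d & forall x y, C x -> C y -> `|y - x| < d ->
    enorm (g y - g x) < enorm (g x).
Proof.
move=> /compact_near_coveringP/near_covering_withinP cC /subspace_continuousP cg g0.
have := cC R (0^'+) (fun d x => forall y, C y -> `|y - x| < d ->
  enorm (g y - g x) < enorm (g x)) _.
case=> [x Cx|d /= d0 hd]; last first.
  exists (d / 2); first by rewrite divr_gt0.
  move=> x y Cx Cy xy; apply: (hd (d / 2)) => //; last by rewrite divr_gt0.
  by rewrite /= /ball /= sub0r normrN gtr0_norm ?divr_gt0 //; lra.
have e0 := enorm_gt0 (g0 x Cx); set e := enorm (g x) in e0.
have /(cg x Cx) : nbhs (g x) [set z | enorm (z - g x) < e / 4].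
  by apply/nbhs_enorm; exists (e / 4); rewrite ?divr_gt0.
rewrite /within /= => /nbhs_normP[r /= r0 hr].
exists (ball x (r / 2), `]0, (r / 2)[%classic).
  split => /=; first by apply: nbhsx_ballx; rewrite divr_gt0.
  near=> t; rewrite /= in_itv /=; apply/andP; split; near: t.
    exact: nbhs_right_gt.
  by apply: nbhs_right_lt; rewrite divr_gt0.
move=> [x' d] /= [xx' /[!in_itv]/= /andP[d0 dr]] Cx' y Cy yx'.
move: xx'; rewrite -ball_normE /= => xx'.
have h1 : enorm (g x' - g x) < e / 4.
  by apply: hr => //=; rewrite /ball_ /=; lra.
have h2 : enorm (g y - g x) < e / 4.
  apply: hr => //=; rewrite /ball_ /=.
  have := ler_distD x' x y; rewrite (distrC x' y); lra.
have h3 := enorm_tri (g y) (g x) (g x').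
have h4 := enorm_tri (g x) (g x') 0; rewrite !subr0 -/e in h4.
rewrite (enormB (g x) (g x')) in h3 h4; lra.
Unshelve. all: by end_near. Qed.

(* Sum the small increments of the angle along the ray from x0, cut into N steps
   by uniform continuity. *)
Lemma angle_lift (V : normedModType R) (C : set V) (x0 : V) (g : V -> R * R) :
  compact C ->
  (forall x t, C x -> 0 <= t <= 1 -> C (x0 + t *: (x - x0))) ->
  {within C, continuous g} -> (forall x, C x -> g x != 0) ->
  exists2 theta : V -> R, {within C, continuous theta} &
    forall x, C x -> g x = rotate (enorm (g x), 0) (expi (theta x)).
Proof.
move=> cC star cg g0; have [d d0 hd] := uniform_nonzero cC cg g0.
move/subspace_continuousP: cg => cg.
have [M [_ hM]] := compact_bounded cC.
have M1 x : C x -> `|x - x0| <= M + 1 + `|x0|.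
  by move=> Cx; have := hM (M + 1) _ x Cx; rewrite ltrDl ltr01 => /(_ isT) /= h; have := ler_normB x x0; lra.
pose N := (Num.truncn ((M + 1 + `|x0|) / d)).+1.
have N0 : 0 < N%:R :> R by rewrite ltr0n.
have hN : (M + 1 + `|x0|) / N%:R < d.
  rewrite ltr_pdivrMr // mulrC -ltr_pdivrMr //; exact: truncnS_gt.
pose p (j : nat) x := x0 + (j%:R / N%:R) *: (x - x0).
have Cp j x : (j <= N)%N -> C x -> C (p j x).
  move=> jN Cx; apply: star => //; rewrite divr_ge0 //=.
  by rewrite ler_pdivrMr // mul1r ler_nat.
have step j x : (j < N)%N -> C x -> enorm (g (p j.+1 x) - g (p j x)) < enorm (g (p j x)).
  move=> jN Cx; apply: hd; [exact/Cp/Cx/ltnW|exact: Cp|].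
  rewrite /p opprD addrACA subrr add0r -scalerBl -mulrBl -natrB // subSnn mul1r.
  rewrite normrZ gtr0_norm ?invr_gt0 // mulrC.
  by apply: le_lt_trans hN; rewrite ler_pM2r ?invr_gt0 // M1.
pose w j x := rotate (g (p j.+1 x)) (conjp (g (p j x))).
have w1 j x : (j < N)%N -> C x -> 0 < (w j x).1.
  move=> jN Cx; have := step j x jN Cx; rewrite /w.
  set b := g (p j.+1 x); set a := g (p j x) => ab.
  have -> : rotate b (conjp a) = rotate (b - a) (conjp a) + (enorm a ^+ 2, 0).
    by rewrite enorm_sqr /rotate /conjp /=; congr pair => /=; ring.
  have a0 : 0 < enorm a by have := enorm_ge0 (b - a); lra.
  have h : enorm (b - a) * enorm a < enorm a ^+ 2 by rewrite expr2 ltr_pM2r.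
  have := enorm_fst (rotate (b - a) (conjp a)); rewrite enormM enorm_conj ler_norml.
  by rewrite /= => /andP[h1 _]; move: (enorm (b - a) * enorm a) h h1 => m; lra.
exists (fun x => arg (g x0) + \sum_(j < N) arg (w j x)).
  apply/subspace_continuousP => x Cx.
  apply: cvgD; first exact: cvg_cst.
  have cp j : (j <= N)%N -> (fun y => g (p j y)) @ within C (nbhs x) --> g (p j x).
    move=> jN; apply: (cvg_within_comp (C := C)) (cg _ (Cp j x jN Cx)).
      by rewrite /within /=; apply: nearW => y; exact: Cp.
    apply: (cvg_trans _ (_ : p j @ nbhs x --> p j x)).
      by apply: cvg_app; exact: cvg_within.
    apply: cvgD; first exact: cvg_cst.
    by apply: cvgZr; apply: cvgB => //; exact: cvg_cst.
  apply: cvg_big => [|j _]; first exact: add_continuous.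
  apply: cvg_arg.
    by have := w1 j x (ltn_ord j) Cx; have := enorm_ge0 (w j x); lra.
  apply: cvg_rotate; first exact: cp.
  by apply: cvg_conjp; apply: cp; exact: ltnW.
move=> x Cx.
have ind n : (n <= N)%N -> g (p n x) =
    rotate (enorm (g (p n x)), 0) (expi (arg (g x0) + \sum_(j < n) arg (w j x))).
  elim: n => [|n IH] nN.
    by rewrite big_ord0 addr0 /p mul0r scale0r addr0 -argK.
  rewrite big_ord_recr /= addrA expiD.
  have IHn := IH (ltnW nN).
  have a0 : enorm (g (p n x)) != 0.
    by rewrite gt_eqF // enorm_gt0 // g0 //; exact/Cp/Cx/ltnW.
  have := argK (w n x); rewrite {1 2}/w enormM enorm_conj.
  move: IHn; set e := expi (_ + _); set b := g (p n.+1 x); set a := g (p n x).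
  set f := expi (arg _) => ea eb.
  have a2 : enorm a ^+ 2 != 0 by rewrite expf_neq0.
  have : rotate (enorm a ^+ 2, 0) b =
      rotate (enorm a ^+ 2, 0) (rotate (enorm b, 0) (rotate e f)).
    transitivity (rotate (rotate b (conjp a)) a).
      by rewrite -conjpK /rotate /conjp /=; congr pair; ring.
    by rewrite eb [X in rotate _ X = _]ea /rotate /=; congr pair; ring.
  rewrite {1 2}/rotate /= => -[].
  rewrite !mul0r !add0r !subr0 => /(mulfI a2) e1 /(mulfI a2) e2.
  by rewrite [LHS]pairE e1 e2 /rotate /=; congr pair; ring.
have := ind N (leqnn N); rewrite /p divff ?gt_eqF // scale1r.
by rewrite addrC subrK.
Qed.

Lemma cong_const (f : R -> R) :
  (forall t, 0 <= t <= 1 -> {for t, continuous f}) ->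
  (forall t, 0 <= t <= 1 -> cong (f t) 0) -> f 1 = f 0.
Proof.
move=> cf c0; apply: (@locally_constant R (fun t => f t = f 0)) => // t t01.
have : nbhs (f t) [set z | `|f t - z| < pi].
  by have := nbhsx_ballx (f t) pi (pi_gt0 R); rewrite -ball_normE.
move=> /(cf t t01); rewrite /= -nbhs_ballE => -[d /= d0 hd].
exists d => // t' t01' tt'.
have : `|f t - f t'| < pi by apply: hd; rewrite /ball /= distrC.
move=> h; rewrite (_ : f t = f t') //; apply: cong_eq.
  by apply: cong_trans (c0 t t01) _; apply/cong_sym/c0.
by have := pi_gt0 R; lra.
Qed.

End Lift.

Section Simplex.
Variable R : realType.
Local Notation S n := (@std_simplex R n).
Implicit Types n : nat.

Lemma simplex_compact n : compact (S n).
Proof.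
apply: (@subclosed_compact _ _ [set v : 'rV[R]_n.+1 | forall i, `[0, 1]%classic (v ord0 i)]).
- have -> : S n = (\bigcap_i [set v : 'rV[R]_n.+1 | 0 <= v 0 i]) `&`
      [set v | \sum_i v 0 i = 1].
    by apply/seteqP; split => v [h1 h2]; split => // i; [move=> _; exact: h1|exact: h1].
  apply: closedI.
    apply: closed_bigI => i _.
    have /continuous_closedP/(_ [set r : R | 0 <= r]) := @coord_continuous R 1 n.+1 0 i.
    by apply; exact: closed_ge.
  have : continuous (fun v : 'rV[R]_n.+1 => \sum_i v 0 i).
    apply: continuous_big => [|i _]; first exact: add_continuous.
    exact: coord_continuous.
  by move=> /continuous_closedP/(_ [set 1]); apply; exact: closed_eq.
- exact: (@rV_compact R n.+1 (fun=> `[0, 1]%classic) (fun=> @segment_compact R 0 1)).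
move=> v [h1 h2] i /=; rewrite in_itv /= h1 /= -h2 (bigD1 i) //= lerDl.
by apply: sumr_ge0 => j _; exact: h1.
Qed.

Lemma simplex_convex n (x y : 'rV[R]_n.+1) t : S n x -> S n y -> 0 <= t <= 1 ->
  S n (x + t *: (y - x)).
Proof.
move=> [x0 x1] [y0 y1] /andP[t0 t1]; split=> [i|].
  by rewrite !mxE; have := x0 i; have := y0 i; nra.
under eq_bigr do rewrite !mxE.
by rewrite big_split /= -mulr_sumr sumrB x1 y1 subrr mulr0 addr0.
Qed.

Definition clamp (t : R) : R := (`|t| - `|t - 1| + 1) / 2.

Lemma clamp01 t : 0 <= clamp t <= 1.
Proof.
by rewrite /clamp; case: (ger0P t) => ?; case: (ger0P (t - 1)) => ?; apply/andP; split; lra.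
Qed.

Lemma clamp_id t : 0 <= t <= 1 -> clamp t = t.
Proof.
move=> /andP[t0 t1]; rewrite /clamp ger0_norm // ler0_norm ?subr_le0 //.
by field.
Qed.

Lemma clamp_continuous : continuous clamp.
Proof.
move=> t; apply: cvgM; last exact: cvg_cst.
apply: cvgD; last exact: cvg_cst.
apply: cvgB; first by apply: cvg_norm; exact: cvg_id.
by apply: cvg_norm; apply: cvgB; [exact: cvg_id|exact: cvg_cst].
Qed.

Lemma simplexP n (x : S n) : S n (val x).
Proof. by case: x => x /= /set_mem. Qed.

Fact simplex_path_subproof n (x y : S n) t :
  (val x + clamp t *: (val y - val x)) \in S n.
Proof. by apply/mem_set/simplex_convex; [exact: simplexP|exact: simplexP|exact: clamp01]. Qed.

Definition simplex_path n (x y : S n) t : S n :=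
  exist (fun v => v \in S n) _ (simplex_path_subproof x y t).

Lemma simplex_path0 n (x y : S n) : simplex_path x y 0 = x.
Proof. by apply: val_inj; rewrite /= clamp_id ?lexx ?ler01 // scale0r addr0. Qed.

Lemma simplex_path1 n (x y : S n) : simplex_path x y 1 = y.
Proof. by apply: val_inj; rewrite /= clamp_id ?lexx ?ler01 // scale1r addrC subrK. Qed.

Lemma continuous_simplex n (X : topologicalType) (f : X -> S n) :
  continuous (fun x => val (f x) : 'rV[R]_n.+1) -> continuous f.
Proof. by move=> h; apply/continuous_comp_initial. Qed.

Lemma simplex_path_continuous n (x y : S n) : continuous (simplex_path x y).
Proof.
apply: continuous_simplex => t /=; apply: cvgD; first exact: cvg_cst.
by apply: cvgZl; exact: clamp_continuous.
Qed.

Lemma val_simplex_continuous n : continuous (fun x : S n => val x : 'rV[R]_n.+1).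
Proof. exact: initial_continuous. Qed.

Lemma simplex_cong_const n (f : S n -> R) (x y : S n) :
  continuous f -> (forall z, cong (f z) 0) -> f x = f y.
Proof.
move=> cf c0.
have := @cong_const R (fun t => f (simplex_path y x t)).
rewrite simplex_path0 simplex_path1; apply=> // t _.
by apply: continuous_comp; [exact: simplex_path_continuous|exact: cf].
Qed.

Lemma simplex_lift n (s : S n -> R * R) :
  continuous s -> (forall x, s x != 0) ->
  exists2 theta : S n -> R, continuous theta &
    forall x, s x = rotate (enorm (s x), 0) (expi (theta x)).
Proof.
move=> cs s0.
pose g (v : 'rV[R]_n.+1) : R * R := if insub v is Some x then s x else (1, 0).
have gE (x : S n) : g (val x) = s x by rewrite /g valK.
have [||||theta ct ht] := @angle_lift R _ (S n) (val (@corner R n ord0)) g.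
- exact: simplex_compact.
- by move=> v t Sv t01; apply: simplex_convex => //; exact: simplexP.
- apply/subspace_sigL_continuousP; rewrite (_ : sigL _ g = s) //.
  by apply/funext => x; rewrite /sigL /= -gE set_valE.
- by move=> v /mem_set Sv; rewrite -[v]/(val (exist _ v Sv : S n)) gE.
exists (sigL (S n) theta); first exact/subspace_sigL_continuousP.
by move=> x; have := ht _ (simplexP x); rewrite gE /sigL /= set_valE.
Qed.

End Simplex.

(** * CW decompositions of the plane *)

Section CellComplex.
Variable R : realType.
Implicit Types x y z p q v w : R * R.

Lemma cball_compact x (r : R) : compact (cball x r).
Proof.
apply: (@subclosed_compact _ _ (`[x.1 - r, x.1 + r]%classic `*` `[x.2 - r, x.2 + r]%classic)).
- have : continuous (fun y : R * R => enorm (y - x)).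
    by move=> y; apply: cvg_enorm; apply: cvgB; [exact: cvg_id|exact: cvg_cst].
  by move=> /continuous_closedP/(_ [set s : R | s <= r]); apply; exact: closed_le.
- by apply: compact_setX; exact: segment_compact.
move=> y /= h; have h1 := enorm_fst (y - x); have h2 := enorm_snd (y - x).
have : `|y.1 - x.1| <= r by apply: le_trans h1 h.
have : `|y.2 - x.2| <= r by apply: le_trans h2 h.
by rewrite !ler_norml !in_itv /= => /andP[? ?] /andP[? ?]; split; apply/andP; split; lra.
Qed.

Lemma plane_hausdorff : hausdorff_space (R * R)%type.
Proof. exact: norm_hausdorff. Qed.

Lemma cdisc_compact k : compact (@cdisc R k).
Proof.
have -> : @cdisc R k = [set v : 'rV[R]_k | forall i, `[-1, 1]%classic (v ord0 i)].
  by apply/seteqP; split => v h i; have := h i; rewrite /= in_itv /= ler_norml.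
exact: (@rV_compact R k (fun=> `[-1, 1]%classic) (fun=> @segment_compact R (-1) 1)).
Qed.

Lemma rV_continuous (X : topologicalType) k (f : X -> 'rV[R]_k) (x : X) :
  (forall j, (fun t => f t 0 j) @ x --> f x 0 j) -> f @ x --> f x.
Proof.
move=> h A /= [P hP sP]; rewrite /nbhs /=.
have : \forall t \near x, forall i j, P i j (f t i j).
  apply: filter_forall => i; apply: filter_forall => j.
  by have := hP i j; rewrite (ord1 i) => /h.
by apply: filterS => t ht; apply: sP.
Qed.

(* Borsuk-Ulam on the 2-sphere, the sphere being embedded in the open k-cube. *)
Lemma no_planar_cube k (Phi : 'rV[R]_k.+3 -> R * R) :
  {within @cdisc R k.+3, continuous Phi} ->
  {in @odisc R k.+3 &, injective Phi} -> False.
Proof.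
move=> /subspace_continuousP cPhi inj.
pose h x : 'rV[R]_k.+3 := \row_j (2^-1 * (if val j == 0%N then x.1 else
  if val j == 1%N then x.2 else if val j == 2%N then 1 - (x.1 ^+ 2 + x.2 ^+ 2) else 0)).
have ho x : enorm x <= 1 -> forall i, `|h x 0 i| < 1.
  move=> hx i; have h1 := enorm_fst x; have h2 := enorm_snd x.
  have := enorm_sqr x; have := enorm_ge0 x; rewrite mxE normrM ger0_norm ?invr_ge0 // => h0 h3.
  rewrite mulrC ltr_pdivrMr // mul1r; case: ifP => _; first by lra.
  case: ifP => _; first by lra.
  case: ifP => _; last by rewrite normr0.
  by rewrite ltr_norml -h3; apply/andP; split; nra.
have hc x : enorm x <= 1 -> cdisc (h x) by move=> hx i; exact/ltW/ho.
have hn x : enorm x <= 1 -> cdisc (- h x) by move=> hx i; rewrite mxE normrN; exact/ltW/ho.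
have hoi x : enorm x <= 1 -> h x \in @odisc R k.+3 by move=> hx; apply/mem_set => i; exact: ho.
have hni x : enorm x <= 1 -> - h x \in @odisc R k.+3.
  by move=> hx; apply/mem_set => i; rewrite mxE normrN; exact: ho.
have hcont x : h @ x --> h x.
  have f1 := @cvg_fst_pair _ _ _ (nbhs_filter x) id x cvg_id.
  have f2 := @cvg_snd_pair _ _ _ (nbhs_filter x) id x cvg_id.
  apply: rV_continuous => j; rewrite mxE; under eq_fun do rewrite mxE.
  apply: cvgM; first exact: cvg_cst.
  case: ifP => _ //; case: ifP => _ //; case: ifP => _; last exact: cvg_cst.
  apply: cvgB; first exact: cvg_cst.
  by apply: cvgD; apply: (@continuous_cvg _ _ _ _ _ _ (fun t : R => t ^+ 2)) => //;
    exact: exprn_continuous.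
have cont (m : R * R -> 'rV[R]_k.+3) x : (forall x, enorm x <= 1 -> cdisc (m x)) ->
    (forall x, m @ x --> m x) -> enorm x <= 1 ->
    (fun t => Phi (m t)) @ within [set x | enorm x <= 1] (nbhs x) --> Phi (m x).
  move=> mc cm hx; apply: (cvg_within_comp (C := @cdisc R k.+3)) (cPhi _ (mc x hx)).
    by rewrite /within /=; apply: nearW => y; exact: mc.
  by apply: cvg_trans (cm x); apply: cvg_app; exact: cvg_within.
pose f x := Phi (h x) - Phi (- h x).
pose C := cball (0 : R * R) 1.
have CE x : C x <-> enorm x <= 1 by rewrite /C /cball /= subr0.
have C' : C = [set x | enorm x <= 1] by apply/seteqP; split => x /CE.
have [||||theta /subspace_continuousP ct ht] := @angle_lift R _ C 0 f.
- exact: cball_compact.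
- move=> x t /CE hx /andP[t0 t1]; apply/CE; rewrite subr0 add0r.
  rewrite /enorm /= !exprMn_comm ?/GRing.comm 1?mulrC //.
  have -> : (x.1 ^+ 2 * t ^+ 2 + t ^+ 2 * x.2 ^+ 2) = t ^+ 2 * (x.1 ^+ 2 + x.2 ^+ 2) by ring.
  rewrite sqrtrM ?sqr_ge0 // sqrtr_sqr ger0_norm //.
  by move: hx; rewrite /enorm; have := sqrtr_ge0 (x.1 ^+ 2 + x.2 ^+ 2); nra.
- apply/subspace_continuousP => x /CE hx; rewrite C'.
  apply: cvgB; apply: cont => //; move=> y; apply: cvgN; exact: hcont.
- move=> x /CE hx; rewrite subr_eq0; apply/eqP => e.
  have : h x = - h x by apply: inj => //; [exact: hoi|exact: hni].
  move/matrixP => hh.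
  have e0 := hh 0 (@Ordinal k.+3 0 isT); have e1 := hh 0 (@Ordinal k.+3 1 isT).
  have e2 := hh 0 (@Ordinal k.+3 2 isT); rewrite !mxE /= in e0 e1 e2.
  have x1 : x.1 = 0 by lra.
  have x2 : x.2 = 0 by lra.
  by move: e2; rewrite x1 x2 expr0n /= !addr0 subr0 mulr1; clear; lra.
have en t : C (expi t) by apply/CE; rewrite enorm_expi.
pose D t := theta (expi (pi * t + pi)) - theta (expi (pi * t)) - pi.
have ctn (g : R -> R) t : {for t, continuous g} ->
    {for t, continuous (fun t => theta (expi (g t)))}.
  move=> cg; apply: (@continuous_within_comp _ _ _ C (fun t => expi (g t)) theta) => //.
    by apply: (@continuous_comp _ _ _ g (@expi R)) => //; exact: expi_continuous.
  exact: (ct _ (en (g t))).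
have cD t : {for t, continuous D}.
  have c0 : {for t, continuous (fun t : R => pi * t)} by apply: mulrl_continuous.
  have c1 := ctn _ t c0.
  have c2 : {for t, continuous (fun t : R => pi * t + pi)}.
    by apply: (@continuousD _ _ _ _ (cst pi)) c0 _; exact: cst_continuous.
  have c3 := ctn _ t c2.
  by apply: cvgB; [apply: cvgB; [exact: c3|exact: c1]|exact: cvg_cst].
have expiDpi t : expi (t + pi) = - expi t :> R * R.
  by rewrite /expi cosDpi sinDpi.
have D0 t : cong (D t) 0.
  rewrite /D; set s := pi * t.
  have e1 : enorm (expi s) = 1 by rewrite enorm_expi.
  have fodd : f (expi (s + pi)) = - f (expi s).
    rewrite /f expiDpi; have -> : h (- expi s) = - h (expi s).
      apply/rowP => j; rewrite !mxE /= !sqrrN cos2Dsin2 subrr.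
      by case: ifP => _; [rewrite mulrN|case: ifP => _; [rewrite mulrN|case: ifP => _; rewrite mulr0 oppr0]].
    by rewrite opprK opprB.
  have h1 := ht _ (en s); have h2 := ht _ (en (s + pi)).
  move: h2; rewrite fodd enormN {1}h1 => h2.
  have fn : enorm (f (expi s)) != 0.
    rewrite gt_eqF // enorm_gt0 //; apply/eqP => e.
    have : h (expi s) = - h (expi s).
      apply: inj; [by apply: hoi; rewrite e1|by apply: hni; rewrite e1|].
      by apply/eqP; rewrite -subr_eq0; exact/eqP.
    move/matrixP => hh.
    have e0 := hh 0 (@Ordinal k.+3 0 isT); have e3 := hh 0 (@Ordinal k.+3 1 isT).
    rewrite !mxE /= in e0 e3; have := cos2Dsin2 s.
    have -> : cos s = 0 by lra.
    have -> : sin s = 0 by lra.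
    by rewrite expr0n /= addr0 => /eqP; rewrite eq_sym oner_eq0.
  have : expi (theta (expi (s + pi))) = expi (theta (expi s) + pi).
    rewrite expiDpi; move: h2; set a := expi (theta _); set b := expi (theta (expi s)).
    rewrite /rotate /= => -[]; rewrite !mul0r !add0r !subr0 -!mulrN.
    by move=> /(mulfI fn) e2 /(mulfI fn) e3; rewrite [LHS]/expi -e2 -e3.
  move=> /expi_cong[l e]; exists l; rewrite -e; ring.
have : D 1 = D 0 by apply: cong_const => t _; [exact: cD|exact: D0].
have [l] := D0 0; rewrite /D mulr0 mulr1 add0r expiDpi.
have -> : expi pi = - expi 0 :> R * R by rewrite -expiDpi add0r.
rewrite opprK; move: (theta _) (theta _) => a b e1 e2.
have : (- 1 : R) = 2 * l%:~R.
  have p0 : pi != 0 :> R by rewrite gt_eqF ?pi_gt0.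
  by apply: (mulfI p0); rewrite mulrA (mulrC pi 2) -e1; lra.
rewrite -[2]/(2%:~R) -[-1]/((-1)%:~R) -intrM => /eqP; rewrite eqr_int; lia.
Qed.

End CellComplex.
Section Cells.
Variables (R : realType) (K : cells R).
Hypothesis KCW : CW_decomposition K.
Implicit Types (x y z p q v w : R * R) (c e : set (R * R)).

Lemma cell_eq k e k' e' x : K k e -> K k' e' -> e x -> e' x -> k = k' /\ e = e'.
Proof.
by case: KCW => _ h _ _ Ke Ke' ex e'x; apply: h => //; exists x.
Qed.

Lemma cell_dim k e : K k e -> (k <= 2)%N.
Proof.
case: KCW => _ _ hchar _ Ke; have [Phi [cPhi _ [Psi _ can] _]] := hchar _ _ Ke.
rewrite leqNgt; apply/negP => k3.
have ek : k = (k - 3).+3 by lia.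
move: Phi cPhi Psi can {Ke}; rewrite ek => Phi cPhi Psi can.
exact: (no_planar_cube cPhi (can_in_inj can)).
Qed.

Lemma cell_cover x : exists k, exists2 e, K k e & e x.
Proof. by case: KCW. Qed.

Lemma cell_nonempty k e : K k e -> e !=set0.
Proof.
case: KCW => _ _ hchar _ Ke; have [Phi [_ <- _ _]] := hchar _ _ Ke.
by exists (Phi 0), 0 => // i; rewrite mxE normr0.
Qed.

Lemma cell0 e : K 0 e -> exists2 v, vertex K v & e = [set v].
Proof.
case: KCW => _ _ hchar _ Ke; have [Phi [_ he _ _]] := hchar _ _ Ke.
suff ee : e = [set Phi 0] by exists (Phi 0); rewrite /vertex -?ee.
rewrite -he; apply/seteqP; split => [_ [a _ <-]|_ ->].
  by congr Phi; apply/rowP => -[].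
by exists 0 => // -[].
Qed.

Lemma closure_cell k e : K k e -> exists2 F : set (set (R * R)), finite_set F &
  (forall e', F e' -> exists j, K j e') /\ closure e `<=` \bigcup_(e' in F) e'.
Proof.
case: KCW => _ _ hchar _ Ke; have [Phi [cPhi he _ [F fF [hF bF]]]] := hchar _ _ Ke.
exists (e |` F); first by rewrite finite_setU; split => //; exact: finite_set1.
split=> [e' [->|/hF[j _ Kj]]|]; [by exists k|by exists j|].
have cl : closed (Phi @` @cdisc R k).
  apply: compact_closed; first exact: plane_hausdorff.
  exact: continuous_compact cPhi (@cdisc_compact R k).
have sub : e `<=` Phi @` @cdisc R k.
  by rewrite -he => _ [a ha <-]; exists a => // i; exact/ltW/ha.
move=> x /(closure_subset sub); rewrite -(closure_id _).1 // => -[a ca <-].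
have [oa|oa] := pselect (odisc a).
  by exists e; [left|rewrite -he; exists a].
by have [e' Fe' h] := bF (Phi a) (ex_intro2 _ _ a (conj ca oa) erefl); exists e' => //; right.
Qed.

Lemma cells_finite (A : set (R * R)) : compact A ->
  finite_set [set e | (exists k, K k e) /\ e `&` A !=set0].
Proof.
move=> cA; set E := [set e | _].
pose pt e : R * R := xget 0 (e `&` A).
have ptP e : E e -> (e `&` A) (pt e) by move=> [_ [x ex]]; exact: (xgetPex 0 (ex_intro _ x ex)).
have ptinj e e' : E e -> E e' -> pt e = pt e' -> e = e'.
  move=> Ee Ee' h; have [[k Ke] _] := Ee; have [[k' Ke'] _] := Ee'.
  have [ep _] := ptP e Ee; have [e'p _] := ptP e' Ee'; rewrite -h in e'p.
  by have [] := cell_eq Ke Ke' ep e'p.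
have clB (B : set (R * R)) : B `<=` pt @` E -> closed B.
  move=> BE; case: KCW => _ _ _; apply => k e Ke.
  have [F fF [hF cF]] := closure_cell Ke.
  apply: compact_closed; first exact: plane_hausdorff.
  apply: finite_compact.
  apply: (@sub_finite_set _ _ (pt @` F)); last exact: finite_image.
  move=> x [Bx /cF[e' Fe' e'x]]; have [e'' Ee'' ex] := BE x Bx.
  exists e' => //; rewrite -ex; congr pt.
  have [j Kj] := hF _ Fe'; have [[j' Kj'] _] := Ee''.
  have [e''p _] := ptP _ Ee''; rewrite ex in e''p.
  by have [] := cell_eq Kj Kj' e'x e''p.
have fB : finite_set (pt @` E).
  have nc := (compact_near_coveringP A).1 cA.
  pose F (Q : set (set (R * R))) :=
    exists2 D0, finite_set D0 & forall D, finite_set D -> D0 `<=` D -> Q D.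
  have FF : Filter F.
    split; first by exists set0; [exact: finite_set0|].
      move=> Q1 Q2 [D1 f1 h1] [D2 f2 h2]; exists (D1 `|` D2); first by rewrite finite_setU.
      by move=> D fD sD; split; [apply: h1|apply: h2] => // x Dx; apply: sD; [left|right].
    by move=> Q1 Q2 sQ [D1 f1 h1]; exists D1 => // D fD sD; apply/sQ/h1.
  have [x Ax|D0 f0 /(_ D0 f0 (fun=> id)) h] :=
      nc _ F (fun D x => (pt @` E) x -> D x) FF.
    exists (~` (pt @` E `\ x), [set D : set (R * R) | D x]) => /=.
      split; last by exists [set x]; [exact: finite_set1|move=> D _; exact].
      apply: open_nbhs_nbhs; split; last by move=> -[_ /=].
      by apply: closed_openC; apply: clB => y [].
    move=> [y D] /= [hy Dx] By; have -> : y = x; last by [].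
    by apply: contrapT => yx; apply: hy.
  apply: sub_finite_set f0 => x Bx; apply: h => //.
  by case: Bx => e Ee <-; case: (ptP e Ee).
have := finite_image (fun x => xget set0 [set e | E e /\ pt e = x]) fB.
apply: sub_finite_set => e Ee; exists (pt e); first by exists e.
have h : [set e' | E e' /\ pt e' = pt e] e by split.
by have [h1 h2] := xgetPex set0 (ex_intro _ e h); exact: ptinj.
Qed.

Lemma min_pos (I : choiceType) (A : set I) (Q : I -> R -> Prop) : finite_set A ->
  (forall i (r s : R), Q i r -> 0 < s <= r -> Q i s) ->
  (forall i, A i -> exists2 r : R, 0 < r & Q i r) ->
  exists2 r : R, 0 < r & forall i, A i -> Q i r.
Proof.
move=> /finite_seqP[X ->] mono.
elim: X => [|i s IH] h; first by exists 1.
have [|r r0 hr] := IH; first by move=> j js; apply: h; rewrite /= inE [j \in s]js orbT.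
have [|t t0 ht] := h i; first by rewrite /= mem_head.
exists (Num.min r t); first by rewrite lt_min r0.
move=> j; rewrite /= inE => /orP[/eqP ->|js].
  by apply: mono ht _; rewrite lt_min r0 t0 ge_min lexx orbT.
by apply: mono (hr j js) _; rewrite lt_min r0 t0 ge_min lexx.
Qed.

Lemma star_nbhd x : exists2 r : R, 0 < r & forall k e y, K k e ->
  e y -> enorm (y - x) < r -> closure e x.
Proof.
have [||r r0 hr] := @min_pos _ _ (fun e r => closure e x \/ forall y, e y -> r <= enorm (y - x))
    (cells_finite (@cball_compact R x 1)).
- move=> e r s [?|h] /andP[s0 sr]; [by left|right => y ey].
  exact: le_trans sr (h y ey).
- move=> e _; have [cx|cx] := pselect (closure e x); first by exists 1 => //; left.
  have : exists r : R, ~ (0 < r -> exists2 y, e y & enorm (y - x) < r).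
    by apply/existsNP => h; apply: cx; exact/closure_enorm.
  move=> [r /not_implyP[r0 h]]; exists r => //; right => y ey.
  by rewrite leNgt; apply/negP => hy; apply: h; exists y.
exists (Num.min r 1); first by rewrite lt_min r0 ltr01.
move=> k e y Ke ey; rewrite lt_min => /andP[y1 y2].
have [|//|h] := hr e; last by have := h y ey; rewrite leNgt y1.
by split; [exists k|exists y; split => //; exact: ltW].
Qed.

End Cells.

(** * Segments *)

Section Segments.
Variable R : realType.
Implicit Types (x y z p q v w a b : R * R).

(* Coordinates along and across the segment from v to w, scaled by its length. *)
Definition pt v w (t n : R) : R * R := v + rotate (t, n) (w - v).

Lemma lerp_pt v w t : lerp v w t = pt v w t 0.
Proof. by rewrite /lerp /pt /rotate /=; congr pair => /=; ring. Qed.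

Lemma oseg_pt v w x : oseg v w x <-> exists2 t, 0 < t < 1 & x = pt v w t 0.
Proof.
split=> [[t /=]|[t t01 ->]].
  by rewrite in_itv /= => t01 <-; exists t => //; rewrite lerp_pt.
by exists t; rewrite /= ?in_itv // lerp_pt.
Qed.

Lemma cseg_pt v w x : cseg v w x <-> exists2 t, 0 <= t <= 1 & x = pt v w t 0.
Proof.
split=> [[t /=]|[t t01 ->]].
  by rewrite in_itv /= => t01 <-; exists t => //; rewrite lerp_pt.
by exists t; rewrite /= ?in_itv // lerp_pt.
Qed.

Lemma pt_sub v w t n t' n' :
  pt v w t n - pt v w t' n' = rotate (t - t', n - n') (w - v).
Proof. by rewrite /pt /rotate /=; congr pair => /=; ring. Qed.

Lemma pt_dist v w t n t' n' :
  enorm (pt v w t n - pt v w t' n') = enorm (t - t', n - n') * enorm (w - v).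
Proof. by rewrite pt_sub enormM. Qed.

Lemma pt_inj v w t n t' n' : v != w -> pt v w t n = pt v w t' n' -> t = t' /\ n = n'.
Proof.
move=> vw e; have : enorm (pt v w t n - pt v w t' n') = 0 by rewrite e subrr enorm0.
rewrite pt_dist => /eqP; rewrite mulf_eq0 => /orP[/eqP/enorm_eq0[]|/eqP/enorm_eq0].
  by split; lra.
by move=> /eqP; rewrite subr_eq0 eq_sym (negbTE vw).
Qed.

Lemma pt_surj v w x : v != w -> exists t n, x = pt v w t n.
Proof.
move=> vw; pose d := w - v.
have d0 : enorm d ^+ 2 != 0 by rewrite expf_neq0 // gt_eqF // enorm_gt0 // subr_eq0 eq_sym.
pose q := rotate (x - v) (conjp d).
exists (q.1 / enorm d ^+ 2), (q.2 / enorm d ^+ 2).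
rewrite /pt -/d -[x in LHS](subrK v) addrC; congr (v + _).
rewrite [LHS]pairE /rotate /q /conjp /=; move: d0; rewrite enorm_sqr => d0.
by congr pair; rewrite /rotate /conjp /=; field.
Qed.

Lemma pt0 v w : pt v w 0 0 = v.
Proof. by rewrite /pt /rotate /=; rewrite [RHS]pairE; congr pair => /=; ring. Qed.

Lemma pt1 v w : pt v w 1 0 = w.
Proof. by rewrite /pt /rotate /=; rewrite [RHS]pairE; congr pair => /=; ring. Qed.

Lemma pt_swap v w t n : pt w v t n = pt v w (1 - t) (- n).
Proof. by rewrite /pt /rotate /=; congr pair => /=; ring. Qed.

Lemma pt_act (g : motion R) v w t n : act g (pt v w t n) = pt (act g v) (act g w) t n.
Proof. by rewrite /pt act_sub /act /rotate /=; congr pair => /=; ring. Qed.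

Lemma lerp_lerp_pt v w t n t' n' s :
  lerp (pt v w t n) (pt v w t' n') s = pt v w (t + s * (t' - t)) (n + s * (n' - n)).
Proof. by rewrite /lerp /pt /rotate /=; congr pair => /=; ring. Qed.

Lemma pt_swap0 v w t : pt v w t 0 = pt w v (1 - t) 0.
Proof. by rewrite pt_swap oppr0. Qed.

Lemma oseg_sub v w : oseg v w `<=` oseg w v.
Proof.
move=> x /oseg_pt[t /andP[t0 t1] ->]; apply/oseg_pt; exists (1 - t); last exact: pt_swap0.
by apply/andP; split; lra.
Qed.

Lemma oseg_sym v w : oseg v w = oseg w v.
Proof. by apply/seteqP; split; exact: oseg_sub. Qed.

Lemma cseg_cases v w x : cseg v w x -> [\/ x = v, x = w | oseg v w x].
Proof.
move=> /cseg_pt[t /andP[t0 t1] ->].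
move: t0; rewrite le_eqVlt => /orP[/eqP <-|t0]; first by rewrite pt0; constructor 1.
move: t1; rewrite le_eqVlt => /orP[/eqP ->|t1]; first by rewrite pt1; constructor 2.
by constructor 3; apply/oseg_pt; exists t; rewrite ?t0.
Qed.

Lemma oseg_cseg v w : oseg v w `<=` cseg v w.
Proof. by move=> x /oseg_pt[t t01 ->]; apply/cseg_pt; exists t => //; lra. Qed.

Lemma cseg_left v w : cseg v w v.
Proof. by apply/cseg_pt; exists 0; rewrite ?pt0 //; lra. Qed.

Lemma cseg_right v w : cseg v w w.
Proof. by apply/cseg_pt; exists 1; rewrite ?pt1 //; lra. Qed.

Lemma continuous_pair (f g : R -> R) : continuous f -> continuous g ->
  continuous (fun t => (f t, g t) : R * R).
Proof. by move=> cf cg t; apply: cvg_pairP; [exact: cf|exact: cg]. Qed.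

Lemma lerp_continuous v w : continuous (lerp v w).
Proof.
move=> t; apply: cvg_pairP => /=; apply: cvgD; apply: cvgM; do ?exact: cvg_cst;
  do ?exact: cvg_id; by apply: cvgB; [exact: cvg_cst|exact: cvg_id].
Qed.

Lemma closure_oseg v w : closure (oseg v w) = cseg v w.
Proof.
apply/seteqP; split.
  have cl : closed (cseg v w).
    apply: compact_closed; first exact: plane_hausdorff.
    apply: continuous_compact; last exact: segment_compact.
    by apply: continuous_subspaceT; exact: lerp_continuous.
  by move=> x /(closure_subset (@oseg_cseg v w)); rewrite -(closure_id _).1.
move=> x /cseg_pt[t t01 ->]; apply/closure_enorm => e e0.
pose s := Num.min 2^-1 (e / (2 * (enorm (w - v) + 1))).
have n0 := enorm_ge0 (w - v); have d0 : 0 < 2 * (enorm (w - v) + 1) by lra.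
have s0 : 0 < s by rewrite lt_min invr_gt0 ltr0n divr_gt0.
have s1 : s <= 2^-1 by rewrite ge_min lexx.
have s2 : s <= e / (2 * (enorm (w - v) + 1)) by rewrite ge_min lexx orbT.
rewrite ler_pdivlMr // in s2.
exists (pt v w (t + s * (2^-1 - t)) 0); first by apply/oseg_pt; exists (t + s * (2^-1 - t)) => //; nra.
rewrite pt_dist subrr (addrC t) addrK /enorm /= expr0n addr0 sqrtr_sqr normrM gtr0_norm //.
have : `|2^-1 - t| <= 1 by rewrite ler_norml; lra.
have := normr_ge0 (2^-1 - t); rewrite -/(enorm (w - v)).
move: (`|_|) (enorm _) n0 d0 s2 => u N n0 d0 s2 u0 u1.
have h : s * u * N <= s * N by rewrite -mulrA ler_pM2l // ler_piMl.
have h' : 0 <= s * N by rewrite mulr_ge0 // ltW.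
have e1 : s * (2 * (N + 1)) = 2 * (s * N) + 2 * s by ring.
by rewrite e1 in s2; move: (s * u * N) (s * N) h h' s2 => p q; lra.
Qed.

Lemma oseg_inj v w a b : v != w -> oseg v w = oseg a b ->
  (v = a /\ w = b) \/ (v = b /\ w = a).
Proof.
move=> vw e.
have e' : cseg v w = cseg a b by rewrite -!closure_oseg e.
have nv : ~ oseg a b v.
  by rewrite -e => /oseg_pt[t t01]; rewrite -{1}(pt0 v w) => /(pt_inj vw)[]; lra.
have nw : ~ oseg a b w.
  by rewrite -e => /oseg_pt[t t01]; rewrite -{1}(pt1 v w) => /(pt_inj vw)[]; lra.
have := cseg_left v w; rewrite e' => /cseg_cases[va|vb|//];
  have := cseg_right v w; rewrite e' => /cseg_cases[wa|wb|//]; first [by left|by right|idtac].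
  by rewrite va wa eqxx in vw.
by rewrite vb wb eqxx in vw.
Qed.

Lemma oseg_mid v w : oseg v w (pt v w 2^-1 0).
Proof. by apply/oseg_pt; exists 2^-1 => //; lra. Qed.

Lemma conv_itv (l h s t u : R) : l < s < h -> l < t < h -> 0 <= u <= 1 ->
  l < s + u * (t - s) < h.
Proof.
move=> /andP[ls sh] /andP[lt th] /andP[u0 u1].
have [st|ts] := leP s t.
  have h1 : 0 <= u * (t - s) by rewrite mulr_ge0 // subr_ge0.
  have h2 : u * (t - s) <= t - s by rewrite ler_piMl // subr_ge0.
  by apply/andP; split; lra.
have h1 : 0 <= u * (s - t) by rewrite mulr_ge0 // subr_ge0 ltW.
have h2 : u * (s - t) <= s - t by rewrite ler_piMl // subr_ge0 ltW.
have e : u * (t - s) = - (u * (s - t)) by ring.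
by rewrite e; apply/andP; split; lra.
Qed.

Definition pol v (r t : R) : R * R := v + rotate (r, 0) (expi t).

Lemma polE v x : x = pol v (enorm (x - v)) (arg (x - v)).
Proof. by rewrite /pol -argK addrC subrK. Qed.

Lemma pol_cong v r s t : cong s t -> pol v r s = pol v r t.
Proof. by move=> /expi_cong e; rewrite /pol e. Qed.

Lemma pol_dist v (r t : R) : 0 <= r -> enorm (pol v r t - v) = r.
Proof.
move=> r0; rewrite /pol addrC addrA addNr add0r enormM enorm_expi mulr1.
by rewrite /enorm /= expr0n addr0 sqrtr_sqr ger0_norm.
Qed.

Lemma arg_pol v (r t : R) : 0 < r -> cong (arg (pol v r t - v)) t.
Proof.
move=> r0; apply/expi_cong.
rewrite /pol addrC addrA addNr add0r arg_scale // expi_arg //.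
exact: enorm_expi.
Qed.

Lemma pt_pol v w t n : 
  pt v w t n = pol v (enorm (t, n) * enorm (w - v)) (arg (w - v) + arg (t, n)).
Proof.
rewrite /pt /pol; congr (v + _).
rewrite {1}(argK (t, n)) {1}(argK (w - v)) expiD.
by rewrite /rotate /=; congr pair; ring.
Qed.

End Segments.

(** * Edges and the faces beside them *)

Section Edges.
Variables (R : realType) (K : cells R).
Hypothesis KCW : CW_decomposition K.
Hypothesis Kstraight : straight_edges K.
Hypothesis Kpolygonal : polygonal_faces K.
Implicit Types (x y z p q v w a b : R * R) (c e : set (R * R)).

Lemma edge_vertex v w : edge K v w -> vertex K v /\ vertex K w.
Proof.
move=> [vw /Kstraight[a [b [Ka Kb _ e]]]].
by case: (oseg_inj vw e) => -[-> ->].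
Qed.

Lemma edge_sym v w : edge K v w -> edge K w v.
Proof. by move=> [vw Ke]; split; [rewrite eq_sym|rewrite oseg_sym]. Qed.

Lemma edge_cellP e : K 1 e -> exists v w, edge K v w /\ e = oseg v w.
Proof. by move=> /Kstraight[a [b [_ _ h ->]]]; exists a, b. Qed.

Lemma edge_inj v w w' : edge K v w -> edge K v w' -> oseg v w = oseg v w' -> w = w'.
Proof.
move=> [vw _] [vw' _] /(oseg_inj vw)[[_ ->]//|[e _]].
by rewrite e eqxx in vw'.
Qed.

Lemma face_open c : K 2 c -> open c.
Proof. by move=> /Kpolygonal[]. Qed.

Lemma cell_cases x :
  [\/ vertex K x, (exists v w, edge K v w /\ oseg v w x) | (exists2 c, K 2 c & c x)].
Proof.
have [k [e Ke ex]] := cell_cover KCW x; have := cell_dim KCW Ke.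
case: k Ke => [|[|[|//]]] Ke _.
- by have [v Kv ev] := cell0 KCW Ke; move: ex; rewrite ev => ->; constructor 1.
- by have [v [w [h ev]]] := edge_cellP Ke; constructor 2; exists v, w; rewrite -ev.
- by constructor 3; exists e.
Qed.

Lemma face_uniq c c' x : K 2 c -> K 2 c' -> c x -> c' x -> c = c'.
Proof. by move=> Kc Kc' cx c'x; have [] := cell_eq KCW Kc Kc' cx c'x. Qed.

Lemma face_vertexN c x : K 2 c -> c x -> ~ vertex K x.
Proof. by move=> Kc cx Kx; have [] := cell_eq KCW Kc Kx cx (erefl x). Qed.

Lemma face_edgeN c x v w : K 2 c -> c x -> edge K v w -> ~ oseg v w x.
Proof. by move=> Kc cx [_ Ke] ex; have [] := cell_eq KCW Kc Ke cx ex. Qed.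

Lemma edge_vertexN v w x : edge K v w -> oseg v w x -> ~ vertex K x.
Proof. by move=> [_ Ke] ex Kx; have [] := cell_eq KCW Ke Kx ex (erefl x). Qed.

Lemma edge_uniq v w a b x : edge K v w -> edge K a b -> oseg v w x -> oseg a b x ->
  oseg v w = oseg a b.
Proof. by move=> [_ Ke] [_ Ke'] ex e'x; have [] := cell_eq KCW Ke Ke' ex e'x. Qed.

Lemma face_path c (g : R -> R * R) : continuous g ->
  (forall t, 0 <= t <= 1 -> exists2 c', K 2 c' & c' (g t)) ->
  K 2 c -> c (g 0) -> c (g 1).
Proof.
move=> cg hg Kc; apply: (@locally_constant R (fun t => c (g t))) => t t01.
have [c' Kc' c't] := hg t t01.
have : nbhs (g t) c' by apply: open_nbhs_nbhs; split => //; exact: face_open.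
move=> /(cg t); rewrite /= -nbhs_ballE => -[d /= d0 hd]; exists d => // t' t'01 tt'.
have c't' : c' (g t') by apply: hd; rewrite /ball /= distrC.
by split=> h; [rewrite (face_uniq Kc Kc' h c't')|rewrite (face_uniq Kc Kc' h c't)].
Qed.

Lemma face_segment c x y : (forall t, 0 <= t <= 1 -> exists2 c', K 2 c' & c' (lerp x y t)) ->
  K 2 c -> c x -> c y.
Proof.
move=> h Kc cx; have := @face_path c (lerp x y) (@lerp_continuous R x y) h Kc.
by rewrite !lerp_pt pt0 pt1; apply.
Qed.

Lemma edge_star v w t : edge K v w -> 0 < t < 1 ->
  exists2 d : R, 0 < d & forall t' n, `|t' - t| < d -> `|n| < d -> n != 0 ->
    exists2 c, K 2 c & c (pt v w t' n).
Proof.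
move=> Ke t01; have [r r0 hr] := star_nbhd KCW (pt v w t 0).
have [vw Kvw] := Ke; have [Kv Kw] := edge_vertex Ke.
have n0 : 0 < enorm (w - v) by rewrite enorm_gt0 // subr_eq0 eq_sym.
have ex : oseg v w (pt v w t 0) by apply/oseg_pt; exists t.
exists (r / (2 * enorm (w - v))); first by rewrite divr_gt0 // mulr_gt0.
move=> t' n ht hn nn0.
have near : enorm (pt v w t' n - pt v w t 0) < r.
  rewrite pt_dist subr0 -ltr_pdivlMr //.
  apply: (le_lt_trans (enorm_le _)) => /=.
  have -> : r / enorm (w - v) = r / (2 * enorm (w - v)) + r / (2 * enorm (w - v)).
    by field; rewrite gt_eqF.
  exact: ltrD.
have [Kx|[a [b [Kab abx]]]|//] := cell_cases (pt v w t' n); exfalso.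
  have := hr _ _ _ Kx erefl near.
  rewrite -(closure_id _).1; first by move=> /= e; apply: (edge_vertexN Ke ex); rewrite e.
  by apply: compact_closed; [exact: plane_hausdorff|exact: compact_set1].
have := hr _ _ _ Kab.2 abx near; rewrite closure_oseg => /cseg_cases[e|e|h].
- by have [Ka _] := edge_vertex Kab; apply: (edge_vertexN Ke ex); rewrite e.
- by have [_ Kb] := edge_vertex Kab; apply: (edge_vertexN Ke ex); rewrite e.
move: abx; rewrite -(edge_uniq Ke Kab ex h) => /oseg_pt[s _ /(pt_inj vw)[_ e]].
by rewrite e eqxx in nn0.
Qed.

Lemma edge_half (s : R) v w t : s = 1 \/ s = -1 -> edge K v w -> 0 < t < 1 ->
  exists2 d : R, 0 < d & exists2 c, K 2 c &
    forall t' n, `|t' - t| < d -> 0 < n < d -> c (pt v w t' (s * n)).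
Proof.
move=> s1 Ke t01; have [d d0 hd] := edge_star Ke t01.
have ns n : 0 < n < d -> `|s * n| < d /\ s * n != 0.
  move=> /andP[n0 nd]; case: s1 => ->; rewrite ?mul1r ?mulN1r ?normrN gtr0_norm //;
  by split => //; rewrite ?oppr_eq0 gt_eqF.
have [|h1 h2] := ns (d / 2); first by apply/andP; split; lra.
have [|c Kc cx] := hd t (s * (d / 2)) _ h1 h2; first by rewrite subrr normr0.
exists d => //; exists c => // t' n ht hn.
apply: face_segment Kc cx => u /andP[u0 u1]; rewrite lerp_lerp_pt.
have e : s * (d / 2) + u * (s * n - s * (d / 2)) = s * (d / 2 + u * (n - d / 2)) by ring.
rewrite e; have /andP[n0 nd] := hn; have [|k1 k2] := ns (d / 2 + u * (n - d / 2)).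
  by apply/andP; split; nra.
apply: hd => //; rewrite addrC addrA addNr add0r normrM ger0_norm //.
by have := normr_ge0 (t' - t); nra.
Qed.

Lemma beside_uniq (s : R) v w c c' : K 2 c -> K 2 c' -> beside s v w c -> beside s v w c' -> c = c'.
Proof.
move=> Kc Kc' [d d0 hd] [d' d'0 hd'].
pose t := Num.min d d' / 2.
have m0 : 0 < Num.min d d' by rewrite lt_min d0.
have h1 : Num.min d d' <= d by rewrite ge_min lexx.
have h2 : Num.min d d' <= d' by rewrite ge_min lexx orbT.
by apply: (face_uniq Kc Kc' (hd t _) (hd' t _)); apply/andP; split; rewrite /t; lra.
Qed.

Lemma besideP (s : R) v w c : beside s v w c <->
  exists2 d : R, 0 < d & forall n, 0 < n < d -> c (pt v w 2^-1 (s * n)).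
Proof.
have e n : lerp v w 2^-1 + rotate (0, s * n) (w - v) = pt v w 2^-1 (s * n).
  by rewrite /lerp /pt /rotate /=; congr pair => /=; ring.
by split=> -[d d0 hd]; exists d => // n hn; [rewrite -e|rewrite e]; exact: hd.
Qed.

Lemma beside_flip (s : R) v w c : beside s v w c -> beside (- s) w v c.
Proof.
move=> /besideP[d d0 hd]; apply/besideP; exists d => // n hn.
have := hd n hn; rewrite pt_swap mulNr.
by have -> : 1 - 2^-1 = 2^-1 :> R by field.
Qed.

Definition side (s : R) v w : set (R * R) := xget set0 [set c | K 2 c /\ beside s v w c].
Definition lface v w := side 1 v w.
Definition rface v w := side (-1) v w.

Lemma sideP (s : R) v w : s = 1 \/ s = -1 -> edge K v w ->
  K 2 (side s v w) /\ beside s v w (side s v w).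
Proof.
move=> s1 Ke; have [|d d0 [c Kc hc]] := @edge_half s v w 2^-1 s1 Ke.
  by apply/andP; split; lra.
have hb : [set c | K 2 c /\ beside s v w c] c.
  split => //; apply/besideP; exists d => // n hn; apply: hc => //.
  by rewrite subrr normr0.
exact: (xgetPex set0 (ex_intro _ c hb)).
Qed.

Lemma side_uniq (s : R) v w c : s = 1 \/ s = -1 -> edge K v w ->
  K 2 c -> beside s v w c -> c = side s v w.
Proof.
by move=> s1 Ke Kc hb; have [K' hb'] := sideP s1 Ke; exact: beside_uniq Kc K' hb hb'.
Qed.

Let pm1 : (1 : R) = 1 \/ (1 : R) = -1. Proof. by left. Qed.
Let pm2 : (-1 : R) = 1 \/ (-1 : R) = -1. Proof. by right. Qed.

Lemma lface_face v w : edge K v w -> K 2 (lface v w).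
Proof. by move=> /(sideP pm1)[]. Qed.

Lemma rface_face v w : edge K v w -> K 2 (rface v w).
Proof. by move=> /(sideP pm2)[]. Qed.

Lemma rface_swap v w : edge K v w -> rface v w = lface w v.
Proof.
move=> Ke; have [Kr hr] := sideP pm2 Ke; apply: side_uniq => //; first exact: edge_sym.
by have := beside_flip hr; rewrite opprK.
Qed.

Lemma lface_swap v w : edge K v w -> lface v w = rface w v.
Proof. by move=> Ke; rewrite rface_swap //; exact: edge_sym. Qed.

Lemma side_along (s : R) v w t : s = 1 \/ s = -1 -> edge K v w -> 0 < t < 1 ->
  exists2 d : R, 0 < d & forall t' n, `|t' - t| < d -> 0 < n < d ->
    (side s v w) (pt v w t' (s * n)).
Proof.
move=> s1 Ke /andP[t0 t1]; have [Kc hb] := sideP s1 Ke.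
pose g (u : R) := 2^-1 + u * (t - 2^-1).
pose Q (u : R) := exists2 d : R, 0 < d & forall n, 0 < n < d ->
  (side s v w) (pt v w (g u) (s * n)).
have g01 u : 0 <= u <= 1 -> 0 < g u < 1.
  by move=> /andP[u0 u1]; rewrite /g; apply/andP; split; nra.
have mem (d n : R) : 0 < n -> 0 < d -> 0 < Num.min n d / 2 < n /\ 0 < Num.min n d / 2 < d.
  move=> n0 d0; have m0 : 0 < Num.min n d by rewrite lt_min n0.
  have h1 : Num.min n d <= n by rewrite ge_min lexx.
  have h2 : Num.min n d <= d by rewrite ge_min lexx orbT.
  by split; apply/andP; split; lra.
have : Q 1.
  apply: locally_constant; last first.
    by move/besideP: hb => [d d0 hd]; exists d => // n hn; rewrite /g mul0r addr0; exact: hd.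
  move=> u u01; have [d d0 [c Kc' hc]] := edge_half s1 Ke (g01 u u01).
  exists d => // u' u'01 uu'.
  have guu' : `|g u' - g u| < d.
    have -> : g u' - g u = (u' - u) * (t - 2^-1) by rewrite /g; ring.
    rewrite normrM; apply: le_lt_trans uu'; rewrite ler_piMr // ler_norml.
    by apply/andP; split; lra.
  have key (u1 : R) : `|g u1 - g u| < d -> Q u1 -> c = side s v w.
    move=> h [d1 d10 h1]; have [m1 m2] := mem d1 d d0 d10.
    exact: (face_uniq Kc' Kc (hc _ _ h m1) (h1 _ m2)).
  split => hQ.
    have e := key u' guu' hQ; exists d => // n hn; rewrite -e; apply: hc => //.
    by rewrite subrr normr0.
  have e : c = side s v w by apply: key hQ; rewrite subrr normr0.
  by exists d => // n hn; rewrite -e; exact: hc.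
move=> [d1 d10 h1].
have g1 : g 1 = t by rewrite /g mul1r; ring.
have [|d d0 [c Kc' hc]] := @edge_half s v w t s1 Ke; first by rewrite t0.
have [m1 m2] := mem d1 d d0 d10; rewrite g1 in h1.
have e : c = side s v w.
  by apply: (face_uniq Kc' Kc (hc t _ _ m1) (h1 _ m2)); rewrite subrr normr0.
by exists d => // t' n; rewrite -e; exact: hc.
Qed.

Lemma closure_edge_face v w x c : edge K v w -> oseg v w x -> K 2 c -> closure c x ->
  c = lface v w \/ c = rface v w.
Proof.
move=> Ke /oseg_pt[t t01 ->] Kc /closure_enorm cx; have [vw _] := Ke.
have [d1 d10 h1] := side_along pm1 Ke t01.
have [d2 d20 h2] := side_along pm2 Ke t01.
have n0 : 0 < enorm (w - v) by rewrite enorm_gt0 // subr_eq0 eq_sym.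
have /andP[t0 t1] := t01.
pose m := Num.min (Num.min d1 d2) (Num.min t (1 - t)).
have m0 : 0 < m by rewrite !lt_min d10 d20 t0 subr_gt0 t1.
have [] := cx (m * enorm (w - v)); first by rewrite mulr_gt0.
move=> y cy; have [t' [n ey]] := pt_surj y vw; rewrite ey pt_dist subr0 ltr_pM2r // => hm.
have := enorm_fst (t' - t, n); have := enorm_snd (t' - t, n) => /= hn ht.
have hn' : `|n| < m by exact: le_lt_trans hm.
have ht' : `|t' - t| < m by exact: le_lt_trans hm.
move: ht' hn'; rewrite !lt_min => /andP[/andP[ht1 ht2] /andP[ht3 ht4]] /andP[/andP[hn1 hn2] _].
have [n_gt|n_lt|n_eq] := ltgtP n 0.
- right; apply: (face_uniq Kc (rface_face Ke) cy).
  have := h2 t' (- n) ht2; rewrite mulN1r opprK; rewrite ltr0_norm // in hn2.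
  by rewrite ey; apply; rewrite oppr_gt0 n_gt.
- left; apply: (face_uniq Kc (lface_face Ke) cy).
  have := h1 t' n ht1; rewrite mul1r; rewrite gtr0_norm // in hn1.
  by rewrite ey; apply; rewrite n_lt.
exfalso; apply: (face_edgeN Kc cy Ke); rewrite ey n_eq; apply/oseg_pt; exists t' => //.
by move: ht3 ht4; rewrite !ltr_norml => /andP[? ?] /andP[? ?]; apply/andP; split; lra.
Qed.

Lemma edge_sub_closure_side (s : R) v w : s = 1 \/ s = -1 -> edge K v w ->
  cseg v w `<=` closure (side s v w).
Proof.
move=> s1 Ke; rewrite -closure_oseg.
rewrite [X in _ `<=` X](closure_id _).1; last exact: closed_closure.
apply: closure_subset => x /oseg_pt[t t01 ->]; apply/closure_enorm => r r0.
have [vw _] := Ke; have n0 : 0 < enorm (w - v) by rewrite enorm_gt0 // subr_eq0 eq_sym.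
have [d d0 hd] := side_along s1 Ke t01.
pose n := Num.min d (r / enorm (w - v)) / 2.
have m0 : 0 < Num.min d (r / enorm (w - v)) by rewrite lt_min d0 divr_gt0.
have h1 : Num.min d (r / enorm (w - v)) <= d by rewrite ge_min lexx.
have h2 : Num.min d (r / enorm (w - v)) <= r / enorm (w - v) by rewrite ge_min lexx orbT.
exists (pt v w t (s * n)).
  by apply: hd; rewrite ?subrr ?normr0 //; apply/andP; split; rewrite /n; lra.
rewrite pt_dist subrr subr0 -ltr_pdivlMr //; apply: le_lt_trans (enorm_le _) _ => /=.
rewrite normr0 add0r normrM; have -> : `|s| = 1 by case: s1 => ->; rewrite ?normrN normr1.
by rewrite mul1r gtr0_norm /n; lra.
Qed.

Lemma face_edge_cases v w c : edge K v w -> K 2 c -> oseg v w `<=` closure c ->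
  c = lface v w \/ c = rface v w.
Proof.
move=> Ke Kc h; apply: (closure_edge_face Ke (oseg_mid v w) Kc).
by apply: h; exact: oseg_mid.
Qed.

Lemma nbrs_finite v : finite_set [set w | edge K v w].
Proof.
have := finite_image (fun e => xget 0 [set w | edge K v w /\ oseg v w = e])
  (cells_finite KCW (@cball_compact R v 1)).
apply: sub_finite_set => w Ke; have [vw Kvw] := Ke; exists (oseg v w).
  split; first by exists 1%N.
  have n0 : 0 < enorm (w - v) by rewrite enorm_gt0 // subr_eq0 eq_sym.
  pose t := Num.min 2^-1 (enorm (w - v))^-1.
  have t0 : 0 < t by rewrite lt_min !invr_gt0 n0 ltr0n.
  have t1 : t <= 2^-1 by rewrite ge_min lexx.
  have t2 : t <= (enorm (w - v))^-1 by rewrite ge_min lexx orbT.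
  exists (pt v w t 0); split.
    by apply/oseg_pt; exists t => //; rewrite t0; lra.
  rewrite /cball /= -{2}(pt0 v w) pt_dist !subr0 /enorm /= expr0n addr0 sqrtr_sqr gtr0_norm //.
  by rewrite -/(enorm (w - v)) -ler_pdivlMr // div1r.
have h : [set w' | edge K v w' /\ oseg v w' = oseg v w] w by split.
by have [h1 h2] := xgetPex 0 (ex_intro _ w h); exact: edge_inj h1 Ke h2.
Qed.

Definition free v (t : R) := forall w, edge K v w -> ~ cong t (arg (w - v)).

Lemma oseg_arg v w x : v != w -> oseg v w x -> cong (arg (x - v)) (arg (w - v)).
Proof.
move=> vw /oseg_pt[t /andP[t0 t1] ->]; rewrite pt_pol.
have -> : arg (t, 0) = 0.
  by rewrite /arg /= eqxx ltNge (ltW t0) /= mul0r atan0 mulr0.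
rewrite addr0; apply: arg_pol; rewrite mulr_gt0 // enorm_gt0 //.
  by apply/eqP => -[] t00; rewrite t00 ltxx in t0.
by rewrite subr_eq0 eq_sym.
Qed.

Lemma vertex_star v : vertex K v -> exists2 r : R, 0 < r &
  (forall w, edge K v w -> r <= enorm (w - v)) /\
  (forall s t : R, 0 < s < r -> free v t -> exists2 c, K 2 c & c (pol v s t)).
Proof.
move=> Kv; have [r r0 hr] := star_nbhd KCW v.
have sv x : vertex K x -> enorm (x - v) < r -> v = x.
  move=> Kx h; have := hr _ _ _ Kx erefl h; rewrite -(closure_id _).1 //.
  by apply: compact_closed; [exact: plane_hausdorff|exact: compact_set1].
exists r => //; split=> [w Ke|s t /andP[s0 sr] ft].
  rewrite leNgt; apply/negP => h; have [_ Kw] := edge_vertex Ke.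
  by have [] := Ke; rewrite (sv _ Kw h) eqxx.
have near : enorm (pol v s t - v) < r by rewrite pol_dist // ltW.
have [Kx|[a [b [Kab abx]]]|//] := cell_cases (pol v s t); exfalso.
  have := sv _ Kx near => e; have := pol_dist v t (ltW s0); rewrite -e subrr enorm0.
  by move=> s00; rewrite -s00 ltxx in s0.
have := hr _ _ _ Kab.2 abx near; rewrite closure_oseg => h.
have key a' b' : edge K a' b' -> v = a' -> oseg a' b' (pol v s t) -> False.
  move=> Kab' e; rewrite -e in Kab' *; have [ab' _] := Kab' => /(oseg_arg ab') h'.
  by apply: (ft _ Kab'); apply: cong_trans h'; apply/cong_sym; exact: arg_pol.
have := cseg_cases h => -[e|e|h'].
- exact: key Kab e abx.
- by apply: key (edge_sym Kab) e _; rewrite oseg_sym.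
exact: (edge_vertexN Kab h' Kv).
Qed.

Lemma pol_path_continuous v (s0 s1 t0 t1 : R) :
  continuous (fun u : R => pol v (s0 + u * s1) (t0 + u * t1)).
Proof.
have aff (a b : R) : continuous (fun u : R => a + u * b).
  by move=> u; apply: cvgD; [exact: cvg_cst|apply: cvgM; [exact: cvg_id|exact: cvg_cst]].
move=> u; apply: cvgD; first exact: cvg_cst.
apply: cvg_rotate; first by apply: cvg_pairP; [exact: aff|exact: cvg_cst].
by apply: (@continuous_comp _ _ _ (fun u : R => t0 + u * t1) (@expi R));
  [exact: aff|exact: expi_continuous].
Qed.

Lemma polar_same v (r : R) c (s1 s2 t1 t2 : R) :
  (forall s t : R, 0 < s < r -> free v t -> exists2 c, K 2 c & c (pol v s t)) ->
  0 < s1 < r -> 0 < s2 < r ->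
  (forall u : R, 0 <= u <= 1 -> free v (t1 + u * (t2 - t1))) ->
  K 2 c -> c (pol v s1 t1) -> c (pol v s2 t2).
Proof.
move=> hr /andP[s10 s1r] /andP[s20 s2r] fr Kc cx.
have := @face_path c _ (@pol_path_continuous v s1 (s2 - s1) t1 (t2 - t1)) _ Kc.
rewrite !mul0r !addr0 !mul1r ![s1 + _]addrC ![t1 + _]addrC !subrK; apply=> // u u01.
by apply: hr; [apply: conv_itv => //; apply/andP|exact: fr].
Qed.

Lemma side_sector (s : R) v w (r : R) (p d rr : R) : s = 1 \/ s = -1 -> 0 < r ->
  (forall s t : R, 0 < s < r -> free v t -> exists2 c, K 2 c & c (pol v s t)) ->
  edge K v w -> cong p (arg (w - v)) -> 0 < d ->
  (forall d' : R, 0 < d' <= d -> free v (p + s * d')) -> 0 < rr < r ->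
  (side s v w) (pol v rr (p + s * d)).
Proof.
move=> s1 r0 hr Ke cp d0 fr hrr.
have dd : 0 < d <= d by rewrite d0 lexx.
have [c Kc cx] := hr rr (p + s * d) hrr (fr d dd).
have [vw _] := Ke; have n0 : 0 < enorm (w - v) by rewrite enorm_gt0 // subr_eq0 eq_sym.
pose t := Num.min 2^-1 (r / (4 * enorm (w - v))).
have t0 : 0 < t by rewrite lt_min invr_gt0 ltr0n divr_gt0 // mulr_gt0.
have t1 : t <= 2^-1 by rewrite ge_min lexx.
have t2 : t <= r / (4 * enorm (w - v)) by rewrite ge_min lexx orbT.
rewrite ler_pdivlMr ?mulr_gt0 // in t2.
have [|d1 d10 h1] := @side_along s v w t s1 Ke; first by rewrite t0; lra.
have a0 : arg (t, 0) = 0 by rewrite /arg /= eqxx ltNge (ltW t0) /= mul0r atan0 mulr0.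
have cp2 : continuous (fun n : R => (t, n) : R * R).
  by apply: continuous_pair; [exact: cst_continuous|move=> ?; exact: cvg_id].
have ca : {for (0 : R), continuous (fun n : R => arg (t, n))}.
  apply: (@cvg_arg _ _ _ _ (fun n : R => (t, n)) (t, 0)).
    by rewrite /= ltr_wpDl ?enorm_ge0.
  exact: cp2.
have : nbhs (arg (t, 0)) [set z : R | `|arg (t, 0) - z| < d].
  by have := nbhsx_ballx (arg (t, 0)) d d0; rewrite -ball_normE.
move=> /ca; rewrite /= -nbhs_ballE => -[d2 /= d20 hd2].
pose m := Num.min (Num.min d1 d2) t.
have m0 : 0 < m by rewrite lt_min t0 andbT lt_min d10.
have m1 : m <= d1 by rewrite 2!ge_min lexx.
have m2 : m <= d2 by rewrite 2!ge_min lexx orbT.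
have m3 : m <= t by rewrite ge_min lexx orbT.
pose n := m / 2; have nn0 : 0 < n by rewrite divr_gt0.
have nm : n < m by rewrite /n; lra.
have ad : `|arg (t, n)| < d.
  have : `|arg (t, 0) - arg (t, n)| < d.
    by apply: hd2; rewrite /ball /= sub0r normrN gtr0_norm //; lra.
  by rewrite a0 sub0r normrN.
have apos : 0 < arg (t, n).
  rewrite argE /=; last by rewrite ltr_wpDl ?enorm_ge0.
  by rewrite mulr_gt0 // -atan0 lt_atan // divr_gt0 // ltr_wpDl ?enorm_ge0.
rewrite gtr0_norm // in ad.
have cy : (side s v w) (pt v w t (s * n)).
  by apply: h1; rewrite ?subrr ?normr0 //; apply/andP; split; lra.
have argn : arg (t, s * n) = s * arg (t, n).
  case: s1 => ->; first by rewrite !mul1r.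
  rewrite !mulN1r -arg_conj //; first by rewrite /= ltr_wpDl ?enorm_ge0.
pose r' := enorm (t, s * n) * enorm (w - v).
have cy' : (side s v w) (pol v r' (p + s * arg (t, n))).
  have cc0 : cong (p + s * arg (t, n)) (arg (w - v) + arg (t, s * n)).
    by rewrite argn; apply: congD => //; exact: cong_refl.
  by rewrite (pol_cong v r' cc0) -pt_pol.
have hr' : 0 < r' < r.
  apply/andP; split.
    by rewrite mulr_gt0 // enorm_gt0 //; apply/eqP => -[t00]; rewrite t00 ltxx in t0.
  have : enorm (t, s * n) <= 2 * t.
    apply: le_trans (enorm_le _) _ => /=; rewrite gtr0_norm // normrM.
    have -> : `|s| = 1 by case: s1 => ->; rewrite ?normrN normr1.
    by rewrite mul1r gtr0_norm //; lra.
  by rewrite /r' => h; have := enorm_ge0 (t, s * n); nra.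
have [Ks _] := sideP s1 Ke.
have cc : c (pol v r' (p + s * arg (t, n))).
  apply: polar_same hr hrr hr' _ Kc cx => u /andP[u0 u1].
  have -> : p + s * d + u * (p + s * arg (t, n) - (p + s * d)) = p + s * (d + u * (arg (t, n) - d)) by ring.
  by apply: fr; apply/andP; split; nra.
by rewrite -(face_uniq Kc Ks cc cy').
Qed.

Lemma arg_nbr_inj v w w' : edge K v w -> edge K v w' -> arg (w - v) = arg (w' - v) -> w = w'.
Proof.
move=> Ke Ke' ea; apply: (edge_inj Ke Ke').
have [vw _] := Ke; have [vw' _] := Ke'.
have n0 : 0 < enorm (w - v) by rewrite enorm_gt0 // subr_eq0 eq_sym.
have n0' : 0 < enorm (w' - v) by rewrite enorm_gt0 // subr_eq0 eq_sym.
pose s := Num.min (enorm (w - v)) (enorm (w' - v)) / 2.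
have m0 : 0 < Num.min (enorm (w - v)) (enorm (w' - v)) by rewrite lt_min n0.
have m1 : Num.min (enorm (w - v)) (enorm (w' - v)) <= enorm (w - v) by rewrite ge_min lexx.
have m2 : Num.min (enorm (w - v)) (enorm (w' - v)) <= enorm (w' - v) by rewrite ge_min lexx orbT.
have s0 : 0 < s by rewrite divr_gt0.
have on u : v != u -> s < enorm (u - v) -> oseg v u (pol v s (arg (u - v))).
  move=> vu su; have nu : 0 < enorm (u - v) by rewrite enorm_gt0 // subr_eq0 eq_sym.
  apply/oseg_pt; exists (s / enorm (u - v)).
    by rewrite divr_gt0 //= ltr_pdivrMr // mul1r.
  rewrite /pol /pt; congr (v + _); rewrite [X in _ = rotate _ X]argK.
  by rewrite /rotate /=; congr pair; field; rewrite gt_eqF.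
apply: (edge_uniq Ke Ke' (on w vw _)); first by rewrite /s; lra.
by rewrite ea; apply: on => //; rewrite /s; lra.
Qed.

Lemma tour_exists v : vertex K v -> exists ws, [/\ uniq ws,
  forall w, (w \in ws) <-> edge K v w &
  forall i, (i < size ws)%N ->
    rface v (nth 0 ws i) = lface v (nth 0 ws (i.+1 %% size ws)%N)].
Proof.
move=> Kv; have [r r0 [_ hr]] := vertex_star Kv.
have /finite_seqP[s0 es0] := nbrs_finite v.
pose le w w' := arg (w' - v) <= arg (w - v).
pose ws := sort le (undup s0).
have memws w : (w \in ws) <-> edge K v w.
  rewrite mem_sort mem_undup; have -> : edge K v w = [set` s0] w by rewrite -es0.
  by [].
have uws : uniq ws by rewrite sort_uniq undup_uniq.
exists ws; split => // i isz; set n := size ws in isz *.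
pose f k := arg (nth 0 ws k - v).
have Kw k : (k < n)%N -> edge K v (nth 0 ws k) by move=> kn; apply/memws/mem_nth.
have fle k l : (k <= l < n)%N -> f l <= f k.
  move=> /andP[kl ln].
  have srt : sorted le ws by apply: sort_sorted => x y; exact: le_total.
  have := @sorted_leq_nth _ le _ _ 0 ws srt k l; rewrite !inE -/n.
  by apply=> //; [move=> y x z h1 h2; exact: le_trans h2 h1|move=> x; exact: lexx|exact: leq_ltn_trans ln].
have flt k l : (k < l < n)%N -> f l < f k.
  move=> /andP[kl ln]; rewrite lt_neqAle fle ?(ltnW kl) ?ln // andbT.
  apply/eqP => e; have := arg_nbr_inj (Kw l ln) (Kw k (ltn_trans kl ln)) e.
  by move=> /eqP; rewrite nth_uniq // ?(ltn_trans kl ln) // gtn_eqF.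
have fb k : - pi < f k <= pi by rewrite arg_gt arg_le.
have onw (t : R) w : edge K v w -> cong t (arg (w - v)) -> exists2 k, (k < n)%N & cong t (f k).
  move=> /memws wws ct; exists (index w ws); first by rewrite /n index_mem.
  by rewrite /f nth_index.
have pi0 := pi_gt0 R.
set j := (i.+1 %% n)%N.
have jn : (j < n)%N by rewrite ltn_mod; exact: leq_ltn_trans isz.
suff [p [cp pf fr]] : exists p : R, [/\ cong p (f j), p < f i &
    forall t, p < t < f i -> free v t].
  pose d := (f i - p) / 2; have d0 : 0 < d by rewrite /d; lra.
  have hr2 : 0 < r / 2 < r by apply/andP; split; lra.
  apply: (face_uniq (rface_face (Kw i isz)) (lface_face (Kw j jn)) (x := pol v (r / 2) (p + d))).
    have -> : p + d = f i + (-1) * d by rewrite /d; field.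
    apply: side_sector hr (Kw i isz) _ d0 _ hr2 => //; first exact: cong_refl.
    by move=> d' /andP[d'0 d'd]; apply: fr; rewrite /d in d'd; apply/andP; split; lra.
  rewrite -[d]mul1r.
  apply: side_sector hr (Kw j jn) cp d0 _ hr2 => //.
  by move=> d' /andP[d'0 d'd]; apply: fr; rewrite /d in d'd; apply/andP; split; lra.
have [i1|i1] := ltnP i.+1 n.
  exists (f i.+1); split; [by rewrite /j modn_small //; exact: cong_refl|by apply: flt; rewrite ltnSn|].
  move=> t /andP[t1 t2] w Ke ct; have [k kn ck] := onw t w Ke ct.
  have /andP[b1 b2] := fb i.+1; have /andP[b3 b4] := fb i; have /andP[b5 b6] := fb k.
  have e : t = f k by apply: cong_eq => //; rewrite ltr_norml; apply/andP; split; lra.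
  have [ki|ki] := leqP k i.
    by have := @fle k i; rewrite ki isz => /(_ isT); lra.
  by have := @fle i.+1 k; rewrite ki kn => /(_ isT); lra.
have en : n = i.+1 by apply/eqP; rewrite eqn_leq i1 isz.
have ej : j = 0%N by rewrite /j en modnn.
exists (f 0%N - 2 * pi); split.
- by rewrite ej; exists (-1); rewrite mulrN1; lra.
- by have /andP[b1 b2] := fb 0%N; have /andP[b3 b4] := fb i; lra.
move=> t /andP[t1 t2] w Ke ct; have [k kn ck] := onw t w Ke ct.
have /andP[b1 b2] := fb 0%N; have /andP[b3 b4] := fb i; have /andP[b5 b6] := fb k.
have k0 := @fle 0%N k; have ki := @fle k i.
rewrite kn in k0; rewrite isz andbT -ltnS -en kn in ki.
have {}k0 := k0 isT; have {}ki := ki isT.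
have [tpi|tpi] := ltP (- pi) t.
  have e : t = f k by apply: cong_eq => //; rewrite ltr_norml; apply/andP; split; lra.
  lra.
have e : t + 2 * pi = f k.
  apply: cong_eq; last by rewrite ltr_norml; apply/andP; split; lra.
  apply: cong_trans ck; exists 1; rewrite mulr1; lra.
lra.
Qed.

Lemma tour_sum v (V : zmodType) (G : set (R * R) -> V) : vertex K v ->
  \sum_(w \in [set w | edge K v w]) G (lface v w) =
  \sum_(w \in [set w | edge K v w]) G (rface v w).
Proof.
move=> Kv; have [ws [uws mws tws]] := tour_exists Kv.
have -> : [set w | edge K v w] = [set` ws] by apply/seteqP; split => w /mws.
rewrite -!(fsbig_seq _ _ uws).
rewrite [RHS](big_nth 0) [LHS](big_nth 0) !big_mkord.
rewrite [LHS](reindex_inj (@ordS_inj _)) /=.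
by apply: eq_bigr => i _; rewrite tws.
Qed.

Lemma vertex_nbr v : vertex K v -> exists w, edge K v w.
Proof.
move=> Kv; apply: contrapT => nw; have [r r0 [_ hr]] := vertex_star Kv.
have fr t : free v t by move=> w Ke; case: nw; exists w.
have hr2 : 0 < r / 2 < r by apply/andP; split; lra.
have [c Kc cx] := hr (r / 2) 0 hr2 (fr 0).
have ball x : x != v -> enorm (x - v) < r -> c x.
  move=> xv xr; rewrite [x](polE v x); apply: polar_same hr hr2 _ _ Kc cx => //.
  by rewrite enorm_gt0 // subr_eq0.
have [oc _ [n [p [[n3 pinj _] fc]]]] := Kpolygonal Kc.
have : frontier c v.
  split.
    apply/closure_enorm => e e0; exists (pol v (Num.min e r / 2) 0).
      have m0 : 0 < Num.min e r by rewrite lt_min e0.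
      have m1 : Num.min e r <= r by rewrite ge_min lexx orbT.
      apply: ball; last by rewrite pol_dist; lra.
      rewrite -subr_eq0; apply/eqP => h.
      by have := @pol_dist _ v (Num.min e r / 2) 0; rewrite h enorm0; lra.
    have m0 : 0 < Num.min e r by rewrite lt_min e0.
    have m1 : Num.min e r <= e by rewrite ge_min lexx.
    by rewrite pol_dist; lra.
  by move=> /interior_subset cv; exact: (face_vertexN Kc cv Kv).
rewrite fc => -[i /= ni].
set a := p i; set b := p _ => /cseg_pt[t /andP[t0 t1] ev].
have ab : a != b.
  apply/eqP => /pinj; rewrite ni ltn_mod (leq_ltn_trans _ ni) // => /(_ isT isT) e.
  have [i1|i1] := ltnP i.+1 n; first by rewrite modn_small // in e; lia.
  have en : n = i.+1 by lia.
  by rewrite en modnn in e; lia.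
pose u : R := if t < 2^-1 then 1 else 0.
have u1 : 2^-1 <= `|u - t| <= 1.
  rewrite /u; case: ltP => h; first by rewrite gtr0_norm; lra.
  by rewrite sub0r normrN ger0_norm //; lra.
have n0 : 0 < enorm (b - a) by rewrite enorm_gt0 // subr_eq0 eq_sym.
pose s := Num.min 2^-1 (r / (2 * enorm (b - a))).
have s0 : 0 < s by rewrite lt_min invr_gt0 ltr0n divr_gt0 // mulr_gt0.
have s1 : s <= 2^-1 by rewrite ge_min lexx.
have s2 : s <= r / (2 * enorm (b - a)) by rewrite ge_min lexx orbT.
rewrite ler_pdivlMr ?mulr_gt0 // in s2.
pose x := pt a b (t + s * (u - t)) 0.
have dx : enorm (x - v) = s * `|u - t| * enorm (b - a).
  rewrite /x ev pt_dist subrr (addrC t) addrK /enorm /= expr0n addr0 sqrtr_sqr.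
  by rewrite normrM gtr0_norm.
have /andP[u2 u3] := u1.
have xv : x != v.
  rewrite -subr_eq0; apply/eqP => h; move: dx; rewrite h enorm0 => /esym/eqP.
  by rewrite !mulf_eq0 (gt_eqF s0) (gt_eqF n0) orbF /= gt_eqF //; lra.
have xr : enorm (x - v) < r.
  rewrite dx; apply: (@le_lt_trans _ _ (s * enorm (b - a))).
    by rewrite ler_pM2r // ler_piMr // ltW.
  by have : s * enorm (b - a) <= r / 2; lra.
have : frontier c x.
  rewrite fc; exists i => //; apply/cseg_pt; exists (t + s * (u - t)) => //.
  by rewrite /u; case: ltP => h; apply/andP; split; nra.
by move=> [_]; apply; apply: open_nbhs_nbhs; split => //; exact: ball.
Qed.

Lemma seq_argmax (I : eqType) (f : I -> R) (s : seq I) (i0 : I) : i0 \in s ->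
  exists2 i, i \in s & forall j, j \in s -> f j <= f i.
Proof.
elim: s i0 => [//|i s IH] i0 _.
have [|s0] := eqVneq s [::].
  by move=> ->; exists i; rewrite ?mem_head // => j; rewrite inE => /eqP ->.
have [j js hj] : exists2 i, i \in s & forall j, j \in s -> f j <= f i.
  by case: s s0 IH => // k s _ IH; apply: (IH k); rewrite mem_head.
have [h|h] := leP (f i) (f j).
  exists j; first by rewrite inE js orbT.
  by move=> k; rewrite inE => /orP[/eqP ->//|/hj].
exists i; first by rewrite mem_head.
by move=> k; rewrite inE => /orP[/eqP ->//|/hj hk]; exact: le_trans hk (ltW h).
Qed.

Lemma vertex_face v c : vertex K v -> K 2 c -> closure c v ->
  exists2 w, edge K v w & c = lface v w.
Proof.
move=> Kv Kc /closure_enorm cv; have [r r0 [rw hr]] := vertex_star Kv.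
have [y cy yr] := cv r r0; have pi0 := pi_gt0 R.
have yv : y != v by apply/eqP => e; apply: (face_vertexN Kc cy); rewrite e.
have n0 : 0 < enorm (y - v) by rewrite enorm_gt0 // subr_eq0.
pose t := arg (y - v).
have ft : free v t.
  move=> w Ke ct; apply: (face_edgeN Kc cy Ke); have [vw _] := Ke.
  have m0 : 0 < enorm (w - v) by rewrite enorm_gt0 // subr_eq0 eq_sym.
  apply/oseg_pt; exists (enorm (y - v) / enorm (w - v)).
    rewrite divr_gt0 //= ltr_pdivrMr // mul1r.
    by have := rw _ Ke; lra.
  rewrite [LHS](polE v) -/t (pol_cong _ _ ct) /pol /pt; congr (v + _).
  rewrite [X in _ = rotate _ X]argK.
  by rewrite /rotate /=; congr pair; field; rewrite gt_eqF.
have [ws [uws mws _]] := tour_exists Kv.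
have [w0 Ke0] := vertex_nbr Kv.
pose f w := if arg (w - v) < t then arg (w - v) else arg (w - v) - 2 * pi.
have [w /mws Ke hw] := seq_argmax f ((mws w0).2 Ke0).
have /andP[tb1 tb2] : - pi < t <= pi by rewrite arg_gt arg_le.
have ne u : edge K v u -> arg (u - v) != t.
  by move=> Ku; apply/eqP => e; apply: (ft _ Ku); rewrite e; exact: cong_refl.
have fb u : edge K v u -> t - 2 * pi < f u < t /\ cong (f u) (arg (u - v)).
  move=> Ku; have hne := ne u Ku; have b1 := arg_gt (u - v); have b2 := arg_le (u - v).
  rewrite /f; case: ifP => [h|/negbT]; first by split; [rewrite h andbT; lra|exact: cong_refl].
  rewrite -leNgt => h; have {}h : t < arg (u - v) by rewrite lt_neqAle eq_sym hne.
  split; first by apply/andP; split; lra.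
  by exists (-1); rewrite mulrN1; lra.
have [/andP[fw1 fw2] cf] := fb w Ke.
exists w => //; apply: (face_uniq Kc (lface_face Ke) cy).
rewrite [X in lface v w X](polE v) -/t.
have -> : t = f w + 1 * (t - f w) by rewrite mul1r; ring.
apply: side_sector r0 hr Ke cf _ _ _ => //; first by rewrite subr_gt0.
  move=> d' /andP[d0 d1] u Ku cu.
  have [/andP[fu1 fu2] cfu] := fb u Ku; rewrite mul1r in cu.
  have e : f w + d' = f u.
    apply: cong_eq; first exact: cong_trans cu (cong_sym cfu).
    by rewrite ltr_norml; apply/andP; split; lra.
  by have := hw u ((mws u).2 Ku); lra.
by rewrite n0.
Qed.

Lemma vertex_faces_eq (I : Type) (f : set (R * R) -> I) v c c' :
  vertex K v -> (forall w, edge K v w -> f (lface v w) = f (rface v w)) ->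
  K 2 c -> K 2 c' -> closure c v -> closure c' v -> f c = f c'.
Proof.
move=> Kv hf Kc Kc' /(vertex_face Kv Kc)[w Kw ->] /(vertex_face Kv Kc')[w' Kw' ->].
have [ws [uws mws tws]] := tour_exists Kv.
have h0 i : (i < size ws)%N -> f (lface v (nth 0 ws i)) = f (lface v (nth 0 ws 0)).
  elim: i => [//|i IH] isz; rewrite -IH ?(ltnW isz) //.
  rewrite [RHS]hf; last by apply/mws/mem_nth; exact: ltnW.
  by rewrite tws ?(ltnW isz) // modn_small.
have := h0 (index w ws); have := h0 (index w' ws).
by rewrite !index_mem !nth_index; try exact/mws; move=> -> ; [move=> ->|exact/mws]; last exact/mws.
Qed.

(** * Edge paths *)

Lemma face_at x : exists2 c, K 2 c & closure c x.
Proof.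
have [Kx|[v [w [Ke ex]]]|[c Kc cx]] := cell_cases x.
- have [w Ke] := vertex_nbr Kx; exists (lface x w); first exact: lface_face.
  exact: (edge_sub_closure_side pm1 Ke (@cseg_left R x w)).
- exists (lface v w); first exact: lface_face.
  exact: (edge_sub_closure_side pm1 Ke (oseg_cseg ex)).
by exists c => //; exact: subset_closure.
Qed.

Lemma closure_face_eq c c' x : K 2 c -> K 2 c' -> c x -> closure c' x -> c' = c.
Proof.
move=> Kc Kc' cx; have : nbhs x c by apply: open_nbhs_nbhs; split => //; exact: face_open.
by move=> h /(_ _ h)[y [c'y cy]]; exact: face_uniq Kc' Kc c'y cy.
Qed.

Lemma faces_at_eq (I : Type) (f : set (R * R) -> I) x c c' :
  (forall v w, edge K v w -> f (lface v w) = f (rface v w)) ->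
  K 2 c -> K 2 c' -> closure c x -> closure c' x -> f c = f c'.
Proof.
move=> hf Kc Kc' cx c'x.
have [Kx|[v [w [Ke ex]]]|[c0 Kc0 c0x]] := cell_cases x.
- by apply: vertex_faces_eq Kx _ Kc Kc' cx c'x => w Ke; exact: hf.
- have := hf _ _ Ke.
  by have [->|->] := closure_edge_face Ke ex Kc cx;
    have [->|->] := closure_edge_face Ke ex Kc' c'x.
by rewrite (closure_face_eq Kc0 Kc c0x cx) (closure_face_eq Kc0 Kc' c0x c'x).
Qed.

Lemma faces_segment_eq (I : Type) (f : set (R * R) -> I) x y c c' :
  (forall t c c', 0 <= t <= 1 -> K 2 c -> K 2 c' ->
    closure c (lerp x y t) -> closure c' (lerp x y t) -> f c = f c') ->
  K 2 c -> K 2 c' -> closure c x -> closure c' y -> f c = f c'.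
Proof.
move=> hf Kc Kc' cx c'y.
suff : forall c'', K 2 c'' -> closure c'' (lerp x y 1) -> f c'' = f c.
  by move=> h; rewrite [RHS]h // lerp_pt pt1.
apply: (@locally_constant R (fun t => forall c'', K 2 c'' -> closure c'' (lerp x y t) -> f c'' = f c)); last first.
  move=> c'' Kc''; have e0 : lerp x y 0 = x by rewrite lerp_pt pt0.
  by rewrite e0 => c''x; apply: (hf 0); rewrite ?e0 // lexx ler01.
move=> t t01; have [r r0 hr] := star_nbhd KCW (lerp x y t).
have : nbhs (lerp x y t) [set z | enorm (z - lerp x y t) < r / 2].
  by apply/nbhs_enorm; exists (r / 2) => //; rewrite divr_gt0.
move=> /(@lerp_continuous R x y t); rewrite /= -nbhs_ballE => -[d /= d0 hd].
exists d => // t' t'01 tt'.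
have near : enorm (lerp x y t' - lerp x y t) < r / 2 by apply: hd; rewrite /ball /= distrC.
have back c'' : K 2 c'' -> closure c'' (lerp x y t') -> closure c'' (lerp x y t).
  move=> Kc'' /closure_enorm h; have [|z cz hz] := h (r / 2); first by rewrite divr_gt0.
  by apply: hr Kc'' cz _; have := enorm_tri z (lerp x y t') (lerp x y t); lra.
split=> h c'' Kc'' cc; last by apply: h => //; exact: back.
have [c1 Kc1 cc1] := face_at (lerp x y t').
by rewrite -(h c1 Kc1 cc1); apply: (hf t) => //; exact: back.
Qed.

Lemma faces_eq (I : Type) (f : set (R * R) -> I) c c' :
  (forall v w, edge K v w -> f (lface v w) = f (rface v w)) ->
  K 2 c -> K 2 c' -> f c = f c'.
Proof.
move=> hf Kc Kc'; have [x cx] := cell_nonempty KCW Kc; have [y c'y] := cell_nonempty KCW Kc'.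
apply: (@faces_segment_eq _ f x y c c') => // [t c1 c2 _||].
- exact: faces_at_eq.
- exact: subset_closure.
exact: subset_closure.
Qed.

Fixpoint epath (W : set (R * R)) a (p : seq (R * R)) : Prop :=
  if p is b :: q then [/\ edge K a b, W b & epath W b q] else True.

Lemma epath_cat W a (p q : seq (R * R)) : epath W a (p ++ q) <-> epath W a p /\ epath W (last a p) q.
Proof.
elim: p a => [|b p IH] a /=; first by split => [|[]].
by split=> [[Ke Wb /IH[]]|[[Ke Wb hp] hq]]; split => //; apply/IH.
Qed.

Lemma epath_sub (W W' : set (R * R)) a (p : seq (R * R)) : W `<=` W' -> epath W a p -> epath W' a p.
Proof. by move=> s; elim: p a => //= b p IH a [? /s ? /IH ?]. Qed.

Definition reach W a b := [/\ W a, vertex K a & exists2 p, epath W a p & last a p = b].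

Lemma reach_refl W a : W a -> vertex K a -> reach W a a.
Proof. by move=> Wa Ka; split => //; exists [::]. Qed.

Lemma reach_trans W b a d : reach W a b -> reach W b d -> reach W a d.
Proof.
move=> [Wa Ka [p hp e]] [Wb Kb [q hq e']]; split => //; exists (p ++ q).
  by apply/epath_cat; rewrite e.
by rewrite last_cat e.
Qed.

Lemma reach_edge W a b : W a -> W b -> edge K a b -> reach W a b.
Proof. by move=> Wa Wb Ke; split => //; [exact: (edge_vertex Ke).1|exists [:: b]]. Qed.

Lemma reach_sub (W W' : set (R * R)) a b : W `<=` W' -> reach W a b -> reach W' a b.
Proof. by move=> s [Wa Ka [p hp e]]; split; [exact: s|by []|exists p => //; exact: epath_sub hp]. Qed.

Lemma polygon_corner c : K 2 c -> exists n (p : nat -> R * R), (0 < n)%N /\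
  frontier c = \bigcup_(i in [set i | (i < n)%N]) cseg (p i) (p (i.+1 %% n)%N).
Proof. by move=> /Kpolygonal[_ _ [n [p [[n3 _ _] h]]]]; exists n, p; split => //; lia. Qed.

Lemma frontier_cases c z : K 2 c -> frontier c z ->
  closure c z /\ (vertex K z \/ exists v w, edge K v w /\ oseg v w z).
Proof.
move=> Kc [cz nz]; split => //.
have [|h|[c' Kc' c'z]] := cell_cases z; [by left|by right|exfalso].
apply: nz; rewrite (closure_face_eq Kc' Kc c'z cz).
by apply: open_nbhs_nbhs; split => //; exact: face_open.
Qed.

Definition ends z v := vertex K v /\ (z = v \/ exists w, edge K v w /\ oseg v w z).

Lemma ends_reach c z v v' : K 2 c -> closure c z -> ends z v -> ends z v' ->
  reach (closure c) v v'.
Proof.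
move=> Kc cz.
have sub a b : edge K a b -> oseg a b z -> closure c a /\ closure c b.
  move=> Ke ez; have [->|->] := closure_edge_face Ke ez Kc cz;
  by split; [exact: (edge_sub_closure_side _ Ke (@cseg_left R a b))|
    exact: (edge_sub_closure_side _ Ke (@cseg_right R a b))].
move=> [Kv [e|[w [Ke ez]]]] [Kv' [e'|[w' [Ke' ez']]]].
- by rewrite -e -e'; apply: reach_refl => //; rewrite e.
- by have := edge_vertexN Ke' ez'; rewrite e.
- by have := edge_vertexN Ke ez; rewrite e'.
have [cv cw] := sub _ _ Ke ez.
have [vw _] := Ke; have [[-> _]|[_ e]] := oseg_inj vw (edge_uniq Ke Ke' ez ez').
  by apply: reach_refl => //; have [] := sub _ _ Ke' ez'.
by rewrite -e; apply: reach_edge.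
Qed.

Lemma frontier_reach c v v' : K 2 c -> vertex K v -> vertex K v' ->
  closure c v -> closure c v' -> reach (closure c) v v'.
Proof.
move=> Kc Kv Kv' cv cv'; have [n [p [n0 fc]]] := polygon_corner Kc.
pose F z := [set a | exists2 u, ends z u & reach (closure c) u a].
have front x : vertex K x -> closure c x -> frontier c x.
  by move=> Kx cx; split => // /interior_subset cx'; exact: (face_vertexN Kc cx').
have exends z : frontier c z -> exists u, ends z u.
  move=> /(frontier_cases Kc)[_ [Kz|[a [b [Ke ez]]]]]; first by exists z; split => //; left.
  by exists a; split; [exact: (edge_vertex Ke).1|right; exists b].
have Feq z z' u : frontier c z -> frontier c z' -> ends z u -> ends z' u -> F z = F z'.
  move=> /(frontier_cases Kc)[cz _] /(frontier_cases Kc)[cz' _] ezu ez'u.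
  apply/seteqP; split=> a [u' hu' ra].
    by exists u => //; apply: reach_trans ra; exact: ends_reach Kc cz ezu hu'.
  by exists u => //; apply: reach_trans ra; exact: ends_reach Kc cz' ez'u hu'.
have loc i : (i < n)%N -> forall t, 0 <= t <= 1 ->
    F (lerp (p i) (p (i.+1 %% n)%N) t) = F (p i).
  move=> ni t t01; set q := p (i.+1 %% n)%N.
  have fr (s : R) : 0 <= s <= 1 -> frontier c (lerp (p i) q s).
    by move=> s01; rewrite fc; exists i => //; exists s => //=; rewrite in_itv.
  have ts (s : R) : 0 <= s <= 1 -> 0 <= s * t <= 1.
    move=> /andP[s0 s1]; have /andP[t0 t1] := t01.
    by rewrite mulr_ge0 //= mulr_ile1.
  have e00 : lerp (p i) q (0 * t) = p i by rewrite mul0r lerp_pt pt0.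
  suff : F (lerp (p i) q (1 * t)) = F (p i) by rewrite mul1r.
  apply: (@locally_constant R (fun s => F (lerp (p i) q (s * t)) = F (p i))); last by rewrite e00.
  move=> s s01; set z := lerp (p i) q (s * t).
  have [r r0 hr] := star_nbhd KCW z.
  have : nbhs z [set z' | enorm (z' - z) < r] by apply/nbhs_enorm; exists r.
  have cl : {for s, continuous (fun s : R => lerp (p i) q (s * t))}.
    apply: (@continuous_comp _ _ _ (fun s : R => s * t) (lerp (p i) q)); last exact: lerp_continuous.
    by apply: mulrr_continuous.
  move=> /cl; rewrite /= -nbhs_ballE => -[d /= d0 hd].
  exists d => // s' s'01 ss'; set z' := lerp (p i) q (s' * t).
  have near : enorm (z' - z) < r by apply: hd; rewrite /ball /= distrC.
  suff -> : F z' = F z by [].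
  have fz := fr _ (ts _ s01); have fz' := fr _ (ts _ s'01).
  have [_ [Kz'|[a [b [Ke ez']]]]] := frontier_cases Kc fz'.
    have := hr _ _ _ Kz' erefl near; rewrite -(closure_id _).1; first by move=> /= e; rewrite -/z e.
    by apply: compact_closed; [exact: plane_hausdorff|exact: compact_set1].
  have [Ka Kb] := edge_vertex Ke.
  have ea' : ends z' a by split => //; right; exists b.
  have eb' : ends z' b.
    by split => //; right; exists a; rewrite oseg_sym; split => //; exact: edge_sym.
  have := hr _ _ _ Ke.2 ez' near; rewrite closure_oseg => /cseg_cases[e|e|ez].
  - exact: (Feq z' z a fz' fz ea' (conj Ka (or_introl e))).
  - exact: (Feq z' z b fz' fz eb' (conj Kb (or_introl e))).
  have ea : ends z a by split => //; right; exists b.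
  exact: (Feq z' z a fz' fz ea' ea).
have corner i : (i < n)%N -> F (p i) = F (p 0%N).
  elim: i => [//|i IH] ni; rewrite -IH ?(ltnW ni) // -(loc i (ltnW ni) 1) ?lexx ?ler01 //.
  by rewrite lerp_pt pt1 modn_small.
have all x : frontier c x -> F x = F (p 0%N).
  rewrite fc => -[i /= ni] [t]; rewrite /= in_itv /= => t01 <-.
  by rewrite loc // corner.
have : F v' v' by exists v'; [split => //; left|exact: reach_refl].
rewrite (all v' (front _ Kv' cv')) -(all v (front _ Kv cv)) => -[u [Ku [->//|]]].
by move=> [w [Ke ev]]; case: (edge_vertexN Ke ev).
Qed.

Lemma face_vertex_at c c' z : K 2 c -> K 2 c' -> closure c z -> closure c' z ->
  c = c' \/ exists2 u, vertex K u & closure c u /\ closure c' u.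
Proof.
move=> Kc Kc' cz c'z.
have [Kz|[v [w [Ke ez]]]|[c0 Kc0 c0z]] := cell_cases z.
- by right; exists z.
- right; exists v; first exact: (edge_vertex Ke).1.
  by have [->|->] := closure_edge_face Ke ez Kc cz; have [->|->] := closure_edge_face Ke ez Kc' c'z;
    split; exact: (edge_sub_closure_side _ Ke (@cseg_left R v w)).
by left; rewrite (closure_face_eq Kc0 Kc c0z cz) (closure_face_eq Kc0 Kc' c0z c'z).
Qed.

Lemma face_vertex c : K 2 c -> exists2 v, vertex K v & closure c v.
Proof.
move=> Kc; have [n [p [n0 fc]]] := polygon_corner Kc.
have : frontier c (p 0%N) by rewrite fc; exists 0%N => //; exact: cseg_left.
move=> /(frontier_cases Kc)[cz [Kz|[a [b [Ke ez]]]]]; first by exists (p 0%N).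
exists a; first exact: (edge_vertex Ke).1.
by have [->|->] := closure_edge_face Ke ez Kc cz;
  exact: (edge_sub_closure_side _ Ke (@cseg_left R a b)).
Qed.

Lemma segment_reach (W : set (R * R)) x y c c' v v' :
  (forall t c, 0 <= t <= 1 -> K 2 c -> closure c (lerp x y t) -> closure c `<=` W) ->
  K 2 c -> K 2 c' -> closure c x -> closure c' y -> vertex K v -> vertex K v' ->
  closure c v -> closure c' v' -> reach W v v'.
Proof.
move=> hW Kc Kc' cx c'y Kv Kv' cv c'v'.
pose f c := [set a | exists u, [/\ vertex K u, closure c u & reach W u a]].
have e : f c = f c'.
  apply: (@faces_segment_eq _ f x y) => // t c1 c2 t01 Kc1 Kc2 c1t c2t.
  have W1 := hW t c1 t01 Kc1 c1t; have W2 := hW t c2 t01 Kc2 c2t.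
  have [->//|[u Ku [c1u c2u]]] := face_vertex_at Kc1 Kc2 c1t c2t.
  apply/seteqP; split=> a [u' [Ku' cu' ra]]; exists u; split => //; apply: reach_trans ra.
    by apply: reach_sub W1 _; exact: frontier_reach.
  by apply: reach_sub W2 _; exact: frontier_reach.
have : f c' v'.
  exists v'; split => //; apply: reach_refl => //.
  apply: (hW 1 c') => //; first by rewrite lexx ler01.
  by rewrite lerp_pt pt1.
rewrite -e => -[u [Ku cu ra]]; apply: reach_trans ra.
apply: (@reach_sub (closure c)); last exact: frontier_reach.
by apply: (hW 0 c) => //; rewrite ?lexx ?ler01 // lerp_pt pt0.
Qed.

Lemma face_connected c x y : K 2 c -> c x -> c y -> exists g : R -> R * R,
  [/\ continuous g, forall t, c (g t), g 0 = x & g 1 = y].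
Proof.
move=> Kc; case: KCW => _ _ hchar _; have [Phi [/subspace_continuousP cPhi <- _ _]] := hchar _ _ Kc.
move=> [a oa <-] [b ob <-].
have og (t : R) : odisc (a + clamp t *: (b - a)).
  move=> i; rewrite !mxE; have := oa i; have := ob i; rewrite !ltr_norml.
  by move=> h1 h2; apply: conv_itv => //; exact: clamp01.
exists (fun t => Phi (a + clamp t *: (b - a))); split.
- move=> t; apply: (@continuous_within_comp _ _ _ (@cdisc R 2) (fun t => a + clamp t *: (b - a)) Phi).
  + by move=> s i; exact/ltW/og.
  + apply: cvgD; first exact: cvg_cst.
    by apply: cvgZl; exact: clamp_continuous.
  by apply: cPhi => i; exact/ltW/og.
- by move=> t; exists (a + clamp t *: (b - a)).
- by rewrite clamp_id ?lexx ?ler01 // scale0r addr0.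
by rewrite clamp_id ?lexx ?ler01 // scale1r addrC subrK.
Qed.

Lemma face_cong_const c (f : R * R -> R) x y : K 2 c ->
  (forall z, c z -> {for z, continuous f}) -> (forall z, c z -> cong (f z) 0) ->
  c x -> c y -> f x = f y.
Proof.
move=> Kc cf hf cx cy; have [g [cg gc <- <-]] := face_connected Kc cy cx.
apply: (@cong_const R (fun t => f (g t))) => t _; last exact: hf.
by apply: continuous_comp; [exact: cg|exact: cf].
Qed.
Fixpoint wind x a (p : seq (R * R)) : R :=
  if p is b :: q then ang x a b + wind x b q else 0.

Fixpoint ecount v w a (p : seq (R * R)) : int :=
  if p is b :: q
  then ((a == v) && (b == w))%:R - ((a == w) && (b == v))%:R + ecount v w b q
  else 0.

Lemma ecountN v w a (p : seq (R * R)) : ecount w v a p = - ecount v w a p.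
Proof. by elim: p a => [|b p IH] a /=; rewrite ?oppr0 // IH opprD opprB. Qed.

Lemma ecount_supp W v w a (p : seq (R * R)) : epath W a p -> ecount v w a p != 0 ->
  [/\ edge K v w, v \in a :: p & w \in a :: p].
Proof.
elim: p a => [|b p IH] a /=; first by [].
move=> [Ke Wb hp].
have [/andP[/eqP <- /eqP <-] _|h1] := boolP ((a == v) && (b == w)).
  by split; rewrite // !inE eqxx ?orbT.
have [/andP[/eqP <- /eqP <-] _|h2] := boolP ((a == w) && (b == v)).
  by split; rewrite ?inE ?eqxx ?orbT //; exact: edge_sym.
rewrite subrr add0r => /(IH _ hp)[Kvw hv hw].
by split; rewrite // inE ?hv ?hw orbT.
Qed.

Lemma ecount_bd W v a (p : seq (R * R)) : epath W a p ->
  \sum_(w \in [set w | edge K w v]) ecount w v a p = (last a p == v)%:R - (a == v)%:R.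
Proof.
have fN : finite_set [set w | edge K w v].
  have -> : [set w | edge K w v] = [set w | edge K v w].
    by apply/seteqP; split=> w /= h; exact: edge_sym.
  exact: nbrs_finite.
elim: p a => [|b p IH] a /=; first by move=> _; rewrite subrr fsbig1.
move=> [Ke Wb hp]; rewrite fsbig_split // IH //.
suff -> : \sum_(w \in [set w | edge K w v])
    (((a == w) && (b == v))%:R - ((a == v) && (b == w))%:R : int) = (b == v)%:R - (a == v)%:R.
  by rewrite /=; ring.
have pick (c d : R * R) : (d = v -> edge K c v) ->
    \sum_(w \in [set w | edge K w v]) (((c == w) && (d == v))%:R : int) = (d == v)%:R.
  move=> h; have [dv|dv] := eqVneq d v; last first.
    by apply: fsbig1 => w _; rewrite andbF.
  rewrite (fsbigD1 c) //=; last exact: h.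
  rewrite eqxx fsbig1 ?addr0 // => w [_ /= /eqP].
  by rewrite eq_sym => /negbTE ->.
have pick2 : \sum_(w \in [set w | edge K w v]) (- ((a == v) && (b == w))%:R : int) = - (a == v)%:R.
  have e w : (- ((a == v) && (b == w))%:R : int) = (-1) * ((b == w) && (a == v))%:R.
    by rewrite mulN1r andbC.
  under eq_fsbigr do rewrite e.
  rewrite -fsbig_distrr //= pick ?mulN1r // => <-; exact: edge_sym.
rewrite fsbig_split //= pick ?pick2 // => e.
by rewrite -e.
Qed.

Lemma wind_cong x a (p : seq (R * R)) : x \notin a :: p ->
  cong (wind x a p) (arg (last a p - x) - arg (a - x)).
Proof.
elim: p a => [|b p IH] a /=; first by move=> _; rewrite subrr; exact: cong_refl.
rewrite inE negb_or => /andP[xa xp]; have := IH b xp.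
move: xp; rewrite inE negb_or => /andP[xb _] h.
have := congD (ang_cong (z := x) (a := a) (b := b) _ _) h.
rewrite !(eq_sym _ x) => /(_ xa xb) h'.
by apply: cong_trans h' _; rewrite addrC addrA subrK; exact: cong_refl.
Qed.

Lemma face_csegN c x v w : K 2 c -> c x -> edge K v w -> ~ cseg v w x.
Proof.
move=> Kc cx Ke /cseg_cases[e|e|]; last exact: face_edgeN Kc cx Ke.
  by apply: (face_vertexN Kc cx); rewrite e; exact: (edge_vertex Ke).1.
by apply: (face_vertexN Kc cx); rewrite e; exact: (edge_vertex Ke).2.
Qed.

Lemma face_notin_path c x W a (p : seq (R * R)) : K 2 c -> c x -> vertex K a -> epath W a p -> x \notin a :: p.
Proof.
move=> Kc cx; elim: p a => [|b p IH] a Ka /=.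
  by move=> _; rewrite inE; apply/eqP => e; apply: (face_vertexN Kc cx); rewrite e.
move=> [Ke _ /(IH b (edge_vertex Ke).2)] h; rewrite inE negb_or h andbT.
by apply/eqP => e; apply: (face_vertexN Kc cx); rewrite e.
Qed.

Lemma wind_continuous c x W a (p : seq (R * R)) : K 2 c -> c x -> epath W a p ->
  {for x, continuous (fun z => wind z a p)}.
Proof.
move=> Kc cx; elim: p a => [|b p IH] a /=; first by move=> _; exact: cst_continuous.
move=> [Ke _ /IH h]; apply: (@cvgD _ _ _ _ _ (fun z => ang z a b) (fun z => wind z b p)) h.
by apply: cvg_ang; [exact: face_csegN Kc cx Ke|exact: cvg_id].
Qed.

Lemma wind_act (g : motion R) x a (p : seq (R * R)) :
  wind (act g x) (act g a) (map (act g) p) = wind x a p.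
Proof. by elim: p a => //= b p IH a; rewrite ang_act IH. Qed.

Lemma act_inj (g : motion R) : injective (act g).
Proof. exact: can_inj (act_invm g). Qed.

Lemma ecount_act (g : motion R) v w a (p : seq (R * R)) :
  ecount (act g v) (act g w) (act g a) (map (act g) p) = ecount v w a p.
Proof. by elim: p a => //= b p IH a; rewrite !(inj_eq (@act_inj g)) IH. Qed.

Lemma wind_halfplane x n a (p : seq (R * R)) :
  (forall u, u \in a :: p -> 0 < (rotate (u - x) (conjp n)).1) ->
  wind x a p = arg (rotate (last a p - x) (conjp n)) - arg (rotate (a - x) (conjp n)).
Proof.
elim: p a => [|b p IH] a h /=; first by rewrite subrr.
rewrite IH; last by move=> u up; apply: h; rewrite inE up orbT.
rewrite (ang_halfplane (n := n)); first by ring.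
  by apply: h; rewrite mem_head.
by apply: h; rewrite !inE eqxx orbT.
Qed.

Lemma atan_half_turn (n : R) v w : v != w -> 0 < n ->
  ang (pt v w 2^-1 n) v w = pi - 2 * atan (2 * n) /\
  ang (pt v w 2^-1 (- n)) v w = - (pi - 2 * atan (2 * n)).
Proof.
move=> vw n0; have m0 : 0 < enorm (w - v) ^+ 2.
  by rewrite exprn_gt0 // enorm_gt0 // subr_eq0 eq_sym.
have key (s : R) : ang (pt v w 2^-1 s) v w = arg (s ^+ 2 - 4^-1, s).
  rewrite /ang -(arg_scale (s ^+ 2 - 4^-1, s) m0); congr arg.
  rewrite enorm_sqr /pt /rotate /conjp /=.
  by congr pair; field.
have en (s : R) : enorm (s ^+ 2 - 4^-1, s) = s ^+ 2 + 4^-1.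
  rewrite /enorm /=; have -> : (s ^+ 2 - 4^-1) ^+ 2 + s ^+ 2 = (s ^+ 2 + 4^-1) ^+ 2 by field.
  by rewrite sqrtr_sqr ger0_norm // addr_ge0 ?sqr_ge0 ?invr_ge0.
have n20 : 0 < n ^+ 2 by rewrite exprn_gt0.
have e1 : arg (n ^+ 2 - 4^-1, n) = pi - 2 * atan (2 * n).
  have h0 : 0 < n / (enorm (n ^+ 2 - 4^-1, n) + (n ^+ 2 - 4^-1)).
    by rewrite divr_gt0 // en; lra.
  rewrite argE /=; last by rewrite en; lra.
  have pi0 := pi_gt0 R.
  have a1 : 0 < atan (2 * n) by rewrite -atan0 lt_atan // mulr_gt0.
  have a2 := atan_ltpi2 (2 * n).
  have a3 : 0 < atan (n / (enorm (n ^+ 2 - 4^-1, n) + (n ^+ 2 - 4^-1))) by rewrite -{1}atan0 lt_atan.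
  have a4 := atan_ltpi2 (n / (enorm (n ^+ 2 - 4^-1, n) + (n ^+ 2 - 4^-1))).
  apply: cong_eq; last by rewrite ltr_norml; apply/andP; split; lra.
  apply/expi_cong; rewrite /expi cosB sinB cospi sinpi !cos_2atan !sin_2atan en.
  have nn0 : n != 0 by rewrite gt_eqF.
  have nn1 : 1 + (2 * n) ^+ 2 != 0 by rewrite gt_eqF // ltr_wpDr ?sqr_ge0.
  have nn2 : 4 * n ^+ 2 + 1 != 0 by rewrite gt_eqF //; lra.
  have -> : n ^+ 2 + 4^-1 + (n ^+ 2 - 4^-1) = 2 * n ^+ 2 by lra.
  have -> : n / (2 * n ^+ 2) = (2 * n)^-1 by field.
  have -> : 1 + (2 * n)^-1 ^+ 2 = (4 * n ^+ 2 + 1) / (4 * n ^+ 2) by field.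
  have -> : 1 - (2 * n)^-1 ^+ 2 = (4 * n ^+ 2 - 1) / (4 * n ^+ 2) by field.
  have -> : 1 + (2 * n) ^+ 2 = 4 * n ^+ 2 + 1 by ring.
  by congr pair; field; rewrite ?nn0 ?nn2.
split; first by rewrite key.
rewrite key -e1 -arg_conj ?sqrrN //.
by rewrite en /=; lra.
Qed.

Lemma wind_jump W v w a (p : seq (R * R)) : edge K v w -> epath W a p ->
  (fun n : R => wind (pt v w 2^-1 n) a p - wind (pt v w 2^-1 (- n)) a p) @ 0^'+ -->
  (2 * pi * (ecount v w a p)%:~R : R).
Proof.
move=> Ke; have [vw _] := Ke; elim: p a => [|b p IH] a /=.
  by move=> _; rewrite mulr0; under eq_fun do rewrite subrr; exact: cvg_cst.
move=> [Kab _ /IH h].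
have -> : (fun n : R => ang (pt v w 2^-1 n) a b + wind (pt v w 2^-1 n) b p -
    (ang (pt v w 2^-1 (- n)) a b + wind (pt v w 2^-1 (- n)) b p)) =
    (fun n : R => (ang (pt v w 2^-1 n) a b - ang (pt v w 2^-1 (- n)) a b) +
      (wind (pt v w 2^-1 n) b p - wind (pt v w 2^-1 (- n)) b p)).
  by apply/funext => n; ring.
rewrite intrD mulrDr; apply: cvgD => // {h}.
have jump : (fun n : R => ang (pt v w 2^-1 n) v w - ang (pt v w 2^-1 (- n)) v w) @ 0^'+ -->
    (2 * pi : R).
  have : (fun n : R => 2 * (pi - 2 * atan (2 * n))) @ 0^'+ --> (2 * (pi - 2 * atan (2 * 0)) : R).
    apply: cvg_at_right_filter.
    apply: cvgM; first exact: cvg_cst.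
    apply: cvgB; first exact: cvg_cst.
    apply: cvgM; first exact: cvg_cst.
    apply: (@continuous_cvg _ _ _ _ _ _ (@atan R)); first exact: continuous_atan.
    by apply: cvgM; [exact: cvg_cst|exact: cvg_id].
  rewrite mulr0 atan0 mulr0 subr0; apply: cvg_trans; apply: near_eq_cvg.
  near=> n; have [|-> ->] := @atan_half_turn n v w vw; last by ring.
  by near: n; exact: nbhs_right_gt.
have segN (n : R) : n != 0 -> ~ cseg v w (pt v w 2^-1 n).
  by move=> n0 /cseg_pt[t _ /(pt_inj vw)[_ e]]; rewrite e eqxx in n0.
have [/andP[/eqP -> /eqP ->]|h1] := boolP ((a == v) && (b == w)).
  by rewrite (negbTE vw) subr0 mulr1.
have [/andP[/eqP -> /eqP ->]|h2] := boolP ((a == w) && (b == v)).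
  rewrite sub0r mulrN1.
  have : (fun n : R => - (ang (pt v w 2^-1 n) v w - ang (pt v w 2^-1 (- n)) v w)) @ 0^'+ -->
      (- (2 * pi) : R) by exact: cvgN.
  apply: cvg_trans; apply: near_eq_cvg; near=> n.
  have n0 : n != 0.
    have : 0 < n by near: n; exact: nbhs_right_gt.
    by move=> /gt_eqF ->.
  by rewrite !(angN (a := v)); [ring|apply: segN; rewrite ?oppr_eq0|apply: segN].
rewrite subrr mulr0.
have nm : ~ cseg a b (pt v w 2^-1 0).
  move=> /cseg_cases[e|e|e].
  - by apply: (edge_vertexN Ke (oseg_mid v w)); rewrite e; exact: (edge_vertex Kab).1.
  - by apply: (edge_vertexN Ke (oseg_mid v w)); rewrite e; exact: (edge_vertex Kab).2.
  have := edge_uniq Ke Kab (oseg_mid v w) e => /(oseg_inj vw)[[e1 e2]|[e1 e2]].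
    by move: h1; rewrite -e1 -e2 !eqxx.
  by move: h2; rewrite -e1 -e2 !eqxx.
have cpt : continuous (fun n : R => pt v w 2^-1 n).
  move=> n; apply: cvgD; first exact: cvg_cst.
  apply: cvg_rotate; last exact: cvg_cst.
  by apply: cvg_pairP; [exact: cvg_cst|exact: cvg_id].
have cptN : continuous (fun n : R => pt v w 2^-1 (- n)).
  move=> n; apply: cvgD; first exact: cvg_cst.
  apply: cvg_rotate; last exact: cvg_cst.
  by apply: cvg_pairP; [exact: cvg_cst|apply: cvgN; exact: cvg_id].
have c1 : (fun n : R => ang (pt v w 2^-1 n) a b) @ (0 : R) --> ang (pt v w 2^-1 0) a b.
  by apply: cvg_ang => //; exact: cpt.
have c2 : (fun n : R => ang (pt v w 2^-1 (- n)) a b) @ (0 : R) --> ang (pt v w 2^-1 0) a b.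
  have h : (fun n : R => pt v w 2^-1 (- n)) @ (0 : R) --> pt v w 2^-1 0.
    by have := cptN 0; rewrite /continuous_at oppr0.
  exact: cvg_ang nm h.
apply: cvg_at_right_filter.
suff h : (fun n : R => ang (pt v w 2^-1 n) a b - ang (pt v w 2^-1 (- n)) a b) @ (0 : R) -->
    (ang (pt v w 2^-1 0) a b - ang (pt v w 2^-1 0) a b) by rewrite subrr in h.
by apply: cvgB; [exact: c1|exact: c2].
Unshelve. all: by end_near. Qed.

Lemma face_jump (f : R * R -> R) v w x y (l : R) : edge K v w ->
  (forall x y, lface v w x -> lface v w y -> f x = f y) ->
  (forall x y, rface v w x -> rface v w y -> f x = f y) ->
  (fun n : R => f (pt v w 2^-1 n) - f (pt v w 2^-1 (- n))) @ 0^'+ --> l ->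
  lface v w x -> rface v w y -> f x - f y = l.
Proof.
move=> Ke fl fr cf lx ry.
have [_ /besideP[d1 d10 h1]] := sideP pm1 Ke.
have [_ /besideP[d2 d20 h2]] := sideP pm2 Ke.
have : (fun n : R => f x - f y) @ 0^'+ --> l.
  apply: cvg_trans cf; apply: near_eq_cvg; near=> n.
  have n0 : 0 < n by near: n; exact: nbhs_right_gt.
  have n1 : n < d1 by near: n; exact: nbhs_right_lt.
  have n2 : n < d2 by near: n; exact: nbhs_right_lt.
  congr (_ - _).
    by apply: fl => //; have := h1 n; rewrite mul1r n0 n1; apply.
  by apply: fr => //; have := h2 n; rewrite mulN1r n0 n2; apply.
by move=> h; apply: (cvg_unique _ (cvg_cst _) h).
Unshelve. all: by end_near. Qed.

(** * Rigid motions acting on cells *)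

Lemma motion_ext (f g : motion R) : act f =1 act g -> f = g.
Proof.
move=> h; have e0 := h 0; have e1 := h (1, 0).
move: e0 e1; rewrite /act !rotate0 !add0r => et; rewrite et => /addIr.
by rewrite !(rotateC _ (1, 0)) !rotate1 => er; exact: motion_eq.
Qed.

Lemma act_invmK (g : motion R) : cancel (act (invm g)) (act g).
Proof.
by move=> x; apply: (@act_inj (invm g)); rewrite act_invm.
Qed.

Lemma invmK (g : motion R) : invm (invm g) = g.
Proof. by apply: motion_ext => x; apply: (@act_inj (invm g)); rewrite act_invmK act_invm. Qed.

Lemma mulmA (f g h : motion R) : mulm f (mulm g h) = mulm (mulm f g) h.
Proof. by apply: motion_ext => x; rewrite !act_mulm. Qed.

Lemma mulmK (f g : motion R) : mulm (mulm f g) (invm g) = f.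
Proof. by apply: motion_ext => x; rewrite !act_mulm act_invmK. Qed.

Lemma mulVmK (f g : motion R) : mulm (invm f) (mulm f g) = g.
Proof. by apply: motion_ext => x; rewrite !act_mulm act_invm. Qed.

Lemma mulmVK (f g : motion R) : mulm f (mulm (invm f) g) = g.
Proof. by apply: motion_ext => x; rewrite !act_mulm act_invmK. Qed.

Lemma mulmKV (f g : motion R) : mulm (mulm f (invm g)) g = f.
Proof. by apply: motion_ext => x; rewrite !act_mulm act_invm. Qed.

Lemma image_act_act (g h : motion R) (A : set (R * R)) :
  act g @` (act h @` A) = act (mulm g h) @` A.
Proof.
apply/seteqP; split=> [_ [_ [x Ax <-] <-]|_ [x Ax <-]].
  by exists x => //; rewrite act_mulm.
by exists (act h x); [exists x|rewrite act_mulm].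
Qed.

Lemma image_act_inj (g : motion R) : injective (fun A : set (R * R) => act g @` A).
Proof.
move=> A B e; apply/seteqP; split=> x Ax.
  have : (act g @` B) (act g x) by rewrite -e; exists x.
  by case=> y By /act_inj <-.
have : (act g @` A) (act g x) by rewrite e; exists x.
by case=> y By /act_inj <-.
Qed.

Lemma image_act_invm (g : motion R) (A : set (R * R)) :
  act (invm g) @` (act g @` A) = A.
Proof.
by apply/seteqP; split=> [_ [_ [x Ax <-] <-]|x Ax];
  [rewrite act_invm|exists (act g x); [exists x|rewrite act_invm]].
Qed.

Lemma act_oseg (g : motion R) v w : act g @` oseg v w = oseg (act g v) (act g w).
Proof.
apply/seteqP; split=> [_ [_ /oseg_pt[t t01 ->] <-]|x /oseg_pt[t t01 ->]].
  by apply/oseg_pt; exists t => //; rewrite pt_act.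
by exists (pt v w t 0); [apply/oseg_pt; exists t|rewrite pt_act].
Qed.

Lemma act_cball (g : motion R) x (r : R) y : cball (act g x) r (act g y) <-> cball x r y.
Proof. by rewrite /cball /= enorm_act. Qed.

Lemma closure_act (g : motion R) (A : set (R * R)) x :
  closure (act g @` A) (act g x) <-> closure A x.
Proof.
split=> /closure_enorm h; apply/closure_enorm => e e0; have [y Ay hy] := h e e0.
  by case: Ay hy => z Az <-; rewrite enorm_act; exists z.
by exists (act g y); [exists y|rewrite enorm_act].
Qed.

Lemma beside_act (g : motion R) (s : R) v w c : beside s v w c ->
  beside s (act g v) (act g w) (act g @` c).
Proof.
move=> /besideP[d d0 hd]; apply/besideP; exists d => // n hn; rewrite -pt_act.
by exists (pt v w 2^-1 (s * n)) => //; exact: hd.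
Qed.

Lemma le00_1 (F : numDomainType) : 0 <= (0 : F) <= 1.
Proof. by rewrite lexx ler01. Qed.

Lemma le01_1 (F : numDomainType) : 0 <= (1 : F) <= 1.
Proof. by rewrite lexx ler01. Qed.

Lemma polar_inj x (r s : R) : x != 0 -> x = rotate (enorm x, 0) (expi r) ->
  x = rotate (enorm x, 0) (expi s) -> expi r = expi s.
Proof.
move=> x0 e1 e2; have n0 : enorm x != 0 by rewrite gt_eqF // enorm_gt0.
have : rotate (enorm x, 0) (expi r) = rotate (enorm x, 0) (expi s) by rewrite -e1 -e2.
rewrite /rotate /= => -[]; rewrite !mul0r !add0r !subr0.
by rewrite /expi => /(mulfI n0) -> /(mulfI n0) ->.
Qed.

(* The radial angle: c is contracted along the image of the rays of the disc. *)
Lemma face_angle c x0 : K 2 c -> ~ c x0 -> exists ra : R * R -> R,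
  (forall y, c y -> y - x0 = rotate (enorm (y - x0), 0) (expi (ra y))) /\
  (forall g : R -> R * R, continuous g -> (forall t, c (g t)) ->
    continuous (fun t => ra (g (clamp t)))).
Proof.
move=> Kc nc; case: KCW => _ _ hchar _.
have [Phi [/subspace_continuousP cPhi im [Psi cPsi can] _]] := hchar _ _ Kc.
move/subspace_continuousP: cPsi => cPsi.
have oPsi y : c y -> odisc (Psi y).
  by rewrite -im => -[a oa <-]; rewrite can //; exact/mem_set.
have PhiPsi y : c y -> Phi (Psi y) = y.
  by rewrite -im => -[a oa <-]; rewrite can //; exact/mem_set.
pose h y (s : R) := Phi (clamp s *: Psi y).
have os y s : c y -> odisc (clamp s *: Psi y).
  move=> cy i; rewrite mxE normrM; have /andP[s0 s1] := clamp01 s.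
  rewrite (ger0_norm s0); apply: le_lt_trans (oPsi y cy i).
  by rewrite ler_piMl.
have ch y s : c y -> c (h y s) by move=> cy; rewrite -im; exists (clamp s *: Psi y) => //; exact: os.
have h1 y : c y -> h y 1 = y.
  by move=> cy; rewrite /h clamp_id ?lexx ?ler01 // scale1r PhiPsi.
have h0 y z : h y 0 = h z 0 by rewrite /h clamp_id ?lexx ?ler01 // !scale0r.
have nz y : c y -> y - x0 != 0.
  by move=> cy; rewrite subr_eq0; apply/eqP => e; rewrite e in cy.
have [b cb] := cell_nonempty KCW Kc.
pose A := arg (h b 0 - x0).
pose L y (r : R) := exists theta : R -> R, [/\ continuous theta,
  forall s, h y s - x0 = rotate (enorm (h y s - x0), 0) (expi (theta s)),
  theta 0 = A & theta 1 = r].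
have Luniq y r r' : c y -> L y r -> L y r' -> r = r'.
  move=> cy [th [cth hth e0 <-]] [th' [cth' hth' e0' <-]].
  have : th 1 - th' 1 = th 0 - th' 0.
    apply: (@cong_const R (fun s => th s - th' s)) => s _.
      by apply: cvgB; [exact: cth|exact: cth'].
    rewrite -(subrr (th' s)); apply: congB; last exact: cong_refl.
    apply/expi_cong; apply: (polar_inj _ (hth s) (hth' s)); apply: nz; exact: ch.
  by rewrite e0 e0'; lra.
have main (g : R -> R * R) : continuous g -> (forall t, c (g t)) ->
    exists2 f : R -> R, continuous f & forall t, L (g (clamp t)) (f t).
  move=> cg gc.
  pose C : set (R * R) := `[0, 1]%classic `*` `[0, 1]%classic.
  pose H (u : R * R) := h (g (clamp u.2)) u.1 - x0.
  have cf : continuous (fun u : R * R => clamp u.1).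
    move=> u; apply: (@continuous_cvg _ _ _ _ (nbhs_filter u) (@fst R R) (@clamp R)).
      exact: clamp_continuous.
    exact: (@cvg_fst_pair _ _ _ (nbhs_filter u) id u cvg_id).
  have cs : continuous (fun u : R * R => g (clamp u.2)).
    move=> u; apply: (@continuous_cvg _ _ _ _ (nbhs_filter u) (@snd R R) (fun t => g (clamp t))).
      by apply: continuous_comp; [exact: clamp_continuous|exact: cg].
    exact: (@cvg_snd_pair _ _ _ (nbhs_filter u) id u cvg_id).
  have cp : continuous (fun u : R * R => Psi (g (clamp u.2))).
    move=> u; apply: (@continuous_within_comp _ _ _ c (fun u : R * R => g (clamp u.2)) Psi).
    - by move=> v; exact: gc.
    - exact: cs.
    exact: cPsi.
  have csp : continuous (fun u : R * R => clamp u.1 *: Psi (g (clamp u.2))).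
    by move=> u; apply: cvgZ; [exact: cf|exact: cp].
  have cH : continuous H.
    move=> u; apply: cvgB; last exact: cvg_cst.
    apply: (@continuous_within_comp _ _ _ (@cdisc R 2)
      (fun u : R * R => clamp u.1 *: Psi (g (clamp u.2))) Phi).
    - by move=> v i; apply/ltW/os.
    - exact: csp.
    by apply: cPhi => i; exact/ltW/os.
  have C01 (s t : R) : 0 <= s <= 1 -> 0 <= t <= 1 -> C (s, t).
    by move=> s01 t01; split; rewrite /= in_itv.
  have [|||| th /subspace_continuousP cth hth] := @angle_lift R _ C (0, 0) H.
  - by apply: compact_setX; exact: segment_compact.
  - move=> [a1 a2] t [/=]; rewrite !in_itv /= => /andP[a10 a11] /andP[a20 a21] /andP[t0 t1].
    split; rewrite /= in_itv /= subr0 add0r.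
      by rewrite mulr_ge0 //= mulr_ile1.
    by rewrite mulr_ge0 //= mulr_ile1.
  - exact: continuous_subspaceT.
  - by move=> u _; apply: nz; apply: ch; exact: gc.
  have cth2 (p : R -> R * R) : continuous p -> (forall t, C (p t)) -> continuous (fun t => th (p t)).
    by move=> cp' pC t; apply: (@continuous_within_comp _ _ _ C p th); [exact: pC|exact: cp'|exact: cth].
  have pc (s : R) : continuous (fun t : R => (s, clamp t)).
    by apply: continuous_pair; [exact: cst_continuous|exact: clamp_continuous].
  have pc' (s : R) : continuous (fun t : R => (clamp t, s)).
    by apply: continuous_pair; [exact: clamp_continuous|exact: cst_continuous].
  have c01 := @clamp01 R; have i0 := @le00_1 R; have i1 := @le01_1 R.
  have cl0 : clamp 0 = 0 :> R by rewrite clamp_id.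
  have cl1 : clamp 1 = 1 :> R by rewrite clamp_id.
  have clc (t : R) : clamp (clamp t) = clamp t by rewrite clamp_id.
  have lift0 t : cong (th (0, clamp t)) A.
    apply/expi_cong; have := hth (0, clamp t) (C01 _ _ i0 (c01 t)).
    rewrite (_ : H _ = h b 0 - x0); last by rewrite /H /= (h0 _ b).
    by move=> e; apply: (polar_inj _ e (argK _)); apply: nz; exact: ch.
  have th0 t : th (0, clamp t) = th (0, 0).
    have : th (0, clamp (1 * clamp t)) - th (0, 0) = th (0, clamp (0 * clamp t)) - th (0, 0).
      apply: (@cong_const R (fun s => th (0, clamp (s * clamp t)) - th (0, 0))) => s _.
        apply: cvgB; last exact: cvg_cst.
        apply: (@continuous_comp _ _ _ (fun s : R => s * clamp t) (fun t => th (0, clamp t))).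
          exact: mulrr_continuous.
        by apply: cth2 => // ?; exact: C01.
      by have := congB (lift0 (s * clamp t)) (lift0 0); rewrite cl0 subrr.
    by rewrite mul1r mul0r cl0 clc; lra.
  have [l el] := lift0 0; rewrite cl0 in el.
  exists (fun t => th (1, clamp t) - (th (0, 0) - A)).
    move=> t; apply: cvgB; last exact: cvg_cst.
    by apply: cth2 => // ?; exact: C01.
  move=> t; exists (fun s => th (clamp s, clamp t) - (th (0, 0) - A)); split.
  - move=> s; apply: cvgB; last exact: cvg_cst.
    by apply: (cth2 (fun s => (clamp s, clamp t))) => // ?; exact: C01.
  - move=> s; have := hth (clamp s, clamp t) (C01 _ _ (c01 s) (c01 t)).
    rewrite /H /= clc.
    have -> : h (g (clamp t)) (clamp s) = h (g (clamp t)) s by rewrite /h clc.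
    move=> {1}->; congr rotate; apply/expi_cong; exists l.
    by rewrite -el; ring.
  - by rewrite cl0 th0; ring.
  by rewrite cl1.
exists (fun y => xget 0 (L y)); split.
  move=> y cy; have [||f _ hf] := main (fun=> y); first exact: cst_continuous.
    by [].
  have := xgetPex 0 (ex_intro _ _ (hf 0)) => -[th [_ hth _ e1]].
  by have := hth 1; rewrite h1 // e1.
move=> g cg gc; have [f cf hf] := main g cg gc.
rewrite (_ : (fun t => _) = f) //; apply/funext => t.
apply: (Luniq (g (clamp t))) => //.
exact: (xgetPex 0 (ex_intro _ _ (hf t))).
Qed.
Variables (L : Type) (P : L -> prototile R) (T : set (tile R L)).
Hypothesis Ttiling : is_tiling P T.
Hypothesis Tcellular : cellular P T K.
Hypothesis Tsym : forall x, local_symmetry T x -> vertex K x.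
Implicit Types (g h : motion R).

Lemma tile_closure k e t x : K k e -> T t -> e x -> shape t x -> closure e `<=` shape t.
Proof.
move=> Ke Tt ex tx; have [_ sub _ _] := Tcellular.
have [cl h] := sub _ Tt; have et : e `<=` shape t by apply: (h _ _ Ke); exists x.
by move=> y /(closureS et); rewrite -(closure_id _).1.
Qed.

Lemma cell_tile k e : K k e -> exists2 t, T t & closure e `<=` shape t.
Proof.
move=> Ke; have [x ex] := cell_nonempty KCW Ke.
have [_ cov _ _] := Ttiling; have [t Tt tx] := cov x.
by exists t => //; apply: tile_closure Ke Tt ex tx.
Qed.

Lemma face_tile_uniq c t t' : is_face T K (c, t) -> is_face T K (c, t') -> t = t'.
Proof.
move=> [/= Kc Tt ct] [_ Tt' ct']; apply: contrapT => ne.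
have [x cx] := cell_nonempty KCW Kc.
have [_ _ /(_ _ _ Tt Tt' ne x) dis _] := Ttiling.
have [] := dis; first by split; [exact: ct|exact: ct'].
case=> _ nint _; apply: nint; apply: (@filterS _ _ _ c); first exact: ct.
by apply: open_nbhs_nbhs; split; [exact: face_open|exact: cx].
Qed.

Lemma mtile1 (t : tile R L) g : act g =1 id -> mtile g t = t.
Proof.
case: t => A l h; rewrite /mtile /=; congr Tile; apply/seteqP; split=> [_ [x Ax <-]|x Ax].
  by rewrite h.
by exists x; rewrite ?h.
Qed.

Lemma mtileM g h (t : tile R L) : mtile g (mtile h t) = mtile (mulm g h) t.
Proof. by rewrite /mtile /= image_act_act. Qed.

Lemma mtile_invK g (t : tile R L) : mtile (invm g) (mtile g t) = t.
Proof. by rewrite mtileM mtile1 // => x; rewrite act_mulm act_invm. Qed.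

Lemma mtile_Kinv g (t : tile R L) : mtile g (mtile (invm g) t) = t.
Proof. by rewrite mtileM mtile1 // => x; rewrite act_mulm act_invmK. Qed.

Lemma tile_meets g (U : set (R * R)) (t : tile R L) :
  shape (mtile g t) `&` (act g @` U) !=set0 <-> shape t `&` U !=set0.
Proof.
split=> [[_ [[x tx <-] [y Uy /act_inj yx]]]|[x [tx Ux]]].
  by exists x; split => //; rewrite -yx.
by exists (act g x); split; exists x.
Qed.

Definition lmatch g x (r : R) :=
  (forall t, T t -> shape t `&` cball x r !=set0 -> T (mtile g t)) /\
  (forall t, T t -> shape t `&` cball (act g x) r !=set0 -> T (mtile (invm g) t)).

Lemma image_cball g x (r : R) : act g @` cball x r = cball (act g x) r.
Proof.
apply/seteqP; split=> [_ [y hy <-]|y hy]; first exact/act_cball.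
exists (act (invm g) y); last exact: act_invmK.
by move: hy; rewrite -{1}(act_invmK g y) => /act_cball.
Qed.

Lemma lmatchP g x (r : R) : lmatch g x r <->
  mtile g @` patch T (cball x r) = patch T (cball (act g x) r).
Proof.
rewrite -image_cball; split=> [[h1 h2]|e].
  apply/seteqP; split=> [_ [t [Tt tx] <-]|t [Tt tx]].
    by split; [exact: h1|exact/tile_meets].
  exists (mtile (invm g) t); last exact: mtile_Kinv.
  split; first by apply: h2 => //; rewrite -image_cball.
  by apply/(tile_meets g); rewrite mtile_Kinv.
split=> t Tt tx; first by have : (mtile g @` patch T (cball x r)) (mtile g t) by [exists t]; rewrite e => -[].
rewrite -image_cball in tx; have : (patch T (act g @` cball x r)) t by [].
by rewrite -e => -[t' [Tt' _] <-]; rewrite mtile_invK.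
Qed.

Lemma lmatch_sub g x y (r r' : R) : lmatch g x r -> enorm (y - x) + r' <= r -> lmatch g y r'.
Proof.
move=> [h1 h2] le; split=> t Tt [z [tz /= zy]]; [apply: h1|apply: h2] => //; exists z; split=> //=.
  by have := enorm_tri z y x; move: zy; rewrite /cball /=; lra.
by have := enorm_tri z (act g y) (act g x); move: zy; rewrite /cball /= enorm_act; lra.
Qed.

Lemma lmatch_inv g x (r : R) : lmatch g x r -> lmatch (invm g) (act g x) r.
Proof. by move=> [h1 h2]; split=> t Tt; [exact: h2|rewrite act_invm invmK; exact: h1]. Qed.

Lemma lmatch_cell g x (r : R) k e y : lmatch g x r -> K k e -> closure e y ->
  enorm (y - x) <= r -> K k (act g @` e).
Proof.
move=> [h1 _] Ke ey yx; have [t Tt et] := cell_tile Ke.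
have [_ _ _ /(_ g t _ Tt _ erefl k)] := Tcellular.
have Tg : T (mtile g t) by apply: h1 => //; exists y; split => //; exact: et.
move=> /(_ Tg) e1; have : cells_in K (shape (mtile g t)) k (act g @` e).
  by rewrite e1; exists e => //; split => // z /subset_closure /et.
by case.
Qed.

Lemma lmatch_vertex g x (r : R) v : lmatch g x r -> vertex K v ->
  enorm (v - x) <= r -> vertex K (act g v).
Proof.
move=> lm Kv le; rewrite /vertex -image_set1; apply: (lmatch_cell lm Kv) le.
exact: subset_closure.
Qed.

Lemma lmatch_vertexE g x (r : R) v : lmatch g x r -> enorm (v - x) <= r ->
  vertex K (act g v) <-> vertex K v.
Proof.
move=> lm le; split=> h; last exact: lmatch_vertex h le.
by rewrite -(act_invm g v); apply: (lmatch_vertex (lmatch_inv lm)) h _; rewrite enorm_act.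
Qed.

Lemma lmatch_edge g x (r : R) v w : lmatch g x r -> edge K v w ->
  enorm (v - x) <= r -> edge K (act g v) (act g w).
Proof.
move=> lm [ne Ke] le; split; first by apply: contra_neq ne; exact: act_inj.
rewrite -act_oseg; apply: (lmatch_cell lm Ke) le.
by rewrite closure_oseg; exact: cseg_left.
Qed.

Lemma lmatch_edgeE g x (r : R) v w : lmatch g x r -> enorm (v - x) <= r ->
  edge K (act g v) (act g w) <-> edge K v w.
Proof.
move=> lm le; split=> h; last exact: lmatch_edge h le.
rewrite -(act_invm g v) -(act_invm g w).
by apply: (lmatch_edge (lmatch_inv lm)) h _; rewrite enorm_act.
Qed.

Lemma closure_side (s : R) v w : s = 1 \/ s = -1 -> edge K v w -> closure (side s v w) v.
Proof. by move=> hs e; apply: (edge_sub_closure_side hs e); exact: cseg_left. Qed.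

Lemma lmatch_side (s : R) g x (r : R) v w : s = 1 \/ s = -1 -> lmatch g x r -> edge K v w ->
  enorm (v - x) <= r -> side s (act g v) (act g w) = act g @` side s v w.
Proof.
move=> hs lm e le; have [Ks bs] := sideP hs e; apply/esym/(side_uniq hs).
- exact: lmatch_edge le.
- exact: (lmatch_cell lm Ks (closure_side hs e) le).
exact: beside_act.
Qed.

Lemma lmatch_lface g x (r : R) v w : lmatch g x r -> edge K v w ->
  enorm (v - x) <= r -> lface (act g v) (act g w) = act g @` lface v w.
Proof. exact: lmatch_side pm1. Qed.

Lemma lmatch_rface g x (r : R) v w : lmatch g x r -> edge K v w ->
  enorm (v - x) <= r -> rface (act g v) (act g w) = act g @` rface v w.
Proof. exact: lmatch_side pm2. Qed.

Lemma lmatch_isface g x (r : R) c t y : lmatch g x r -> is_face T K (c, t) -> closure c y ->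
  enorm (y - x) <= r -> is_face T K (mface g (c, t)).
Proof.
move=> lm [/= Kc Tt ct] cy le; have [z cz] := cell_nonempty KCW Kc.
split=> /=; first exact: (lmatch_cell lm Kc cy le).
  apply: lm.1 => //; exists y; split=> //.
  by apply: (tile_closure Kc Tt cz) cy; exact: ct.
by move=> _ [u cu <-]; exists u => //; exact: ct.
Qed.

Definition diam : R := xget 0 [set D : R | forall t, T t -> bounded_by (shape t) D].

Lemma diamP t : T t -> bounded_by (shape t) diam.
Proof.
have [_ _ _ h] := Ttiling; rewrite /diam.
by move: t; exact: (xgetPex 0 (P := [set D : R | forall t, T t -> bounded_by (shape t) D]) h).
Qed.

Lemma cell_diam k e x y : K k e -> closure e x -> closure e y -> enorm (x - y) <= diam.
Proof. by move=> Ke ex ey; have [t Tt et] := cell_tile Ke; apply: (diamP Tt); exact: et. Qed.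

Lemma diam_ge0 : 0 <= diam.
Proof.
have [_ cov _ _] := Ttiling; have [t Tt tx] := cov 0.
by apply: le_trans (diamP Tt tx tx); exact: enorm_ge0.
Qed.

Lemma edge_diam v w : edge K v w -> enorm (v - w) <= diam.
Proof.
by move=> [_ Ke]; apply: (cell_diam Ke); rewrite closure_oseg; [exact: cseg_left|exact: cseg_right].
Qed.

Lemma near_vertex x : exists2 v, vertex K v & enorm (v - x) <= diam.
Proof.
have [c Kc cx] := face_at x; have [v Kv cv] := face_vertex Kc.
by exists v => //; exact: (cell_diam Kc).
Qed.

Lemma vertices_finite x (r : R) : finite_set [set v | vertex K v /\ enorm (v - x) <= r].
Proof.
have inj : {in (fun v : R * R => [set v]) @^-1`
    [set e | (exists k, K k e) /\ e `&` cball x r !=set0] &, injective (fun v : R * R => [set v])}.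
  by move=> v w _ _ e; have : [set w] v by rewrite -e.
apply: sub_finite_set (finite_preimage inj (cells_finite KCW (@cball_compact R x r))).
by move=> v [Kv vx]; split; [exists 0%N|exists v].
Qed.

Lemma iter_period (I : choiceType) (A : set I) (f : I -> I) i : finite_set A -> injective f ->
  (forall n, A (iter n f i)) -> exists2 n, (0 < n)%N & iter n f i = i.
Proof.
move=> fA inj hA; apply: contrapT => h.
have lt m n : (m < n)%N -> iter m f i <> iter n f i.
  move=> mn; rewrite -(subnKC (ltnW mn)) iterD => e; apply: h.
  exists (n - m)%N; first by rewrite subn_gt0.
  by move: (n - m)%N e => k; elim: m {mn} => [|m IH] /= => [<- //|/inj/IH].
have ij : {in (fun n => iter n f i) @^-1` A &, injective (fun n => iter n f i)}.
  by move=> m n _ _ e; have [/lt|/lt|//] := ltngtP m n; rewrite e.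
apply: infinite_nat; apply: sub_finite_set (finite_preimage ij fA).
by move=> n _; exact: hA.
Qed.

Lemma iter_mult (I : Type) (f : I -> I) i m n : iter n f i = i -> iter (m * n) f i = i.
Proof. by move=> e; elim: m => // m IH; rewrite mulSn iterD IH. Qed.

Lemma iter_act g n : exists h, act h =1 iter n (act g).
Proof.
elim: n => [|n [h IH]]; last by exists (mulm g h) => x; rewrite act_mulm IH.
by exists (mulm g (invm g)) => x; rewrite act_mulm act_invmK.
Qed.

Lemma act_fix2 g v w : v != w -> act g v = v -> act g w = w -> act g =1 id.
Proof.
move=> ne ev ew.
have r1 : rot g = (1, 0).
  have : rotate (rot g - (1, 0)) (w - v) = 0.
    rewrite rotateC rotateBr (rotateC _ (1, 0)) rotate1 (rotateC (w - v)) -act_sub ev ew.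
    exact: subrr.
  move=> /(congr1 (@enorm R)); rewrite enormM enorm0 => /eqP; rewrite mulf_eq0 => /orP[/eqP e|].
    by apply/eqP; rewrite -subr_eq0; apply/eqP; exact: enorm_eq0.
  by rewrite gt_eqF // enorm_gt0 // subr_eq0 eq_sym.
move=> x; rewrite -[LHS](subrK v) -{1}ev act_sub r1 rotate1; exact: subrK.
Qed.

Lemma fixed_point g : rot g <> (1, 0) -> exists x, act g x = x.
Proof.
move=> ne; pose d := (1, 0) - rot g; have d0 : d != 0 by rewrite subr_eq0; apply/eqP => /esym.
have n0 : enorm d != 0 by rewrite gt_eqF // enorm_gt0.
pose x := rotate (rotate ((enorm d ^+ 2)^-1, 0) (conjp d)) (trans g); exists x.
have : rotate d x = trans g.
  rewrite /x rotateA (_ : rotate d _ = (1, 0)) ?rotate1 // rotateC -rotateA conjpK /rotate /=.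
  by rewrite !mul0r mulr0 subr0 addr0 mulVf // expf_neq0.
rewrite /d rotateC rotateBr (rotateC _ (1, 0)) rotate1 (rotateC x) /act => <-.
by rewrite addrC subrK.
Qed.

Lemma face_corner c : K 2 c -> exists v w, edge K v w /\ c = lface v w.
Proof.
move=> Kc; have [v Kv cv] := face_vertex Kc.
by have [w e ->] := vertex_face Kv Kc cv; exists v, w.
Qed.

Lemma face_symmetry g c t : is_face T K (c, t) -> mface g (c, t) = (c, t) -> act g =1 id.
Proof.
move=> fc [hc ht]; have [/= Kc Tt ct] := fc.
have [v [w [evw cE]]] := face_corner Kc; have [Kv Kw] := edge_vertex evw.
have cw : closure c w by rewrite cE; apply: (edge_sub_closure_side pm1 evw); exact: cseg_right.
have cv : closure c v by rewrite cE; apply: (closure_side pm1 evw).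
have [y0 cy0] := cell_nonempty KCW Kc; have tc := tile_closure Kc Tt cy0 (ct _ cy0).
have [n n0 per] : exists2 n, (0 < n)%N & forall y, iter n (act g) y = y.
  have per u : vertex K u -> closure c u -> exists2 n, (0 < n)%N & iter n (act g) u = u.
    move=> Ku cu; apply: (iter_period (vertices_finite v diam) (@act_inj g)) => n.
    suff [Kn tn] : vertex K (iter n (act g) u) /\ shape t (iter n (act g) u).
      by split=> //; apply: (diamP Tt) => //; exact: tc.
    elim: n => [|n [Kn tn]] /=; first by split=> //; exact: tc.
    split; last by rewrite -ht; exists (iter n (act g) u).
    have [_ _ _ /(_ g t t Tt Tt ht 0%N) e] := Tcellular.
    have : cells_in K (shape t) 0 (act g @` [set iter n (act g) u]).
      by rewrite {1}e; exists [set iter n (act g) u] => //; split=> // _ ->.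
    by rewrite image_set1 => -[].
  have [n1 n10 e1] := per _ Kv cv; have [n2 n20 e2] := per _ Kw cw.
  exists (n1 * n2)%N; first by rewrite muln_gt0 n10.
  have [h hE] := iter_act g (n1 * n2); move=> y; rewrite -hE; apply: (@act_fix2 h v w evw.1).
    by rewrite hE mulnC iter_mult.
  by rewrite hE iter_mult.
have cg y k : c y -> c (iter k (act g) y).
  by move=> cy; elim: k => //= k IH; rewrite -hc; exists (iter k (act g) y).
have [r1|/fixed_point[x0 fx]] := pselect (rot g = (1, 0)).
  have gE x : act g x = x + trans g by rewrite /act r1 rotate1.
  have iE k x : iter k (act g) x = x + trans g *+ k.
    by elim: k => [|k IH] /=; rewrite ?addr0 // gE IH mulrSr addrA.
  have t0 : trans g = 0.
    have := per 0; rewrite iE add0r; case: (trans g) => a b /= e.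
    have z (a' b' : R) k : (a', b') *+ k = (a' *+ k, b' *+ k).
      by elim: k => //= k IH; rewrite !mulrSr IH.
    move: e; rewrite z => -[/eqP + /eqP]; rewrite !mulrn_eq0 !(gtn_eqF n0) /=.
    by move=> /eqP -> /eqP ->.
  by move=> x; rewrite gE t0 addr0.
have [cx|ncx] := pselect (c x0).
  have [e e0 he] := open_enorm (face_open Kc) cx.
  have [//|r1] := pselect (rot g = (1, 0)).
    by move=> r1 x; rewrite -[LHS](subrK (act g x0)) act_sub r1 rotate1 fx; exact: subrK.
  have sub : cball x0 (e / 2) `<=` c.
    by move=> z hz; apply: he; apply: le_lt_trans hz _; lra.
  have pE : patch T (cball x0 (e / 2)) = [set t].
    apply/seteqP; split=> [t' [Tt' [z [tz /sub cz]]]|_ ->].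
      apply: (@face_tile_uniq c) => //; split=> //= z' cz'.
      by apply: (tile_closure Kc Tt' cz tz); exact: subset_closure.
    by split=> //; exists x0; split; [exact: ct|rewrite /cball /= subrr enorm0; lra].
  exfalso; apply: (face_vertexN Kc cx); apply: Tsym; exists (e / 2); first lra.
  by exists g; split=> //; rewrite pE image_set1 ht.
have [ra [hra cra]] := face_angle Kc ncx.
pose phi := arg (rot g); pose D y := ra (act g y) - ra y - phi.
have Dc y : c y -> cong (D y) 0.
  move=> cy; rewrite -(subrr (ra y + phi)) /D -addrA -opprD; apply: congB; last exact: cong_refl.
  apply/expi_cong; have yx : y - x0 != 0.
    by rewrite subr_eq0; apply/eqP => e; rewrite e in cy.
  apply: (@polar_inj (act g y - x0)); last 1 first.
  - rewrite -{1 2}fx enorm_act act_sub {1}(hra _ cy) expiD -(expi_arg (rot_norm g)) -/phi.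
    by rewrite rotateA (rotateC (expi phi)) -rotateA (rotateC (expi phi)).
  - by rewrite -fx act_sub; apply/eqP => /(congr1 (@enorm R)) /eqP; 
      rewrite enormM rot_norm mul1r enorm0 gt_eqF // enorm_gt0.
  by apply: hra; exact: (cg _ 1%N).
have Deq y z : c y -> c z -> D y = D z.
  move=> cy cz; have [f [cf fc' <- <-]] := face_connected Kc cz cy.
  have := @cong_const R (fun s => D (f (clamp s))); rewrite !clamp_id ?le00_1 ?le01_1 //; apply.
    move=> s _; apply: cvgB; last exact: cvg_cst.
    apply: cvgB; last exact: cra.
    apply: (cra (fun s => act g (f s))); last by move=> ?; exact: (cg _ 1%N).
    move=> u; apply: cvgD; last exact: cvg_cst.
    by apply: cvg_rotate; [exact: cvg_cst|exact: cf].
  by move=> s _; exact: Dc.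
have it k : ra (iter k (act g) y0) = ra y0 + k%:R * (phi + D y0).
  elim: k => [|k IH]; first by rewrite mul0r addr0.
  have := Deq _ _ (cg _ k cy0) cy0; rewrite {1}/D /= IH -natr1 mulrDl mul1r.
  by move: (D y0) (_%:R * _) => d m; lra.
have : phi + D y0 = 0.
  have /eqP := it n; rewrite per eq_sym -subr_eq0 addrC addKr mulf_eq0 pnatr_eq0.
  by rewrite (gtn_eqF n0) /= => /eqP.
move=> e; have ph0 : phi = 0.
  apply: cong_eq.
    have := congN (Dc _ cy0); rewrite oppr0; rewrite (_ : - D y0 = phi) //; lra.
  have := arg_gt (rot g); have := arg_le (rot g); have := pi_gt0 R; rewrite -/phi subr0.
  by move=> h1 h2 h3; rewrite ltr_norml; apply/andP; split; lra.
have r1 : rot g = (1, 0) by rewrite -(expi_arg (rot_norm g)) -/phi ph0 expi0.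
by move=> x; rewrite -[LHS](subrK (act g x0)) act_sub r1 rotate1 fx; exact: subrK.
Qed.

(** * The winding number of the face directions *)

Variable dir : facet R L -> facet R L.
Hypothesis Hdir : face_directions T K dir.
Variables (c1 c2 : set (R * R) -> set (R * R)) (rho : set (R * R) -> R).
Hypothesis Hedge : edge_choices T K dir c1 c2 rho.

Fact idm_unit : ((1, 0) : R * R).1 ^+ 2 + ((1, 0) : R * R).2 ^+ 2 == 1.
Proof. by rewrite /= expr1n expr0n addr0. Qed.

Definition idm : motion R := Motion 0 idm_unit.

Lemma rot_mulm g h : rot (mulm g h) = rotate (rot g) (rot h). Proof. by []. Qed.

Lemma rot_invm g : rot (invm g) = conjp (rot g). Proof. by []. Qed.

Definition hmot c : motion R :=
  xget idm [set h | exists t, is_face T K (c, t) /\ mface h (c, t) = dir (c, t)].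

Lemma hmotP c : K 2 c -> exists t, is_face T K (c, t) /\ mface (hmot c) (c, t) = dir (c, t).
Proof.
move=> Kc; apply: (@xgetPex _ idm [set h | exists t, is_face T K (c, t) /\ mface h (c, t) = dir (c, t)]).
have [t Tt ct] := cell_tile Kc.
have fc : is_face T K (c, t) by split=> //=; apply: subset_trans ct; exact: subset_closure.
by have [h e] := Hdir.1 _ fc; exists h, t.
Qed.

Lemma mfaceM g h (X : facet R L) : mface g (mface h X) = mface (mulm g h) X.
Proof. by rewrite /mface /= image_act_act mtileM. Qed.

Lemma mface1 g (X : facet R L) : act g =1 id -> mface g X = X.
Proof.
case: X => c t h; rewrite /mface /= mtile1 //; congr pair.
by apply/seteqP; split=> [_ [x cx <-]|x cx]; [rewrite h|exists x].
Qed.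

Lemma hmot_uniq h c t : is_face T K (c, t) -> mface h (c, t) = dir (c, t) -> h = hmot c.
Proof.
move=> fc e; have [/= Kc _ _] := fc; have [t' [fc' e']] := hmotP Kc.
have tE := face_tile_uniq fc' fc; rewrite tE in e'.
have : mface (mulm (invm (hmot c)) h) (c, t) = (c, t).
  by rewrite -mfaceM e -e' mfaceM mface1 // => x; rewrite act_mulm act_invm.
move=> /(face_symmetry fc) s; apply: motion_ext => x.
by rewrite -[LHS](act_invmK (hmot c)) -(act_mulm (invm (hmot c))) s.
Qed.

Lemma hmot_act g x (r : R) c y : lmatch g x r -> K 2 c -> closure c y ->
  enorm (y - x) <= r -> hmot (act g @` c) = mulm (hmot c) (invm g).
Proof.
move=> lm Kc cy le; have [t [fc e]] := hmotP Kc.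
have fg := lmatch_isface lm fc cy le; apply/esym/(hmot_uniq fg).
rewrite -[(_, _)]/(mface g (c, t)).
rewrite (Hdir.2 _ _ fc fg) -e mfaceM; congr mface.
by apply: motion_ext => z; rewrite !act_mulm act_invm.
Qed.

Definition turn c : R := arg (rot (hmot c)).

Definition cross v w : R := contribution c1 rho v w (lface v w).

Lemma edge_rotationE c c' (r : R) : edge_rotation T K dir c c' r -> cong r (turn c' - turn c).
Proof.
move=> [t1 [t2 [h1 [h2 [f1 f2 e1 e2]]]]].
rewrite (hmot_uniq f1 e1) (hmot_uniq f2 e2) rot_mulm rot_invm => e.
apply/expi_cong; rewrite [LHS]/expi -e expiD expiN /turn.
by rewrite !expi_arg //; exact: rot_norm.
Qed.

Lemma edge_sides v w : edge K v w ->
  (c1 (oseg v w) = lface v w /\ c2 (oseg v w) = rface v w /\ lface v w <> rface v w) \/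
  (c1 (oseg v w) = rface v w /\ c2 (oseg v w) = lface v w /\ lface v w <> rface v w).
Proof.
move=> evw; have [K1 K2 ne sub _] := Hedge.1 _ evw.2.
have s1 : oseg v w `<=` closure (c1 (oseg v w)) by move=> x /sub[].
have s2 : oseg v w `<=` closure (c2 (oseg v w)) by move=> x /sub[].
have [e1|e1] := face_edge_cases evw K1 s1; have [e2|e2] := face_edge_cases evw K2 s2.
- by case: ne; rewrite e1 e2.
- by left; rewrite -e1 -e2.
- by right; rewrite -e1 -e2; split => //; split=> // /esym.
by case: ne; rewrite e1 e2.
Qed.

Lemma cross_cong v w : edge K v w -> cong (cross v w) (turn (rface v w) - turn (lface v w)).
Proof.
move=> evw; have [_ _ _ _ /edge_rotationE h] := Hedge.1 _ evw.2; rewrite /cross /contribution.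
have [[e1 [e2 ne]]|[e1 [e2 ne]]] := edge_sides evw; rewrite e1 e2 in h *.
  by rewrite asboolT.
by rewrite asboolF // -opprB; exact: congN.
Qed.

Lemma crossN v w : edge K v w -> cross w v = - cross v w.
Proof.
move=> evw; rewrite /cross /contribution (oseg_sym w v) -rface_swap //.
have [[e1 [e2 ne]]|[e1 [e2 ne]]] := edge_sides evw; rewrite e1.
  by rewrite asboolF ?asboolT //; exact: nesym.
by rewrite asboolT // asboolF // opprK.
Qed.

Lemma lmatch_oseg g x (r : R) v w : lmatch g x r -> edge K v w -> enorm (v - x) <= r ->
  mtile g @` patch T (oseg v w) = patch T (act g @` oseg v w).
Proof.
move=> [h1 h2] e le.
have tv t u v' w' : edge K v' w' -> T t -> shape t u -> oseg v' w' u -> shape t v'.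
  move=> [_ Ke] Tt tu eu; apply: (tile_closure Ke Tt eu tu).
  by rewrite closure_oseg; exact: cseg_left.
apply/seteqP; split=> [_ [t [Tt [u [tu eu]]] <-]|t [Tt [u [tu eu]]]].
  split; last by apply/tile_meets; exists u.
  apply: h1 => //; exists v; split=> //; exact: tv e Tt tu eu.
have eg := lmatch_edge (conj h1 h2) e le.
exists (mtile (invm g) t); last exact: mtile_Kinv.
split; last by apply/(tile_meets g); rewrite mtile_Kinv; exists u.
apply: h2 => //; exists (act g v); split; last by rewrite /cball /= enorm_act.
by apply: tv eg Tt tu _; rewrite -act_oseg.
Qed.

Lemma lmatch_cross g x (r : R) v w : lmatch g x r -> edge K v w -> enorm (v - x) <= r ->
  cross (act g v) (act g w) = cross v w.
Proof.
move=> lm e le; have eg := lmatch_edge lm e le.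
have := Hedge.2 g _ e.2; rewrite act_oseg => /(_ eg.2); rewrite -act_oseg (lmatch_oseg lm e le) => /(_ erefl) [e1 _ er].
rewrite /cross /contribution (lmatch_lface lm e le) -act_oseg e1 er.
have [h|h] := pselect (lface v w = c1 (oseg v w)); first by rewrite !asboolT // h.
by rewrite !asboolF // => /image_act_inj.
Qed.

Lemma finite_uniq (I : choiceType) (A : set I) : finite_set A ->
  exists2 s : seq I, uniq s & A = [set` s].
Proof.
move=> /finite_seqP[s ->]; exists (undup s); first exact: undup_uniq.
by apply/seteqP; split=> x /=; rewrite mem_undup.
Qed.

Lemma fsumB (I : choiceType) (V : zmodType) (A : set I) (F G : I -> V) : finite_set A ->
  \sum_(i \in A) (F i - G i) = \sum_(i \in A) F i - \sum_(i \in A) G i.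
Proof. by move=> /finite_uniq[s us ->]; rewrite -!fsbig_seq // sumrB. Qed.

Lemma fsum_cong (I : choiceType) (A : set I) (F G : I -> R) : finite_set A ->
  (forall i, A i -> cong (F i) (G i)) ->
  cong (\sum_(i \in A) F i) (\sum_(i \in A) G i).
Proof.
move=> /finite_uniq[s us ->] h; rewrite -!fsbig_seq //.
elim: s {us} h => [|i s IH] h; first by rewrite !big_nil; exact: cong_refl.
rewrite !big_cons; apply: congD; first by apply: h; rewrite /= inE eqxx.
by apply: IH => j js; apply: h; rewrite /= inE (js : j \in s) orbT.
Qed.

Lemma lmatch_nbrs (V : zmodType) g v (r : R) (F : R * R -> V) : lmatch g v r -> 0 <= r ->
  \sum_(w \in [set w | edge K (act g v) w]) F w =
  \sum_(w \in [set w | edge K v w]) F (act g w).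
Proof.
move=> lm r0; rewrite -(fsbig_image _ (act g) F); last by move=> a b _ _ /act_inj.
congr (\sum_(w \in _) F w); apply/seteqP; split=> [w /= e|_ [w e <-]].
  exists (act (invm g) w); last exact: act_invmK.
  by apply/(lmatch_edgeE _ lm); rewrite ?subrr ?enorm0 // act_invmK.
by apply: (lmatch_edge lm e); rewrite subrr enorm0.
Qed.

Definition sigma v : int :=
  if `[< vertex K v >] then
    xget 0 [set k : int | 2 * pi * k%:~R = - \sum_(w \in [set w | edge K v w]) cross v w]
  else 0.

Lemma sigmaP v : vertex K v ->
  2 * pi * (sigma v)%:~R = - \sum_(w \in [set w | edge K v w]) cross v w.
Proof.
move=> Kv; rewrite /sigma asboolT //.
apply: (@xgetPex _ 0 [set k : int | 2 * pi * k%:~R = - \sum_(w \in [set w | edge K v w]) cross v w]).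
have fA := nbrs_finite v.
have [k e] : cong (\sum_(w \in [set w | edge K v w]) cross v w) 0.
  have := fsum_cong fA (fun w => @cross_cong v w).
  by rewrite (fsumB _ _ fA) (@tour_sum v R turn Kv) subrr.
by exists (- k) => /=; rewrite mulrNz mulrN -e subr0.
Qed.

Lemma sigma_winding : winding_chain K c1 rho sigma.
Proof.
split=> v Kv; first by rewrite /sigma asboolF.
have [ws [us mem tour]] := tour_exists Kv.
exists ws, (fun i => lface v (nth 0 ws i)); split.
  split=> // i si; have e : edge K v (nth 0 ws i) by apply/mem/mem_nth.
  have [Kl bl] := sideP pm1 e; have [Kr br] := sideP pm2 e.
  by split=> //; rewrite -tour.
rewrite sigmaP //; congr (- _).
have -> : [set w | edge K v w] = [set` ws] by apply/seteqP; split=> w /mem.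
by rewrite -fsbig_seq // (big_nth 0) big_mkord.
Qed.

Lemma thicken1 v (r : R) : thicken [set v] r = cball v r.
Proof. by apply/seteqP; split=> [x [_ -> ]//|x hx]; exists v. Qed.

Lemma sigma_C0 : C0 T K sigma.
Proof.
split=> [v|]; first by apply: contraPP => Kv; rewrite /sigma asboolF // eqxx.
exists 1 => // g v Kv Kg; rewrite !thicken1 => /lmatchP lm.
apply/eqP; rewrite -(eqr_int R) -(inj_eq (mulfI (_ : 2 * pi != 0 :> R))); last first.
  by have := pi_gt0 R => h; apply/eqP; lra.
rewrite !sigmaP // (lmatch_nbrs _ lm) //; apply/eqP; congr (- _); apply: eq_fsbigr => w.
by move=> /set_mem e; rewrite (lmatch_cross lm) // subrr enorm0.
Qed.
Lemma dE_ge (f g : motion R) x : enorm x <= 1 -> enorm (act f x - act g x) <= dE f g.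
Proof.
move=> hx; apply: ub_le_sup; last by exists x.
exists (enorm (trans f - trans g) + 2) => _ [y /= hy <-].
rewrite /act (_ : _ - _ = (trans f - trans g) + (rotate (rot f) y - rotate (rot g) y)).
  apply: le_trans (enormD _ _) _; rewrite lerD2l; apply: le_trans (enormD _ _) _.
  rewrite enormN !enormM !rot_norm; lra.
by rewrite opprD addrACA addrC.
Qed.

Lemma dE_le_rot (f g : motion R) :
  dE f g <= enorm (trans f - trans g) + enorm (rot f - rot g).
Proof.
apply: ge_sup; first by exists (enorm (act f 0 - act g 0)), 0 => //=; rewrite enorm0.
move=> _ [y /= hy <-].
rewrite /act (_ : _ - _ = (trans f - trans g) + rotate y (rot f - rot g)).
  apply: le_trans (enormD _ _) _; rewrite lerD2l enormM.
  by rewrite ler_piMl //; exact: enorm_ge0.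
by rewrite rotateBr !(rotateC y) opprD addrACA addrC.
Qed.

Lemma dE_trans (f g : motion R) : enorm (trans f - trans g) <= dE f g.
Proof.
have := @dE_ge f g 0; rewrite enorm0 => /(_ ler01).
by rewrite /act !rotate0 !add0r.
Qed.

Lemma dE_rot (f g : motion R) : enorm (rot f - rot g) <= 2 * dE f g.
Proof.
have e1 : enorm ((1, 0) : R * R) = 1 by rewrite /enorm /= expr1n expr0n addr0 sqrtr1.
have := @dE_ge f g (1, 0); rewrite e1 => /(_ (lexx _)).
rewrite /act !(rotateC _ (1, 0)) !rotate1 => h.
have -> : rot f - rot g = (rot f + trans f - (rot g + trans g)) - (trans f - trans g).
  by rewrite (opprD (rot g)) addrACA addrK.
by have := enormD (rot f + trans f - (rot g + trans g)) (- (trans f - trans g));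
  have := dE_trans f g; rewrite enormN; lra.
Qed.

Lemma nbhs_motion (f : motion R) (A : set (motion R)) :
  nbhs f A <-> exists2 e : R, 0 < e & forall g, dE f g < e -> A g.
Proof.
rewrite -[nbhs f A]/(\near f, A f) metricType_numDomainType.nbhs_mdistP; split.
  by move=> [e /= e0 h]; exists e.
by move=> [e e0 h]; exists e.
Qed.

Section MotionLimits.
Variables (X : Type) (F : set_system X).
Context {FF : Filter F}.
Implicit Types s : X -> motion R.

Lemma cvg_enormP (s : X -> R * R) a : s @ F --> a <->
  forall e : R, 0 < e -> F [set t | enorm (s t - a) < e].
Proof.
split=> h; first by move=> e e0; apply: (h [set y | enorm (y - a) < e]); apply/nbhs_enorm; exists e.
by move=> A /nbhs_enorm[e e0 hA]; apply: filterS (h e e0) => t; exact: hA.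
Qed.

Lemma cvg_motion s f : (fun t => trans (s t)) @ F --> trans f ->
  (fun t => rot (s t)) @ F --> rot f -> s @ F --> f.
Proof.
move=> /cvg_enormP ht /cvg_enormP hr A /nbhs_motion[e e0 hA].
have e2 : 0 < e / 2 by lra.
apply: (@filterS _ F _ _ (s @^-1` A) _ (filterI (ht _ e2) (hr _ e2))) => t [/= h1 h2]; apply: hA.
apply: le_lt_trans (dE_le_rot _ _) _; rewrite enormB (enormB (rot f)); lra.
Qed.

Lemma cvg_trans_part s f : s @ F --> f -> (fun t => trans (s t)) @ F --> trans f.
Proof.
move=> h; apply/cvg_enormP => e e0.
apply: (h [set g | enorm (trans g - trans f) < e]); apply/nbhs_motion; exists e => // g hg.
by rewrite /= enormB; apply: le_lt_trans hg; exact: dE_trans.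
Qed.

Lemma cvg_rot s f : s @ F --> f -> (fun t => rot (s t)) @ F --> rot f.
Proof.
move=> h; apply/cvg_enormP => e e0.
apply: (h [set g | enorm (rot g - rot f) < e]); apply/nbhs_motion; exists (e / 2); first lra.
by move=> g hg; rewrite /= enormB; have := dE_rot f g; lra.
Qed.

Lemma cvg_act g (s : X -> R * R) a : s @ F --> a -> (fun t => act g (s t)) @ F --> act g a.
Proof.
move=> /cvg_enormP h; apply/cvg_enormP => e e0.
by apply: filterS (h e e0) => t; rewrite /= enorm_act.
Qed.

Lemma cvg_rot_act g (s : X -> R * R) a : s @ F --> a ->
  (fun t => rotate (rot g) (s t)) @ F --> rotate (rot g) a.
Proof.
move=> /cvg_enormP h; apply/cvg_enormP => e e0.
by apply: filterS (h e e0) => t; rewrite /= -rotateBr enormM rot_norm mul1r.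
Qed.

End MotionLimits.

Lemma compact_motions x (r : R) : compact [set f : motion R | enorm (trans f - x) <= r].
Proof.
pose mk (u : (R * R) * R) : motion R := Motion u.1 (introT eqP (etrans (esym (enorm_sqr (expi u.2))) (etrans (congr1 (fun t => t ^+ 2) (enorm_expi u.2)) (expr1n _ 2)))).
have -> : [set f : motion R | enorm (trans f - x) <= r] = mk @` (cball x r `*` `[- pi, pi]%classic).
  apply/seteqP; split=> [f fx|_ [u [ux _] <-]] //.
  exists (trans f, arg (rot f)); last by apply: motion_eq => //=; exact: expi_arg (rot_norm f).
  by split=> //=; rewrite in_itv /= arg_le ltW ?arg_gt.
apply: continuous_compact; last by apply: compact_setX; [exact: cball_compact|exact: segment_compact].
apply: continuous_subspaceT => u; apply: (@cvg_motion _ _ (nbhs_filter u)); first exact: cvg_fst.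
apply: (@continuous_cvg _ _ _ _ (nbhs_filter u) (fun v : (R * R) * R => v.2) (@expi R)).
  exact: expi_continuous.
exact: cvg_snd.
Qed.

Lemma compact_motions_bounded (A : set (motion R)) : compact A ->
  exists r : R, forall f, A f -> enorm (trans f) <= r.
Proof.
move=> cA; have cT : compact (@trans R @` A).
  apply: continuous_compact cA; apply: continuous_subspaceT => f.
  exact: (@cvg_trans_part _ _ (nbhs_filter f) id f).
have [M [_ hM]] := compact_bounded cT.
exists (2 * (M + 1)) => f Af; have := hM (M + 1) _ (trans f) (imageP _ Af).
rewrite ltrDl ltr01 => /(_ isT) /=; rewrite /Num.Def.normr /= ge_max => /andP[h1 h2].
by apply: le_trans (enorm_le _) _; lra.
Qed.

Lemma continuous_mulm g (X : topologicalType) (s : X -> motion R) : continuous s ->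
  continuous (fun t => mulm g (s t)).
Proof.
move=> cs t; apply: (@cvg_motion _ _ (nbhs_filter t)).
  exact: (@cvg_act _ _ (nbhs_filter t) g _ _ (@cvg_trans_part _ _ (nbhs_filter t) _ _ (cs t))).
exact: (@cvg_rot_act _ _ (nbhs_filter t) g _ _ (@cvg_rot _ _ (nbhs_filter t) _ _ (cs t))).
Qed.

Definition finsupp (I : choiceType) (V : zmodType) (F : I -> V) := finite_set [set i | F i != 0].

Lemma fsumT (I : choiceType) (V : zmodType) (A : set I) (F : I -> V) : (forall i, F i != 0 -> A i) -> \sum_(i \in [set: I]) F i = \sum_(i \in A) F i.
Proof.
move=> h; apply/esym/fsbig_widen => // i [_ /= nA]; apply/eqP.
by apply: contra_notT nA; exact: h.
Qed.

Section FiniteSums.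
Variables (I : choiceType) (V : zmodType).
Implicit Types (A : set I) (F G : I -> V).

Lemma finsuppN F : finsupp F -> finsupp (fun i => - F i).
Proof. by apply: sub_finite_set => i /=; rewrite oppr_eq0. Qed.

Lemma finsuppD F G : finsupp F -> finsupp G -> finsupp (fun i => F i + G i).
Proof.
move=> hF hG; apply: (@sub_finite_set _ _ ([set i | F i != 0] `|` [set i | G i != 0])); last first.
  by rewrite finite_setU.
by move=> i /= h; have [F0|] := eqVneq (F i) 0; [right; move: h; rewrite F0 add0r|left].
Qed.

Lemma fsumTD F G : finsupp F -> finsupp G ->
  \sum_(i \in [set: I]) (F i + G i) = \sum_(i \in [set: I]) F i + \sum_(i \in [set: I]) G i.
Proof.
move=> hF hG; pose A := [set i | F i != 0] `|` [set i | G i != 0].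
have fA : finite_set A by rewrite finite_setU.
rewrite !(@fsumT _ _ A) //=; last 3 first.
- by move=> i h; right.
- by move=> i h; left.
- by move=> i h; have [F0|] := eqVneq (F i) 0; [right; move: h; rewrite F0 add0r|left].
exact: fsbig_split.
Qed.

Lemma fsumTN F : finsupp F -> \sum_(i \in [set: I]) - F i = - \sum_(i \in [set: I]) F i.
Proof.
move=> hF; apply/eqP; rewrite -addr_eq0 -fsumTD //; last exact: finsuppN.
by rewrite fsbig1 // => i _; rewrite addNr.
Qed.

Lemma fsumTB F G : finsupp F -> finsupp G ->
  \sum_(i \in [set: I]) (F i - G i) = \sum_(i \in [set: I]) F i - \sum_(i \in [set: I]) G i.
Proof. by move=> hF hG; rewrite fsumTD ?fsumTN //; exact: finsuppN. Qed.

Lemma fsumT_bij (J : choiceType) (f : I -> J) (f' : J -> I) (G : J -> V) :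
  cancel f f' -> cancel f' f ->
  \sum_(j \in [set: J]) G j = \sum_(i \in [set: I]) G (f i).
Proof.
move=> fK f'K; rewrite -(fsbig_image _ f G); last by move=> i j _ _ /(can_inj fK).
by congr (\sum_(j \in _) _); apply/seteqP; split=> j // _; exists (f' j).
Qed.

Lemma fsumT_fibre (J : choiceType) (d : I -> J) F : finsupp F ->
  \sum_(j \in [set: J]) \sum_(i \in [set i | d i = j]) F i = \sum_(i \in [set: I]) F i.
Proof.
move=> hF; set A := [set i | F i != 0]; have fB := finite_image d hF.
rewrite (@fsumT _ _ (d @` A)); last first.
  move=> j; apply: contraPP => nB; rewrite fsbig1 ?eqxx // => i /= ij.
  by apply/eqP; apply: contra_notT nB => Fi; exists i.
rewrite (@fsumT _ _ A) //.
transitivity (\sum_(j \in d @` A) \sum_(i \in A) (if d i == j then F i else 0)).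
  apply: eq_fsbigr => j _; rewrite -(@fsbig_widen _ _ _ _ (A `&` [set i | d i = j]) A); last 2 first.
  - exact: subIsetl.
  - by move=> i [Ai] /= h; case: eqP => // e; case: h.
  rewrite [LHS]fsbig_supp; rewrite (_ : _ `&` _ = A `&` [set i | d i = j]).
    by apply: eq_fsbigr => i /set_mem[_ /= ->]; rewrite eqxx.
  by apply/seteqP; split=> i /= [h1 h2]; split => //; apply/eqP.
rewrite exchange_fsbig //; apply: eq_fsbigr => i /set_mem Ai.
rewrite -(@fsbig_widen _ _ _ _ [set d i] (d @` A)).
- by rewrite fsbig_set1 eqxx.
- by move=> _ ->; exists i.
by move=> j [_ /= h]; case: eqP => // e; case: h.
Qed.

Lemma fsumT_ord n (F : 'I_n -> I -> V) : (forall k, finsupp (F k)) ->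
  finsupp (fun i => \sum_k F k i) /\
  \sum_(i \in [set: I]) \sum_k F k i = \sum_k \sum_(i \in [set: I]) F k i.
Proof.
elim: n F => [|n IH] F h.
  split; first by apply: sub_finite_set (finite_set0 I) => i /=; rewrite big_ord0 eqxx.
  by rewrite big_ord0 fsbig1 // => i _; rewrite big_ord0.
have [f e] := IH (fun k => F (lift ord0 k)) (fun k => h _).
have E : (fun i => \sum_k F k i) = (fun i => F ord0 i + \sum_(k < n) F (lift ord0 k) i).
  by apply/funext => i; rewrite big_ord_recl.
split; first by rewrite E; exact: finsuppD.
rewrite big_ord_recl -e -fsumTD //; apply: eq_fsbigr => i _; exact: big_ord_recl.
Qed.

End FiniteSums.

Lemma fsumTZ (I : choiceType) (a : R) (F : I -> R) :
  finsupp F -> \sum_(i \in [set: I]) a * F i = a * \sum_(i \in [set: I]) F i.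
Proof.
move=> hF; have /finite_uniq[s us sE] := hF.
rewrite !(@fsumT _ _ [set i | F i != 0]) //; last by move=> i; rewrite mulf_eq0 negb_or => /andP[].
by rewrite sE -!fsbig_seq // mulr_sumr.
Qed.

(** * Locally finite singular chains of motions *)

Definition small n (r : R) (s : smap R n) := forall p q : @std_simplex R n,
  enorm (trans (s p) - trans (s q)) <= r.

Definition near n x (r : R) (s : smap R n) := exists p : @std_simplex R n,
  enorm (trans (s p) - x) <= r.

Definition tame n (z : schain R n) := [/\ forall s, z s != 0 -> continuous s,
  forall r : R, finite_set [set s | z s != 0 /\ near 0 r s] &
  exists r : R, forall s, z s != 0 -> small r s].

Definition compactly n (eta : smap R n -> R) := forall r : R, exists r' : R,
  forall s, small r s -> eta s != 0 -> near 0 r' s.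

Definition pair n (z : schain R n) (eta : smap R n -> R) : R :=
  \sum_(s \in [set: smap R n]) (z s)%:~R * eta s.

Definition delta n (eta : smap R n -> R) : smap R n.+1 -> R :=
  fun s => \sum_(i < n.+2) (-1) ^+ i * eta (s \o coface i).

Lemma mulz_neq0 (k : int) (r : R) : k%:~R * r != 0 -> k != 0 /\ r != 0.
Proof. by rewrite mulf_eq0 negb_or intr_eq0 => /andP. Qed.

Lemma small_comp n k (r : R) (s : smap R n) (d : @std_simplex R k -> @std_simplex R n) :
  small r s -> small r (s \o d).
Proof. by move=> h p q; exact: h. Qed.

Lemma tame_finsupp n (z : schain R n) (eta : smap R n -> R) : tame z -> compactly eta ->
  finsupp (fun s => (z s)%:~R * eta s).
Proof.
move=> [_ fz [r hr]] /(_ r)[r' h]; apply: sub_finite_set (fz r') => s /= /mulz_neq0[zs es].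
by split=> //; apply: h => //; exact: hr.
Qed.

Lemma compactlyD n (eta eta' : smap R n -> R) : compactly eta -> compactly eta' ->
  compactly (fun s => eta s + eta' s).
Proof.
move=> h h' r; have [a ha] := h r; have [b hb] := h' r.
exists (Num.max a b) => s sr; have [->|e0 _] := eqVneq (eta s) 0.
  by rewrite add0r => /(hb _ sr)[p hp]; exists p; rewrite le_max hp orbT.
by have [p hp] := ha _ sr e0; exists p; rewrite le_max hp.
Qed.

Lemma compactlyM n (eta eta' : smap R n -> R) : compactly eta ->
  compactly (fun s => eta s * eta' s).
Proof.
move=> h r; have [a ha] := h r; exists a => s sr.
by rewrite mulf_eq0 negb_or => /andP[/(ha _ sr)].
Qed.

Lemma compactlyMr n (eta eta' : smap R n -> R) : compactly eta ->
  compactly (fun s => eta' s * eta s).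
Proof.
move=> /(compactlyM eta') h r; have [a ha] := h r.
by exists a => s sr; rewrite mulrC; exact: ha.
Qed.

Lemma compactlyN n (eta : smap R n -> R) : compactly eta -> compactly (fun s => - eta s).
Proof. by move=> h r; have [a ha] := h r; exists a => s sr; rewrite oppr_eq0; exact: ha. Qed.

Lemma compactlyB n (eta eta' : smap R n -> R) : compactly eta -> compactly eta' ->
  compactly (fun s => eta s - eta' s).
Proof. by move=> h h'; apply: compactlyD => //; exact: compactlyN. Qed.

Lemma compactly_face n i (eta : smap R n -> R) : compactly eta ->
  compactly (fun s : smap R n.+1 => eta (s \o coface i)).
Proof.
move=> h r; have [a ha] := h r; exists a => s sr es.
by have [p hp] := ha _ (small_comp (coface i) sr) es; exists (coface i p).
Qed.

Lemma pairDr n (z : schain R n) (eta eta' : smap R n -> R) :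
  tame z -> compactly eta -> compactly eta' ->
  pair z (fun s => eta s + eta' s) = pair z eta + pair z eta'.
Proof.
move=> tz h h'; rewrite /pair -fsumTD; [|exact: tame_finsupp|exact: tame_finsupp].
by apply: eq_fsbigr => s _; rewrite mulrDr.
Qed.

Lemma pairBr n (z : schain R n) (eta eta' : smap R n -> R) :
  tame z -> compactly eta -> compactly eta' ->
  pair z (fun s => eta s - eta' s) = pair z eta - pair z eta'.
Proof.
move=> tz h h'; rewrite /pair -fsumTB; [|exact: tame_finsupp|exact: tame_finsupp].
by apply: eq_fsbigr => s _; rewrite mulrBr.
Qed.

Lemma pairZr n (z : schain R n) (a : R) (eta : smap R n -> R) : tame z -> compactly eta ->
  pair z (fun s => a * eta s) = a * pair z eta.
Proof.
move=> tz h; have fs := tame_finsupp tz h; rewrite /pair.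
rewrite -fsumTZ //; apply: eq_fsbigr => s _; exact: mulrCA.
Qed.

Lemma pair_eq n (z : schain R n) (eta eta' : smap R n -> R) :
  (forall s, z s != 0 -> eta s = eta' s) -> pair z eta = pair z eta'.
Proof.
move=> h; apply: eq_fsbigr => s _; have [->|/h ->//] := eqVneq (z s) 0.
by rewrite !mul0r.
Qed.

Lemma pairDl n (z z' : schain R n) (eta : smap R n -> R) :
  tame z -> tame z' -> compactly eta ->
  pair (fun s => z s + z' s) eta = pair z eta + pair z' eta.
Proof.
move=> tz tz' h; rewrite /pair -fsumTD; [|exact: tame_finsupp|exact: tame_finsupp].
by apply: eq_fsbigr => s _; rewrite rmorphD /= mulrDl.
Qed.

Lemma tame_face_finite n (z : schain R n.+1) i u : tame z ->
  finite_set [set s : smap R n.+1 | z s != 0 /\ s \o coface i = u].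
Proof.
move=> [_ fz _]; pose p := @corner R n ord0.
apply: sub_finite_set (fz (enorm (trans (u p)))) => s /= [zs <-]; split=> //.
by exists (coface i p); rewrite subr0.
Qed.

Lemma stokes n (z : schain R n.+1) (eta : smap R n -> R) : tame z -> compactly eta ->
  pair (sbd z) eta = pair z (delta eta).
Proof.
move=> tz he; rewrite /pair /delta /sbd.
have fs i : finsupp (fun s : smap R n.+1 => (z s)%:~R * eta (s \o coface i)).
  by apply: (tame_finsupp tz); exact: compactly_face.
have fs' (i : 'I_n.+2) : finsupp (fun s : smap R n.+1 => (z s)%:~R * ((-1) ^+ i * eta (s \o coface i))).
  by apply: sub_finite_set (fs i) => s /=; rewrite mulrCA mulf_eq0 negb_or => /andP[].
transitivity (\sum_(u \in [set: smap R n]) \sum_(i < n.+2) (-1) ^+ i *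
    \sum_(s \in [set s : smap R n.+1 | s \o coface i = u]) (z s)%:~R * eta (s \o coface i)).
  apply: eq_fsbigr => u _; rewrite rmorph_sum mulr_suml; apply: eq_bigr => i _.
  have fz := tame_face_finite i u tz.
  have sup (V : zmodType) (F : smap R n.+1 -> V) : (forall s, z s = 0 -> F s = 0) ->
      \sum_(s \in [set s : smap R n.+1 | s \o coface i = u]) F s =
      \sum_(s \in [set s : smap R n.+1 | z s != 0 /\ s \o coface i = u]) F s.
    move=> h; apply/esym/fsbig_widen => [s []//|s [/= su]].
    by move=> ns; apply: h; apply: contra_notP ns => /eqP.
  rewrite (sup int) => [|s ->]; last by rewrite mulr0.
  rewrite (sup R) => [|s ->]; last by rewrite mul0r.
  have [l ul lE] := finite_uniq fz.
  have hl s : s \in l -> s \o coface i = u.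
    by move=> sl; have : [set` l] s by []; rewrite -lE => -[].
  rewrite lE -!fsbig_seq // rmorph_sum mulr_suml mulr_sumr big_seq [RHS]big_seq.
  apply: eq_bigr => s sl; rewrite hl // rmorphM rmorphXn rmorphN1 /=.
  by rewrite mulrA.
transitivity (\sum_(i < n.+2) (-1) ^+ i *
    \sum_(s \in [set: smap R n.+1]) (z s)%:~R * eta (s \o coface i)); last first.
  rewrite (eq_fsbigr (fun s => \sum_(i < n.+2) (z s)%:~R * ((-1) ^+ i * eta (s \o coface i)))); last first.
    by move=> s _; rewrite mulr_sumr.
  rewrite (fsumT_ord fs').2; apply: eq_bigr => i _.
  by rewrite -fsumTZ //; apply: eq_fsbigr => s _; rewrite mulrCA.
have inner i : finsupp (fun u : smap R n =>
    \sum_(s \in [set s : smap R n.+1 | s \o coface i = u]) (z s)%:~R * eta (s \o coface i)).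
  apply: (@sub_finite_set _ _ _ _ (finite_image (fun s : smap R n.+1 => s \o coface i) (fs i))) => u /=.
  apply: contraPP => nu; rewrite fsbig1 ?eqxx // => s /= su.
  by apply/eqP; apply: contra_notT nu => h; exists s.
rewrite (fsumT_ord _).2; last first.
  by move=> i; apply: sub_finite_set (inner i) => u /=; rewrite mulf_eq0 negb_or => /andP[].
apply: eq_bigr => i _; rewrite (fsumTZ _ (inner i)).
by rewrite (fsumT_fibre _ (fs i)).
Qed.
Lemma coface_val n (i : 'I_n.+2) (p : @std_simplex R n) j :
  (val (coface i p) : 'rV[R]_n.+2) 0 j =
  if unlift i j is Some k then (val p : 'rV[R]_n.+1) 0 k else 0.
Proof. by rewrite mxE. Qed.

Lemma corner_val n (i j : 'I_n.+1) : (val (@corner R n i) : 'rV[R]_n.+1) 0 j = (j == i)%:R.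
Proof. by rewrite mxE. Qed.

Lemma coface_corner n (i : 'I_n.+2) (j : 'I_n.+1) :
  coface i (@corner R n j) = @corner R n.+1 (lift i j).
Proof.
apply: val_inj; apply/rowP => k; rewrite coface_val corner_val.
case: unliftP => [l ->|->]; first by rewrite corner_val (inj_eq (@lift_inj _ i)).
by rewrite (negbTE (neq_lift i j)).
Qed.

Lemma coface_coface n (i i' : 'I_n.+3) (j j' : 'I_n.+2) : (j < i)%N ->
  nat_of_ord i = j'.+1 -> nat_of_ord i' = j ->
  forall p : @std_simplex R n, coface i (coface j p) = coface i' (coface j' p).
Proof.
move=> ji ij' i'j p.
have E1 : i = lift i' j' by apply: val_inj; rewrite /= /bump i'j ij'; lia.
have E2 : i' = lift i j by apply: val_inj; rewrite /= /bump i'j; lia.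
have E3 l : lift i (lift j l) = lift i' (lift j' l).
  by apply: val_inj; rewrite /= /bump i'j ij'; lia.
apply: val_inj; apply/rowP => k; rewrite !coface_val.
case: (unliftP i k) => [k1 ->|->]; last by rewrite E1 liftK coface_val unlift_none.
case: (unliftP j k1) => [k2 ->|->]; last by rewrite coface_val unlift_none -E2 unlift_none.
by rewrite E3 coface_val liftK -E3 E3 liftK coface_val liftK.
Qed.

Lemma delta2 (eta : smap R 1 -> R) s : delta eta s =
  eta (s \o coface (inord 0)) - eta (s \o coface (inord 1)) + eta (s \o coface (inord 2)).
Proof.
rewrite /delta !big_ord_recl big_ord0 /= expr0 !exprS expr0 !mulr1 !mul1r mulrNN mul1r addr0 mulN1r addrA.
have -> : inord 0 = ord0 :> 'I_3 by apply: val_inj; rewrite /= inordK.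
have -> : inord 1 = lift ord0 ord0 :> 'I_3 by apply: val_inj; rewrite /= inordK.
have -> : inord 2 = lift ord0 (lift ord0 ord0) :> 'I_3 by apply: val_inj; rewrite /= inordK.
by rewrite mul1r.
Qed.

Lemma delta_delta (eta : smap R 1 -> R) s : delta (delta eta) s = 0.
Proof.
have c (i i' : 'I_4) (j j' : 'I_3) : (j < i)%N -> nat_of_ord i = j'.+1 -> nat_of_ord i' = j ->
    (s \o coface i) \o coface j = (s \o coface i') \o coface j'.
  by move=> h1 h2 h3; apply/funext => p /=; rewrite (coface_coface h1 h2 h3).
have -> : delta (delta eta) s = \sum_(i < 4) (-1) ^+ i * delta eta (s \o coface i) by [].
rewrite !big_ord_recl big_ord0 /= !delta2 !exprS expr0.
pose o0 : 'I_4 := ord0; pose o1 : 'I_4 := lift ord0 ord0.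
pose o2 : 'I_4 := lift ord0 (lift ord0 ord0).
pose o3 : 'I_4 := lift ord0 (lift ord0 (lift ord0 ord0)).
rewrite -/o0 -/o1 -/o2 -/o3.
rewrite (c o1 o0 (inord 0) (inord 0)) ?inordK // (c o2 o0 (inord 0) (inord 1)) ?inordK //.
rewrite (c o3 o0 (inord 0) (inord 2)) ?inordK // (c o2 o1 (inord 1) (inord 1)) ?inordK //.
rewrite (c o3 o1 (inord 1) (inord 2)) ?inordK // (c o3 o2 (inord 2) (inord 2)) ?inordK //.
by ring.
Qed.

Lemma continuous_coface n i : continuous (@coface R n i).
Proof.
apply: continuous_simplex => p; apply: rV_continuous => j.
case E: (unlift i j) => [k|].
  have e (q : @std_simplex R n) : (val (coface i q) : 'rV[R]_n.+2) 0 j = (val q : 'rV[R]_n.+1) 0 k.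
    by rewrite coface_val E.
  rewrite e (funext e).
  apply: (@continuous_cvg _ _ _ _ (nbhs_filter p) (fun p : @std_simplex R n => val p : 'rV[R]_n.+1)
    (fun v : 'rV[R]_n.+1 => v 0 k)); last exact: val_simplex_continuous.
  exact: coord_continuous.
have e (q : @std_simplex R n) : (val (coface i q) : 'rV[R]_n.+2) 0 j = 0.
  by rewrite coface_val E.
by rewrite e (funext e) => A /nbhs_singleton A0; apply: (@filterS _ (nbhs p) (nbhs_filter p) setT) (@filterT _ _ (nbhs_filter p)).
Qed.

Lemma sbd_neq0 n (z : schain R n.+1) u : sbd z u != 0 ->
  exists s i, z s != 0 /\ s \o coface i = u.
Proof.
apply: contraPP => h; rewrite /sbd big1 ?eqxx // => i _; rewrite fsbig1 // => s /= su.
have [->|zs] := eqVneq (z s) 0; first by rewrite mulr0.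
by case: h; exists s, i.
Qed.

Lemma tame_sbd n (z : schain R n.+1) : tame z -> tame (sbd z).
Proof.
move=> [cz fz [r hr]]; split.
- move=> u /sbd_neq0[s [i [zs <-]]] p.
  by apply: continuous_comp; [exact: continuous_coface|exact: cz].
- move=> r'; apply: (@sub_finite_set _ _ (\bigcup_(i in [set: 'I_n.+2])
    ((fun s => s \o coface i) @` [set s | z s != 0 /\ near 0 r' s]))).
    move=> u [/sbd_neq0[s [i [zs su]]] [p hp]]; exists i => //; exists s => //; split=> //.
    by exists (coface i p); rewrite -su in hp.
  by apply: bigcup_finite => [|i _]; [exact: finite_finset|exact: finite_image].
by exists r => u /sbd_neq0[s [i [zs <-]]]; apply: small_comp; exact: hr.
Qed.

Lemma sbd_pair n (z : schain R n.+1) u : (sbd z u)%:~R = pair (sbd z) (fun u' => (u' == u)%:R).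
Proof.
rewrite /pair (@fsumT _ _ [set u]) ?fsbig_set1 ?eqxx ?mulr1 // => u' /mulz_neq0[_].
by have [->//|_] := eqVneq u' u; rewrite eqxx.
Qed.

Lemma compactly1 n (u : smap R n) : compactly (fun u' => (u' == u)%:R).
Proof.
move=> r; exists (enorm (trans (u (@corner R n ord0)))) => u' _.
have [->|_] := eqVneq u' u; last by rewrite eqxx.
by exists (@corner R n ord0); rewrite subr0.
Qed.

Lemma sbd_sbd (z : schain R 3) : tame z -> sbd (sbd z) = 0 :> schain R 1.
Proof.
move=> tz; apply/funext => u; apply/eqP; rewrite -(intr_eq0 R) sbd_pair.
have tz' := tame_sbd tz.
rewrite stokes //; last exact: compactly1.
have cd : compactly (delta (fun u' : smap R 1 => (u' == u)%:R : R)).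
  rewrite (_ : delta _ = fun s => (s \o coface (inord 0) == u)%:R - (s \o coface (inord 1) == u)%:R
     + (s \o coface (inord 2) == u)%:R); last by apply/funext => s; exact: delta2.
  apply: compactlyD; first apply: compactlyB; apply: (@compactly_face 1 _ (fun u' => (u' == u)%:R));
    exact: compactly1.
rewrite stokes // /pair fsbig1 // => s _; by rewrite delta_delta mulr0.
Qed.

Lemma sbdD n (z z' : schain R n.+1) : tame z -> tame z' ->
  sbd (fun s => z s + z' s) = (fun u => sbd z u + sbd z' u).
Proof.
move=> tz tz'; apply/funext => u; rewrite /sbd -big_split /=; apply: eq_bigr => i _.
pose A := [set s : smap R n.+1 | z s != 0 /\ s \o coface i = u] `|`
  [set s : smap R n.+1 | z' s != 0 /\ s \o coface i = u].
have fA : finite_set A by rewrite finite_setU; split; exact: tame_face_finite.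
have sup (F : smap R n.+1 -> int) : (forall s, z s = 0 -> z' s = 0 -> F s = 0) ->
    \sum_(s \in [set s : smap R n.+1 | s \o coface i = u]) F s = \sum_(s \in A) F s.
  move=> h; apply/esym/fsbig_widen => [s [[]|[]]//|s [/= su]].
  move=> ns; apply: h; apply: contra_notP ns => /eqP zs; [by left|by right].
rewrite !sup; do ?by move=> s zs zs'; rewrite ?zs ?zs' ?addr0 mulr0.
by rewrite -fsbig_split //; apply: eq_fsbigr => s _; rewrite mulrDr.
Qed.

(** * Pushing singular chains to edge paths *)

Definition src (u : smap R 1) : motion R := u (@corner R 1 ord0).
Definition tgt (u : smap R 1) : motion R := u (@corner R 1 ord_max).
Definition s12 (s : smap R 2) : smap R 1 := s \o coface (inord 0).
Definition s02 (s : smap R 2) : smap R 1 := s \o coface (inord 1).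
Definition s01 (s : smap R 2) : smap R 1 := s \o coface (inord 2).

Lemma simplex_corners s : [/\ src (s12 s) = tgt (s01 s), tgt (s12 s) = tgt (s02 s) &
  src (s02 s) = src (s01 s)].
Proof.
by split; rewrite /src /tgt /s12 /s02 /s01 /= !coface_corner; congr (s (corner _ _));
  apply: val_inj; rewrite /= /bump !inordK.
Qed.

Definition theta (u : smap R 1) : R := xget 0 [set w | turning u w].

Lemma turning_uniq u (r r' : R) : turning u r -> turning u r' -> r = r'.
Proof.
move=> [t [ct ht ->]] [t' [ct' ht' ->]].
have h : (t \- t') (@corner R 1 ord_max) = (t \- t') (@corner R 1 ord0).
  apply: simplex_cong_const => [p|p]; first exact: (@cvgB _ _ _ _ (nbhs_filter p) _ _ _ _ (ct p) (ct' p)).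
  rewrite /= -(subrr (t' p)); apply: congB; last exact: cong_refl.
  by apply/expi_cong; rewrite /expi -ht -ht'.
by move: h => /=; lra.
Qed.

Lemma rot_neq0 g : rot g != 0.
Proof. by apply/eqP => e; have := rot_norm g; rewrite e enorm0 => /esym/eqP; rewrite oner_eq0. Qed.

Lemma rot_lift n (s : smap R n) : continuous s -> exists2 t : @std_simplex R n -> R,
  continuous t & forall i, rot (s i) = (cos (t i), sin (t i)).
Proof.
move=> cs; have [|p|t ct ht] := @simplex_lift R n (fun i => rot (s i)).
- by move=> p; exact: (@cvg_rot _ _ (nbhs_filter p) s (s p) (cs p)).
- exact: rot_neq0.
by exists t => // p; rewrite ht rot_norm rotate1.
Qed.

Lemma thetaP u : continuous u -> turning u (theta u).
Proof.
move=> cu; have [t ct ht] := rot_lift cu; apply: (@xgetPex _ 0 [set w | turning u w]).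
by exists (t (@corner R 1 ord_max) - t (@corner R 1 ord0)), t.
Qed.

Lemma theta_cong u : continuous u -> cong (theta u) (arg (rot (tgt u)) - arg (rot (src u))).
Proof.
move=> /thetaP[t [_ ht ->]]; apply: congB; apply/expi_cong; rewrite expi_arg ?rot_norm //;
  exact/esym/ht.
Qed.

Lemma turning_mul g u (w : R) : turning u w -> turning (mulm g \o u) w.
Proof.
move=> [t [ct ht ->]]; exists (fun i => arg (rot g) + t i); split.
- by move=> p; exact: (@cvgD _ _ _ _ (nbhs_filter p) _ _ _ _ (@cvg_cst _ _ _ _ (nbhs_filter p)) (ct p)).
- move=> p; rewrite -[RHS]/(expi _) expiD expi_arg ?rot_norm //=.
  by rewrite ht.
by ring.
Qed.

Lemma mulm_compK n g (s : smap R n) : mulm (invm g) \o (mulm g \o s) = s.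
Proof. by apply/funext => p /=; rewrite mulVmK. Qed.

Lemma mulm_compVK n g (s : smap R n) : mulm g \o (mulm (invm g) \o s) = s.
Proof. by apply/funext => p /=; rewrite mulmVK. Qed.

Lemma theta_mul g u : theta (mulm g \o u) = theta u.
Proof.
congr (xget 0 _); apply/seteqP; split=> w /= h; last exact: turning_mul.
by rewrite -(mulm_compK g u); exact: turning_mul.
Qed.

Lemma theta_cong_mul g u : continuous u ->
  cong (theta u) (arg (rot (mulm g (tgt u))) - arg (rot (mulm g (src u)))).
Proof.
by move=> cu; rewrite -(theta_mul g); apply: theta_cong; exact: continuous_mulm.
Qed.

Lemma theta_add s : continuous s -> theta (s02 s) = theta (s01 s) + theta (s12 s).
Proof.
move=> cs; have [t ct ht] := rot_lift cs.
have tu i : theta (s \o coface i) =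
    t (coface i (@corner R 1 ord_max)) - t (coface i (@corner R 1 ord0)).
  apply: turning_uniq; last by exists (t \o coface i); split=> // [p|p];
    [apply: continuous_comp; [exact: continuous_coface|exact: ct]|exact: ht].
  by apply: thetaP => p; apply: continuous_comp; [exact: continuous_coface|exact: cs].
rewrite /s12 /s02 /s01 !tu !coface_corner.
have -> : lift (inord 0) (ord_max : 'I_2) = ord_max :> 'I_3 by apply: val_inj; rewrite /= inordK.
have -> : lift (inord 1) (ord_max : 'I_2) = ord_max :> 'I_3 by apply: val_inj; rewrite /= inordK.
have -> : lift (inord 1) (ord0 : 'I_2) = ord0 :> 'I_3 by apply: val_inj; rewrite /= inordK.
have -> : lift (inord 2) (ord0 : 'I_2) = ord0 :> 'I_3 by apply: val_inj; rewrite /= inordK.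
have -> : lift (inord 2) (ord_max : 'I_2) = lift (inord 0) (ord0 : 'I_2) :> 'I_3.
  by apply: val_inj; rewrite /= /bump !inordK.
by ring.
Qed.

Lemma motion_ballE g (r : R) : ball g r = [set h | dE g h < r].
Proof. by rewrite -metricType_numDomainType.ball_mdistE. Qed.

Lemma patch_sub f g (r : R) :
  patch (mtile (invm f) @` T) (cball 0 r) `<=` patch (mtile (invm g) @` T) (cball 0 r) <->
  forall t, T t -> shape t `&` cball (trans f) r !=set0 -> T (mtile (mulm g (invm f)) t).
Proof.
have tE : trans f = act f 0 by rewrite /act rotate0 add0r.
rewrite tE -image_cball; split=> [h t Tt tx|h _ [[t Tt <-] tx]].
  have [|[t' Tt' e] _] := h (mtile (invm f) t).
    split; first by exists t.
    by apply/(tile_meets f); rewrite mtile_Kinv.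
  by rewrite -mtileM -e mtile_Kinv.
split=> //; exists (mtile (mulm g (invm f)) t).
  by apply: h => //; apply/(tile_meets (invm f)); rewrite image_act_invm.
by rewrite mtileM mulVmK.
Qed.

Lemma TrotE (r : R) f g Phi : Trot T r f g Phi <->
  Phi = mulm (mulm g (invm f)) /\ lmatch (mulm g (invm f)) (trans f) r.
Proof.
have iE : invm (mulm g (invm f)) = mulm f (invm g).
  by apply: motion_ext => x; apply: (@act_inj (mulm g (invm f)));
    rewrite act_invmK !act_mulm act_invm act_invmK.
have aE : act (mulm g (invm f)) (trans f) = trans g.
  have t0 h : trans h = act h 0 by rewrite /act rotate0 add0r.
  by rewrite !t0 act_mulm act_invm.
split=> [[-> e]|[-> [h1 h2]]]; split=> //.
  split; first by apply/patch_sub; rewrite e.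
  by rewrite iE aE; apply/patch_sub; rewrite e.
by apply/seteqP; split; apply/patch_sub; rewrite // -iE -aE.
Qed.

Definition equiv n (r : R) (c : schain R n) :=
  (forall s, c s != 0 -> exists f : motion R, range s `<=` ball f (r / 2)) /\
  (forall g s i, lmatch g (trans (s i)) r -> c (mulm g \o s) = c s).

Lemma pushforward_mul n g (c : schain R n) u : pushforward (mulm g) c u = c (mulm (invm g) \o u).
Proof.
rewrite /pushforward (_ : [set s | _] = [set mulm (invm g) \o u]) ?fsbig_set1 //.
by apply/seteqP; split=> s /= => [<-|->]; rewrite ?mulm_compK ?mulm_compVK.
Qed.

Lemma equivariantE n (c : schain R n) : equivariant T c <-> exists2 r : R, 0 < r & equiv r c.
Proof.
split=> -[r r0 [h1 h2]]; exists r => //; split=> //.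
  move=> g s p lm; pose f := s p; have gE : mulm (mulm g f) (invm f) = g by exact: mulmK.
  have /h2 /(congr1 (fun d : schain R n => d (mulm g \o s))) : Trot T r f (mulm g f) (mulm g).
    by apply/TrotE; rewrite gE.
  rewrite pushforward_mul mulm_compK /star asboolT; last by exists p.
  by rewrite asboolT => [->//|]; exists p.
move=> f g Phi /TrotE[-> lm]; apply/funext => u; rewrite pushforward_mul /star.
set k := mulm g (invm f) in lm *.
have [[p _ pu]|nu] := pselect (range u g).
  have fE : (mulm (invm k) \o u) p = f.
    rewrite /= pu; apply: motion_ext => x; apply: (@act_inj k).
    by rewrite act_mulm act_invmK /k act_mulm act_invm.
  rewrite [in RHS]asboolT; last by exists p.
  rewrite asboolT; last by exists p.
  by rewrite -[in RHS](mulm_compVK k u); apply/esym/(h2 _ _ p); rewrite fE.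
rewrite [in RHS]asboolF // asboolF // => -[p _ /= e]; apply: nu; exists p => //.
by rewrite -[u p](mulmVK k) e /k mulmKV.
Qed.

Lemma lmatch_mono g x (r r' : R) : r <= r' -> lmatch g x r' -> lmatch g x r.
Proof. by move=> le lm; apply: lmatch_sub lm _; rewrite subrr enorm0 add0r. Qed.

Lemma equiv_mono n (r r' : R) (c : schain R n) : r <= r' -> equiv r c -> equiv r' c.
Proof.
move=> le [h1 h2]; split=> [s /h1[f hf]|g s p lm]; last by apply: (h2 _ _ p); exact: lmatch_mono lm.
by exists f; apply: subset_trans hf _; apply: le_ball; lra.
Qed.

Lemma equiv_small n (r : R) (c : schain R n) s : equiv r c -> c s != 0 -> small r s.
Proof.
move=> [h _] /h[f]; rewrite motion_ballE => hf p q.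
have hp := hf _ (imageT s p); have hq := hf _ (imageT s q).
have := enorm_tri (trans (s p)) (trans f) (trans (s q)).
have := dE_trans f (s p); have := dE_trans f (s q); rewrite (enormB (trans f) (trans (s p))) /= in hp hq *.
by move: hp hq => /=; lra.
Qed.

Lemma equiv_sbd n (r : R) (c : schain R n.+1) : equiv r c -> equiv r (sbd c).
Proof.
move=> [h1 h2]; split=> [u /sbd_neq0[s [i [/h1[f hf] <-]]]|g u p lm].
  by exists f => _ [q _ <-]; apply: hf; exists (coface i q).
rewrite /sbd; apply: eq_bigr => i _.
rewrite (_ : [set s : smap R n.+1 | s \o coface i = mulm g \o u] =
  (fun s : smap R n.+1 => mulm g \o s) @` [set s : smap R n.+1 | s \o coface i = u]); last first.
  apply/seteqP; split=> [s /= e|_ [s /= <- <-]] //.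
  by exists (mulm (invm g) \o s); [rewrite -[RHS](mulm_compK g) -e|exact: mulm_compVK].
rewrite fsbig_image; last by move=> s s' _ _ /(congr1 (comp (mulm (invm g)))); rewrite !mulm_compK.
by apply: eq_fsbigr => s /set_mem su; rewrite (h2 _ _ (coface i p)) //; rewrite -su in lm.
Qed.

Lemma equivD n (r : R) (c c' : schain R n) : equiv r c -> equiv r c' ->
  equiv r (fun s => c s + c' s).
Proof.
move=> [h1 h2] [h1' h2']; split=> [s|g s p lm]; last by rewrite (h2 _ _ p) // (h2' _ _ p).
by have [->|/h1//] := eqVneq (c s) 0; rewrite add0r => /h1'.
Qed.

Lemma tame_bm n (z : schain R n) : tame z -> borel_moore z.
Proof.
move=> [cz fz _]; split=> // A /compact_motions_bounded[r hr].
by apply: sub_finite_set (fz r) => s [zs [f [[p _ <-] Af]]]; split=> //; exists p; rewrite subr0; exact: hr.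
Qed.

Lemma bm_tame n (r : R) (z : schain R n) : borel_moore z -> equiv r z -> tame z.
Proof.
move=> [cz fz] ez; split=> // [r'|]; last by exists r => s; exact: equiv_small.
apply: (@sub_finite_set _ _ _ _ (fz _ (@compact_motions 0 r'))) => s [zs [p hp]]; split=> //.
by exists (s p); split=> //; exists p.
Qed.
Definition goodv f v :=
  [/\ vertex K v, enorm (v - trans f) <= diam & vertex K (trans f) -> v = trans f].

(* Choosing the vertex in the frame of f makes nu equivariant under local matches. *)
Definition nu f := act f (xget 0 [set q | goodv f (act f q)]).

Lemma nuP f : goodv f (nu f).
Proof.
apply: (@xgetPex _ 0 [set q | goodv f (act f q)]).
have [v gv] : exists v, goodv f v.
  have [Kf|nK] := pselect (vertex K (trans f)).
    by exists (trans f); split=> //; rewrite subrr enorm0 diam_ge0.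
  by have [v Kv le] := near_vertex (trans f); exists v.
by exists (act (invm f) v); rewrite /= act_invmK.
Qed.

Lemma trans_mulm g f : trans (mulm g f) = act g (trans f). Proof. by []. Qed.

Lemma nu_mul g f (r : R) : lmatch g (trans f) r -> diam <= r -> nu (mulm g f) = act g (nu f).
Proof.
move=> lm le; rewrite /nu -act_mulm; congr (act _ (xget 0 _)).
have vf : vertex K (act g (trans f)) <-> vertex K (trans f).
  by apply: (lmatch_vertexE lm); rewrite subrr enorm0; apply: le_trans le; exact: diam_ge0.
apply/seteqP; split=> q /=; rewrite /goodv act_mulm trans_mulm enorm_act => -[Kv d e]; split=> //.
- by apply/(lmatch_vertexE lm (le_trans d le)).
- by move=> /vf /e /act_inj.
- by apply/(lmatch_vertexE lm (le_trans d le)).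
by move=> /vf /e ->.
Qed.

Lemma nu_vertex f : vertex K (trans f) -> nu f = trans f.
Proof. by have [_ _ h] := nuP f. Qed.

Definition rad u := diam + enorm (nu (tgt u) - nu (src u)).

Definition goodp u (p : seq (R * R)) :=
  [/\ epath (cball (nu (src u)) (rad u)) (nu (src u)) p,
      last (nu (src u)) p = nu (tgt u),
      nu (src u) = nu (tgt u) -> p = [::] &
      edge K (nu (src u)) (nu (tgt u)) -> p = [:: nu (tgt u)]].

Definition epth u :=
  map (act (src u)) (xget [::] [set q : seq (R * R) | goodp u (map (act (src u)) q)]).

Lemma rad_ge0 u : 0 <= rad u.
Proof. by rewrite addr_ge0 ?diam_ge0 //; exact: enorm_ge0. Qed.

Lemma lerp_dist v w (t : R) : 0 <= t <= 1 -> enorm (lerp v w t - v) <= enorm (w - v).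
Proof.
move=> /andP[t0 t1]; rewrite lerp_pt -{2}(pt0 v w) pt_dist !subr0.
apply: ler_piMl; first exact: enorm_ge0.
by apply: le_trans (enorm_le _) _; rewrite /= normr0 addr0 ger0_norm.
Qed.

Lemma goodp_exists u : exists p : seq (R * R), goodp u p.
Proof.
set v := nu (src u); set w := nu (tgt u).
have [Kv _ _] := nuP (src u); have [Kw _ _] := nuP (tgt u); rewrite -/v -/w in Kv Kw.
have wb : cball v (rad u) w by rewrite /cball /= /rad -/v -/w lerDr diam_ge0.
have [e|ne] := pselect (v = w).
  by exists [::]; split=> //; rewrite -/v -/w e => -[/eqP].
have [ed|ned] := pselect (edge K v w); first by exists [:: w]; split.
have [c Kc cv] := face_at v; have [c' Kc' cw] := face_at w.
have [|_ _ [p pp pl]] := @segment_reach (cball v (rad u)) v w c c' v w _ Kc Kc' cv cw Kv Kw cv cw.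
  move=> t d t01 Kd dl y dy; rewrite /cball /= /rad -/v -/w.
  apply: le_trans (enorm_tri _ (lerp v w t) _) _; apply: lerD; last exact: lerp_dist.
  exact: (cell_diam Kd).
by exists p; split.
Qed.

Lemma epthP u : goodp u (epth u).
Proof.
apply: (@xgetPex _ [::] [set q : seq (R * R) | goodp u (map (act (src u)) q)]).
have [p gp] := goodp_exists u; exists (map (act (invm (src u))) p) => /=.
rewrite -map_comp (eq_map (_ : _ =1 id)) ?map_id // => x /=; exact: act_invmK.
Qed.

Lemma epath_act g x (r r' : R) a0 a (p : seq (R * R)) : lmatch g x r -> enorm (a - x) <= r ->
  cball a0 r' `<=` cball x r ->
  epath (cball (act g a0) r') (act g a) (map (act g) p) <-> epath (cball a0 r') a p.
Proof.
move=> lm + sub; elim: p a => //= b p IH a le.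
split=> -[e ab h].
  have ab' : cball a0 r' b by exact/(act_cball g).
  by split=> //; [exact/(lmatch_edgeE _ lm le)|apply/(IH _ (sub _ ab'))].
split; [exact/(lmatch_edgeE _ lm le)|exact/act_cball|].
by apply/(IH _ (sub _ ab)).
Qed.

Lemma nu_near f : enorm (nu f - trans f) <= diam.
Proof. by have [] := nuP f. Qed.

Lemma small_src u (r : R) : small r u -> enorm (trans (tgt u) - trans (src u)) <= r.
Proof. exact. Qed.

Lemma rad_small u (r : R) : small r u -> rad u <= r + 3 * diam.
Proof.
move=> /small_src h; rewrite /rad.
have := enorm_tri (nu (tgt u)) (trans (tgt u)) (nu (src u)).
have := enorm_tri (trans (tgt u)) (trans (src u)) (nu (src u)).
have := nu_near (tgt u); have := nu_near (src u); rewrite (enormB (nu (src u)) (trans _)); lra.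
Qed.

Lemma cball_rad u (r : R) : small r u ->
  cball (nu (src u)) (rad u) `<=` cball (trans (src u)) (r + 4 * diam).
Proof.
move=> /rad_small h y; rewrite /cball /= => hy.
by have := enorm_tri y (nu (src u)) (trans (src u)); have := nu_near (src u); lra.
Qed.

Lemma small_mul n g (r : R) (s : smap R n) : small r (mulm g \o s) <-> small r s.
Proof. by split=> h p q; have := h p q; rewrite /= enorm_act. Qed.

Lemma small_ge0 n (r : R) (s : smap R n) : small r s -> 0 <= r.
Proof. by move=> /(_ (@corner R n ord0) (@corner R n ord0)); rewrite subrr enorm0. Qed.

Lemma nu_ends g u (r : R) : small r u -> lmatch g (trans (src u)) (r + 4 * diam) ->
  nu (src (mulm g \o u)) = act g (nu (src u)) /\ nu (tgt (mulm g \o u)) = act g (nu (tgt u)).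
Proof.
move=> sr lm; have r0 := small_ge0 sr; have d0 := diam_ge0.
split; first by apply: (nu_mul lm); lra.
apply: (@nu_mul _ _ diam) => //; apply: lmatch_sub lm _.
by have := small_src sr; lra.
Qed.

Lemma epth_mul g u (r : R) : small r u -> lmatch g (trans (src u)) (r + 4 * diam) ->
  epth (mulm g \o u) = map (act g) (epth u).
Proof.
move=> sr lm; have [es et] := nu_ends sr lm; have r0 := small_ge0 sr; have d0 := diam_ge0.
have av : enorm (nu (src u) - trans (src u)) <= r + 4 * diam by have := nu_near (src u); lra.
have radE : rad (mulm g \o u) = rad u by rewrite /rad es et enorm_act.
rewrite /epth -map_comp (eq_map (_ : act (src (mulm g \o u)) =1 act g \o act (src u))); last first.
  by move=> x; exact: act_mulm.
congr (map _ (xget [::] _)); apply/seteqP.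
have mE (q : seq (R * R)) : map (act (src (mulm g \o u))) q = map (act g) (map (act (src u)) q).
  by rewrite -map_comp; apply: eq_map => x; exact: act_mulm.
have ep (p : seq (R * R)) := epath_act p lm av (cball_rad sr).
have ed : edge K (act g (nu (src u))) (act g (nu (tgt u))) <-> edge K (nu (src u)) (nu (tgt u)).
  exact: (lmatch_edgeE _ lm av).
split=> q; rewrite /= /goodp mE radE es et last_map.
  move=> [h1 h2 h3 h4]; split.
  - exact/ep.
  - exact: act_inj h2.
  - by move=> e; apply: (@inj_map _ _ _ (@act_inj g)); apply: h3; rewrite e.
  by move=> /ed/h4 e; apply: (@inj_map _ _ _ (@act_inj g)); rewrite e.
move=> [h1 h2 h3 h4]; split.
- exact/ep.
- by rewrite h2.
- by move=> /act_inj/h3 ->.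
by move=> /ed/h4 ->.
Qed.

Lemma epath_in W a (p : seq (R * R)) b : epath W a p -> b \in p -> W b.
Proof.
elim: p a => //= d p IH a [_ Wd h]; rewrite inE => /orP[/eqP ->//|bp].
exact: IH h bp.
Qed.

Lemma epth_near u (r : R) b : small r u -> b \in nu (src u) :: epth u ->
  enorm (b - trans (src u)) <= r + 4 * diam.
Proof.
move=> sr bp; apply: (cball_rad sr); move: bp; rewrite inE => /orP[/eqP ->|bp].
  by rewrite /cball /= subrr enorm0 rad_ge0.
by have [h _ _ _] := epthP u; exact: epath_in h bp.
Qed.

Definition count v w u : R := (ecount v w (nu (src u)) (epth u))%:~R.

Definition beta x u : R := wind x (nu (src u)) (epth u).

Definition deg x s : R := delta (beta x) s / (2 * pi).

Lemma count_near v w u (r : R) : small r u -> count v w u != 0 ->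
  enorm (v - trans (src u)) <= r + 4 * diam.
Proof.
move=> sr; rewrite intr_eq0 => cn; have [h _ _ _] := epthP u.
by have [_ vp _] := ecount_supp h cn; exact: epth_near sr vp.
Qed.

Lemma countN v w u : count w v u = - count v w u.
Proof. by rewrite /count ecountN rmorphN. Qed.

Lemma count_mul g v w u (r : R) : small r u -> lmatch g (trans (src u)) (r + 4 * diam) ->
  count (act g v) (act g w) (mulm g \o u) = count v w u.
Proof.
by move=> sr lm; rewrite /count (epth_mul sr lm) (nu_ends sr lm).1 ecount_act.
Qed.

Lemma beta_mul g x u (r : R) : small r u -> lmatch g (trans (src u)) (r + 4 * diam) ->
  beta (act g x) (mulm g \o u) = beta x u.
Proof.
by move=> sr lm; rewrite /beta (epth_mul sr lm) (nu_ends sr lm).1 wind_act.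
Qed.

Lemma count_sum v u :
  \sum_(w \in [set w | edge K w v]) count w v u = (nu (tgt u) == v)%:R - (nu (src u) == v)%:R.
Proof.
have [h l _ _] := epthP u; rewrite /count.
have := ecount_bd v h; rewrite l => /(congr1 (fun k : int => k%:~R : R)).
rewrite rmorphB !rmorph_nat /= => <-.
have fA : finite_set [set w | edge K w v].
  by apply: sub_finite_set (nbrs_finite v) => w; exact: edge_sym.
by have [l' ul ->] := finite_uniq fA; rewrite -!fsbig_seq // rmorph_sum.
Qed.

Lemma far_halfplane x y b : enorm (b - y) < enorm (y - x) ->
  0 < (rotate (b - x) (conjp (y - x))).1.
Proof.
move=> h; have -> : b - x = (b - y) + (y - x) by rewrite addrA subrK.
rewrite rotateC rotateDr conjpK.
rewrite -[X in 0 < X]/((rotate (conjp (y - x)) (b - y)).1 + enorm (y - x) ^+ 2).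
have := enorm_fst (rotate (conjp (y - x)) (b - y)); rewrite enormM enorm_conj.
move: h (enorm_ge0 (b - y)); set a := enorm (b - y); set d := enorm (y - x).
move: (rotate _ _).1 => t h a0; rewrite ler_norml => /andP[ht _].
have : 0 < d * (d - a) by apply: mulr_gt0; lra.
by rewrite mulrBr -expr2; move: (d * a) (d ^+ 2) ht => m n; lra.
Qed.

Lemma beta_far x y u (r : R) : small r u -> 2 * r + 4 * diam < enorm (y - x) ->
  enorm (trans (src u) - y) <= r ->
  beta x u = arg (rotate (nu (tgt u) - x) (conjp (y - x))) -
    arg (rotate (nu (src u) - x) (conjp (y - x))).
Proof.
move=> sr far yu; have [_ l _ _] := epthP u; rewrite /beta -{1}l; apply: wind_halfplane => b bp.
apply: far_halfplane; apply: le_lt_trans (enorm_tri _ (trans (src u)) _) _.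
by have := epth_near sr bp; lra.
Qed.

Lemma deg_near x s (r : R) (p : @std_simplex R 2) : small r s -> deg x s != 0 ->
  enorm (x - trans (s p)) <= 2 * r + 4 * diam.
Proof.
move=> sr; apply: contra_neqT; rewrite -ltNge enormB => far.
have ns (d : std_simplex (n:=1) -> std_simplex (n:=2)) := small_comp d sr.
rewrite /deg delta2 -/(s12 s) -/(s02 s) -/(s01 s).
rewrite (beta_far (ns _) far) ?(beta_far (ns _) far); do ?exact: sr.
have [-> -> ->] := simplex_corners s.
by rewrite (_ : _ - _ + _ = 0) ?mul0r //; ring.
Qed.

(** * Degrees *)

Lemma xget_face c : K 2 c -> c (xget 0 c).
Proof. by move=> Kc; have := cell_nonempty KCW Kc; exact: xgetPex. Qed.

Lemma deg_cong c x s : K 2 c -> c x -> cong (delta (beta x) s) 0.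
Proof.
move=> Kc cx; have bc u : cong (beta x u) (arg (nu (tgt u) - x) - arg (nu (src u) - x)).
  have [h l _ _] := epthP u; have [Kv _ _] := nuP (src u).
  by rewrite -l; apply: wind_cong; exact: face_notin_path Kc cx Kv h.
rewrite delta2 -/(s12 s) -/(s02 s) -/(s01 s).
have := congD (congB (bc (s12 s)) (bc (s02 s))) (bc (s01 s)).
have [-> -> ->] := simplex_corners s.
have E (a b d : R) : a - b - (a - d) + (b - d) = 0 by ring.
by rewrite E.
Qed.

Lemma pi2_neq0 : 2 * pi != 0 :> R.
Proof. by have := pi_gt0 R => h; apply/eqP; lra. Qed.

Lemma degE x s : delta (beta x) s = 2 * pi * deg x s.
Proof. by rewrite mulrC divfK // pi2_neq0. Qed.

Lemma beta_continuous c x u : K 2 c -> c x -> {for x, continuous (beta^~ u)}.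
Proof. by move=> Kc cx; have [h _ _ _] := epthP u; exact: wind_continuous Kc cx h. Qed.

Lemma deg_const c x y s : K 2 c -> c x -> c y -> deg x s = deg y s.
Proof.
move=> Kc cx cy; rewrite /deg; congr (_ / _).
apply: (face_cong_const (f := fun x => delta (beta x) s) Kc _ _ cx cy); last by move=> z; exact: deg_cong.
move=> z cz; rewrite (_ : (fun x => _) = (fun x => beta x (s12 s) - beta x (s02 s) + beta x (s01 s))).
  have bc u := @beta_continuous c z u Kc cz.
  exact: (@cvgD _ _ _ _ (nbhs_filter z) _ _ _ _
    (@cvgB _ _ _ _ (nbhs_filter z) _ _ _ _ (bc (s12 s)) (bc (s02 s))) (bc (s01 s))).
by apply/funext => w; exact: delta2.
Qed.

Definition fdeg c s : R := deg (xget 0 c) s.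

Lemma fdegE c x s : K 2 c -> c x -> fdeg c s = deg x s.
Proof. by move=> Kc cx; apply: (deg_const _ Kc) => //; exact: xget_face. Qed.

Lemma fdeg_int c s : K 2 c -> exists k : int, fdeg c s = k%:~R.
Proof.
move=> Kc; have [k e] := deg_cong s Kc (xget_face Kc); exists k; move: e.
by rewrite subr0 degE => /(mulfI pi2_neq0).
Qed.

Lemma fdeg_jump v w s : edge K v w ->
  fdeg (lface v w) s - fdeg (rface v w) s = delta (count v w) s.
Proof.
move=> e; have Kl := lface_face e; have Kr := rface_face e.
apply: (mulfI pi2_neq0); rewrite mulrBr -!degE.
apply: (face_jump (f := fun x => delta (beta x) s) e) (xget_face Kl) (xget_face Kr).
- by move=> x y lx ly; rewrite !degE (deg_const s Kl lx ly).
- by move=> x y lx ly; rewrite !degE (deg_const s Kr lx ly).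
pose jump u (n : R) : R := beta (pt v w 2^-1 n) u - beta (pt v w 2^-1 (- n)) u.
have wj u : jump u @ 0^'+ --> (2 * pi * count v w u : R).
  by have [h _ _ _] := epthP u; exact: wind_jump e h.
rewrite (_ : (fun n => _) = fun n => jump (s12 s) n - jump (s02 s) n + jump (s01 s) n); last first.
  by apply/funext => n; rewrite !delta2 /jump /s12 /s02 /s01; ring.
rewrite delta2 -/(s12 s) -/(s02 s) -/(s01 s) mulrDr mulrBr.
by apply: cvgD; [apply: cvgB; exact: wj|exact: wj].
Qed.

Lemma lmatch_corner g s (r : R) (p q : @std_simplex R 2) : small r s ->
  lmatch g (trans (s p)) (2 * r + 4 * diam) -> lmatch g (trans (s q)) (r + 4 * diam).
Proof. by move=> sr lm; apply: lmatch_sub lm _; have := sr q p; lra. Qed.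

Lemma fdeg_mul g c s (r : R) (p : @std_simplex R 2) : K 2 c -> K 2 (act g @` c) -> small r s ->
  lmatch g (trans (s p)) (2 * r + 4 * diam) -> fdeg (act g @` c) (mulm g \o s) = fdeg c s.
Proof.
move=> Kc Kg sr lm; have cx := xget_face Kc.
have cgx : (act g @` c) (act g (xget 0 c)) by exists (xget 0 c).
rewrite (fdegE _ Kg cgx) /fdeg /deg; congr (_ / _); rewrite !delta2.
have bE (i : 'I_3) : beta (act g (xget 0 c)) ((mulm g \o s) \o coface i) = beta (xget 0 c) (s \o coface i).
  apply: (beta_mul _ (small_comp (coface i) sr)); exact: lmatch_corner sr lm.
by rewrite !bE.
Qed.

Lemma near_origin n v (r : R) (s : smap R n) (p : @std_simplex R n) : enorm (v - trans (s p)) <= r ->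
  near 0 (enorm v + r) s.
Proof.
move=> h; exists p; rewrite subr0; have := enorm_tri (trans (s p)) v 0.
by rewrite !subr0 (enormB _ v); lra.
Qed.

Lemma count_compactly v w : compactly (count v w).
Proof.
move=> r; exists (enorm v + (r + 4 * diam)) => u sr cn.
exact: near_origin (count_near sr cn).
Qed.

Lemma fdeg_compactly c : compactly (fdeg c).
Proof.
move=> r; exists (enorm (xget 0 c) + (2 * r + 4 * diam)) => s sr cn.
exact: near_origin (deg_near (@corner R 2 ord0) sr cn).
Qed.

Definition vturn v u : R := (nu (src u) == v)%:R * theta u.

Lemma vturn_compactly v : compactly (vturn v).
Proof.
apply: compactlyM => r; exists (enorm v + diam) => u sr.
have [<- _|_] := eqVneq (nu (src u)) v; last by rewrite eqxx.
exact: near_origin (nu_near (src u)).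
Qed.

Definition over0 (z : schain R 1) := forall u, z u != 0 -> forall i, vertex K (trans (u i)).

Lemma vertex_path_const n (u : smap R n) (p q : @std_simplex R n) : continuous u ->
  (forall i, vertex K (trans (u i))) -> trans (u p) = trans (u q).
Proof.
move=> cu Ku; pose f (t : R) := trans (u (simplex_path p q t)).
have cf : continuous f.
  move=> t; apply: (@cvg_trans_part _ _ (nbhs_filter t) _ (u (simplex_path p q t))).
  by apply: continuous_comp; [exact: simplex_path_continuous|exact: cu].
have : f 0 = f 1.
  apply: (@locally_constant R (fun t => f 0 = f t)) => // t _.
  have [r r0 hr] := star_nbhd KCW (f t).
  have [d d0 hd] : exists2 d : R, 0 < d & forall t' : R, `|t' - t| < d -> enorm (f t' - f t) < r.
    have : nbhs t (fun t' => enorm (f t' - f t) < r).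
      exact: (@cvg_enormP _ _ (nbhs_filter t) f (f t)).1 (cf t) r r0.
    move=> /nbhs_ballP[d /= d0 hd]; exists d => // t' h; apply: hd.
    by rewrite /ball /= distrC.
  exists d => // t' _ h; suff -> : f t' = f t by [].
  have : closure [set f t'] (f t) by apply: (hr 0%N _ (f t')) => //; [exact: Ku|exact: hd].
  move=> /closure_enorm hc; apply/eqP; apply: contrapT => /negP; rewrite -subr_eq0 => ne.
  by have [y ->] := hc _ (enorm_gt0 ne); rewrite ltxx.
by rewrite /f simplex_path0 simplex_path1.
Qed.

Lemma over0_epth (u : smap R 1) : continuous u -> (forall i, vertex K (trans (u i))) ->
  epth u = [::] /\ nu (src u) = trans (src u).
Proof.
move=> cu Ku; have ns i : nu (u i) = trans (u i) by apply: nu_vertex; exact: Ku.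
split; last exact: ns.
by have [_ _ h _] := epthP u; apply: h; rewrite !ns; exact: vertex_path_const.
Qed.

Lemma over0_count v w (u : smap R 1) : continuous u -> (forall i, vertex K (trans (u i))) -> count v w u = 0.
Proof. by move=> cu Ku; rewrite /count (over0_epth cu Ku).1. Qed.

Lemma pair_cong n (z : schain R n) (eta eta' : smap R n -> R) :
  tame z -> compactly eta -> compactly eta' ->
  (forall s, continuous s -> cong (eta s) (eta' s)) -> cong (pair z eta) (pair z eta').
Proof.
move=> tz h h' e; pose A := [set s | (z s)%:~R * eta s != 0] `|` [set s | (z s)%:~R * eta' s != 0].
rewrite /pair !(@fsumT _ _ A); [|by move=> s; right|by move=> s; left].
apply: fsum_cong; first by rewrite finite_setU; split; exact: tame_finsupp.
move=> s _; have [->|zs] := eqVneq (z s) 0; first by rewrite !mul0r; exact: cong_refl.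
by apply: congMz; apply: e; case: tz => + _ _; exact.
Qed.

Lemma pair_eq0 n (z : schain R n) (eta : smap R n -> R) :
  (forall s, z s != 0 -> eta s = 0) -> pair z eta = 0.
Proof.
move=> h; rewrite /pair fsbig1 // => s _.
by have [->|/h ->] := eqVneq (z s) 0; rewrite ?mul0r ?mulr0.
Qed.

Lemma pair_fsum n (I : choiceType) (A : set I) (z : schain R n) (eta : I -> smap R n -> R) :
  finite_set A -> tame z -> (forall i, A i -> compactly (eta i)) ->
  \sum_(i \in A) pair z (eta i) = pair z (fun s => \sum_(i \in A) eta i s).
Proof.
move=> /finite_uniq[l ul ->] tz h; rewrite -fsbig_seq //.
rewrite (_ : (fun s => _) = fun s => \sum_(i <- l) eta i s); last first.
  by apply/funext => s; rewrite -fsbig_seq.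
suff : compactly (fun s => \sum_(i <- l) eta i s) /\
    \sum_(i <- l) pair z (eta i) = pair z (fun s => \sum_(i <- l) eta i s) by case.
have {}h i : i \in l -> compactly (eta i) by exact: h.
elim: l {ul} h => [|i l IH] h.
  split; last by rewrite big_nil pair_eq0 // => s _; rewrite big_nil.
  by move=> r; exists 0 => s _; rewrite big_nil eqxx.
have [cl e] : compactly (fun s => \sum_(i <- l) eta i s) /\
    \sum_(i <- l) pair z (eta i) = pair z (fun s => \sum_(i <- l) eta i s).
  by apply: IH => j jl; apply: h; rewrite inE jl orbT.
have ci : compactly (eta i) by apply: h; rewrite inE eqxx.
rewrite (_ : (fun s => _) = fun s => eta i s + \sum_(j <- l) eta j s); last first.
  by apply/funext => s; rewrite big_cons.
by split; [exact: compactlyD|rewrite big_cons e pairDr].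
Qed.

Lemma pair_mul n (z : schain R n) (eta eta' : smap R n -> R) g x (r r' : R) :
  equiv r z -> lmatch g x (r' + r) ->
  (forall s, small r s -> eta s != 0 -> near x r' s) ->
  (forall s, small r s -> eta' s != 0 -> near (act g x) r' s) ->
  (forall s, small r s -> near x r' s -> eta' (mulm g \o s) = eta s) ->
  pair z eta' = pair z eta.
Proof.
move=> ez lm h1 h2 h3; rewrite /pair.
rewrite (fsumT_bij _ (@mulm_compK n g) (@mulm_compVK n g)); apply: eq_fsbigr => s _.
have [[sr [p sp]]|ns] := pselect (small r s /\ near x r' s).
  by rewrite (ez.2 _ _ p) ?h3 //; [exists p|apply: lmatch_sub lm _; lra].
transitivity (0 : R).
  apply/eqP; apply: contra_notT ns => /mulz_neq0[/(equiv_small ez)/small_mul sr].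
  move=> /(h2 _ ((small_mul g r s).2 sr))[p sp]; split=> //; exists p.
  by move: sp; rewrite /= enorm_act.
apply/esym/eqP; apply: contra_notT ns => /mulz_neq0[/(equiv_small ez) sr es].
by split=> //; exact: h1.
Qed.
Definition face0 : set (R * R) := xget set0 [set c | K 2 c].

Lemma face0P : K 2 face0.
Proof.
by have [c Kc _] := face_at 0; apply: (@xgetPex _ set0 [set c | K 2 c]); exists c.
Qed.

Lemma compactly0 n : compactly (fun _ : smap R n => 0).
Proof. by move=> r; exists 0 => s _; rewrite eqxx. Qed.

Lemma pair_fdeg_int (z : schain R 2) c : tame z -> K 2 c -> exists k : int, k%:~R = pair z (fdeg c).
Proof.
move=> tz Kc; have [k e] : cong (2 * pi * pair z (fdeg c)) 0.
  rewrite -pairZr //; last exact: fdeg_compactly.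
  rewrite -[X in cong _ X](@pair_eq0 2 z (fun=> 0)) //.
  apply: pair_cong => //; [by apply: compactlyMr; exact: fdeg_compactly|exact: compactly0|].
  by move=> s _; have [k ->] := fdeg_int s Kc; exists k; rewrite subr0.
by exists k; move: e; rewrite subr0 => /(mulfI pi2_neq0).
Qed.

(* The degree of z over the plane. *)
Definition mdeg (z : schain R 2) : int := xget 0 [set k : int | k%:~R = pair z (fdeg face0)].

Lemma mdegP (z : schain R 2) : tame z -> (mdeg z)%:~R = pair z (fdeg face0).
Proof.
move=> tz; apply: (@xgetPex _ 0 [set k : int | k%:~R = pair z (fdeg face0)]).
exact: pair_fdeg_int face0P.
Qed.

Section MainClaim.
Variables (z : schain R 2) (r : R).
Hypotheses (tz : tame z) (ez : equiv r z) (oz : over0 (sbd z)).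

Let tz' : tame (sbd z) := tame_sbd tz.

Let contz (u : smap R 1) : sbd z u != 0 -> continuous u.
Proof. by case: tz' => + _ _; exact. Qed.

Let pair_over0 (eta : smap R 1 -> R) :
  (forall u : smap R 1, continuous u -> (forall i, vertex K (trans (u i))) -> eta u = 0) ->
  pair (sbd z) eta = 0.
Proof. by move=> h; apply: pair_eq0 => u zu; apply: h; [exact: contz|exact: oz]. Qed.

Lemma delta_compactly (eta : smap R 1 -> R) : compactly eta -> compactly (delta eta).
Proof.
move=> h; rewrite (_ : delta _ = fun s => eta (s \o coface (inord 0)) -
  eta (s \o coface (inord 1)) + eta (s \o coface (inord 2))); last by apply/funext => s; exact: delta2.
by apply: compactlyD; first apply: compactlyB; exact: compactly_face.
Qed.

Lemma mdegE c : K 2 c -> (mdeg z)%:~R = pair z (fdeg c).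
Proof.
move=> Kc; rewrite mdegP //; apply: (faces_eq (f := fun c => pair z (fdeg c))) face0P Kc => v w e.
apply/eqP; rewrite -subr_eq0 -pairBr //; do ?exact: fdeg_compactly.
rewrite (@pair_eq 2 z _ (delta (count v w))); last by move=> s _; exact: fdeg_jump.
rewrite -stokes //; last exact: count_compactly.
by apply/eqP/pair_over0 => u; exact: over0_count.
Qed.

Definition tip s : motion R := tgt (s12 s).

Definition height c : R := pair z (fun s => fdeg c s * arg (rot (mulm (hmot c) (tip s)))).

Definition flux v w : R := pair z (fun s => count v w (s01 s) * theta (s12 s)).

Definition edgewind v w : R := flux v w - (mdeg z)%:~R * cross v w -
  (height (lface v w) - height (rface v w)).

Let flux_compactly v w : compactly (fun s => count v w (s01 s) * theta (s12 s)).
Proof. by apply: compactlyM; apply: compactly_face; exact: count_compactly. Qed.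

Let height_compactly c :
  compactly (fun s => fdeg c s * arg (rot (mulm (hmot c) (tip s)))).
Proof. by apply: compactlyM; exact: fdeg_compactly. Qed.

Lemma edgewindN v w : edge K v w -> edgewind w v = - edgewind v w.
Proof.
move=> e; rewrite /edgewind crossN // -rface_swap // -(rface_swap (edge_sym e)).
have -> : flux w v = - flux v w.
  rewrite /flux -mulN1r -pairZr //; apply: pair_eq => s _.
  by rewrite countN mulNr mulN1r.
by ring.
Qed.

Lemma flux_sum v : vertex K v ->
  \sum_(w \in [set w | edge K w v]) flux w v = pair (sbd z) (vturn v).
Proof.
move=> Kv; have fA : finite_set [set w | edge K w v].
  by apply: sub_finite_set (nbrs_finite v) => w; exact: edge_sym.
rewrite /flux pair_fsum // stokes //; last exact: vturn_compactly.
apply: pair_eq => s zs; have cs : continuous s by case: tz => + _ _; exact.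
have := count_sum v (s01 s); have [l ul ->] := finite_uniq fA.
rewrite -!fsbig_seq // -mulr_suml => ->.
rewrite delta2 -/(s12 s) -/(s02 s) -/(s01 s) /vturn theta_add //.
by have [-> _ ->] := simplex_corners s; ring.
Qed.

Lemma edgewind_sum v : vertex K v -> \sum_(w \in [set w | edge K w v]) edgewind w v =
  pair (sbd z) (vturn v) - 2 * pi * (mdeg z)%:~R * (sigma v)%:~R.
Proof.
move=> Kv; rewrite -flux_sum //.
have -> : [set w | edge K w v] = [set w | edge K v w].
  by apply/seteqP; split=> w; exact: edge_sym.
have fA := nbrs_finite v.
have hE (G : set (R * R) -> R) : \sum_(w \in [set w | edge K v w]) (G (lface w v) - G (rface w v)) = 0.
  rewrite fsumB //; apply/eqP; rewrite subr_eq0; apply/eqP.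
  transitivity (\sum_(w \in [set w | edge K v w]) G (rface v w)).
    by apply: eq_fsbigr => w /set_mem e; rewrite rface_swap.
  rewrite -tour_sum //; apply: eq_fsbigr => w /set_mem e.
  by rewrite (rface_swap (edge_sym e)).
rewrite /edgewind fsumB // hE subr0 fsumB //; congr (_ - _).
transitivity (- (mdeg z)%:~R * \sum_(w \in [set w | edge K v w]) cross v w).
  have [l ul lE] := finite_uniq fA; rewrite lE -!fsbig_seq // mulr_sumr big_seq [RHS]big_seq.
  apply: eq_bigr => w wl; rewrite crossN ?mulNr ?mulrN //.
  by have : [set` l] w by []; rewrite -lE.
by rewrite mulrAC sigmaP //; ring.
Qed.

Lemma arg_rot_mulm g h : cong (arg (rot (mulm g h))) (arg (rot g) + arg (rot h)).
Proof.
apply/expi_cong; rewrite expi_arg ?rot_norm // expiD !expi_arg ?rot_norm //.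
Qed.

Lemma edgewind_int v w : edge K v w -> cong (edgewind v w) 0.
Proof.
move=> e; have Kl := lface_face e; have Kr := rface_face e.
pose A f : R := arg (rot (mulm (hmot (rface v w)) f)).
pose zeta u : R := count v w u * A (tgt u).
have cz : compactly zeta by apply: compactlyM; exact: count_compactly.
have <- : - pair (sbd z) zeta = 0.
  by rewrite pair_over0 ?oppr0 // => u cu Ku; rewrite /zeta over0_count // mul0r.
rewrite stokes // /edgewind (mdegE Kl) /flux /height -(mulN1r (pair z (delta zeta))) -pairZr //; last exact: delta_compactly.
rewrite (mulrC (pair z _)) -pairZr //; last exact: fdeg_compactly.
have c1' : compactly (fun s => cross v w * fdeg (lface v w) s) by apply: compactlyMr; exact: fdeg_compactly.
rewrite -!pairBr //; do ?exact: compactlyB.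
apply: pair_cong => //; first by apply: compactlyB; apply: compactlyB.
  by apply: compactlyMr; exact: delta_compactly.
move=> s cs; have [k ek] := fdeg_int s Kl; have [k' ek'] := fdeg_int s Kr.
have jump := fdeg_jump s e; rewrite delta2 -/(s12 s) -/(s02 s) -/(s01 s) ek ek' in jump.
rewrite delta2 -/(s12 s) -/(s02 s) -/(s01 s) /zeta ek ek' -[arg (rot (mulm (hmot (rface v w)) (tip s)))]/(A (tip s)).
have [p12 p02 _] := simplex_corners s; rewrite -p02 -p12 -/(tip s).
have th : cong (theta (s12 s)) (A (tip s) - A (src (s12 s))).
  by apply: theta_cong_mul => p; apply: continuous_comp; [exact: continuous_coface|exact: cs].
have AL : cong (arg (rot (mulm (hmot (lface v w)) (tip s)))) (A (tip s) - cross v w).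
  apply: cong_trans (arg_rot_mulm _ _) _; rewrite -/(turn (lface v w)).
  have := congB (arg_rot_mulm (hmot (rface v w)) (tip s)) (cross_cong e).
  rewrite -/(turn (rface v w)) -/(A (tip s)) => /cong_sym; apply: cong_trans.
  rewrite (_ : turn (rface v w) + _ - _ = turn (lface v w) + arg (rot (tip s))); last by ring.
  exact: cong_refl.
have {}th := congMz (ecount v w (nu (src (s01 s))) (epth (s01 s))) th.
have {}AL := congMz k AL; rewrite -/(count v w (s01 s)) in th.
have := congB th (congB AL (cong_refl (k'%:~R * A (tip s)))).
move=> /congB /(_ (cong_refl (cross v w * k%:~R))).
set lhs := _ - _ - _; set rhs := _ - _ - _ => h.
have -> : count v w (s01 s) * theta (s12 s) - cross v w * k%:~R -
    (k%:~R * arg (rot (mulm (hmot (lface v w)) (tip s))) - k'%:~R * A (tip s)) = lhs.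
  by rewrite /lhs; ring.
apply: cong_trans h _; suff -> : rhs = -1 * (count v w (s12 s) * A (tip s) -
    count v w (s02 s) * A (tip s) + count v w (s01 s) * A (src (s12 s))) by exact: cong_refl.
have -> : rhs = count v w (s01 s) * (A (tip s) - A (src (s12 s))) - (k%:~R - k'%:~R) * A (tip s).
  by rewrite /rhs; ring.
by rewrite jump; ring.
Qed.

Definition edgechain v w : int :=
  if `[< edge K v w >] then xget 0 [set k : int | 2 * pi * k%:~R = edgewind v w] else 0.

Lemma edgechainP v w : edge K v w -> 2 * pi * (edgechain v w)%:~R = edgewind v w.
Proof.
move=> e; rewrite /edgechain asboolT //.
apply: (@xgetPex _ 0 [set k : int | 2 * pi * k%:~R = edgewind v w]).
by have [k] := edgewind_int e; rewrite subr0; exists k.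
Qed.

Lemma edgechainN v w : edgechain w v = - edgechain v w.
Proof.
have [e|ne] := pselect (edge K v w); last first.
  by rewrite /edgechain !asboolF ?oppr0 // => /edge_sym.
apply/eqP; rewrite -(eqr_int R) -(inj_eq (mulfI pi2_neq0)) edgechainP; last exact: edge_sym.
by rewrite rmorphN mulrN edgechainP // edgewindN.
Qed.

Lemma lmatch_thicken g (U : set (R * R)) y (a : R) : U y ->
  mtile g @` patch T (thicken U a) = patch T (thicken (act g @` U) a) -> lmatch g y a.
Proof.
move=> Uy e; split=> t Tt [x [tx xy]].
  have : (mtile g @` patch T (thicken U a)) (mtile g t).
    by exists t => //; split=> //; exists x; split=> //; exists y.
  by rewrite e => -[].
have : patch T (thicken (act g @` U) a) t.
  by split=> //; exists x; split=> //; exists (act g y) => //; exists y.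
by rewrite -e => -[t' [Tt' _] <-]; rewrite mtile_invK.
Qed.

Let far := 2 * r + 5 * diam.
Let wide := far + (3 * r + 4 * diam).

Lemma height_act g c v : 0 <= r -> lmatch g v wide -> K 2 c -> closure c v ->
  height (act g @` c) = height c.
Proof.
move=> r0 lm Kc cv; have d0 := diam_ge0.
have v0 : enorm (v - v) <= wide by rewrite subrr enorm0 /wide /far; lra.
have Kg := lmatch_cell lm Kc cv v0; have cx := xget_face Kc; have cg := xget_face Kg.
have hE := hmot_act lm Kc cv v0.
have nr c' v' s : K 2 c' -> closure c' v' -> small r s -> fdeg c' s != 0 -> near v' far s.
  move=> Kc' cv' sr /(deg_near (@corner R 2 ord0) sr) h; exists (@corner R 2 ord0).
  have := cell_diam Kc' (subset_closure (xget_face Kc')) cv'.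
  have := enorm_tri (trans (s (@corner R 2 ord0))) (xget 0 c') v'.
  by rewrite (enormB (trans _) (xget 0 c')) /far; lra.
apply: (pair_mul (r' := far) (g := g) (x := v) ez).
- by apply: lmatch_sub lm _; rewrite subrr enorm0 /wide; lra.
- by move=> s sr; rewrite mulf_eq0 negb_or => /andP[fs _]; exact: nr Kc cv sr fs.
- move=> s sr; rewrite mulf_eq0 negb_or => /andP[fs _]; apply: nr Kg _ sr fs.
  exact/closure_act.
move=> s sr [p sp]; rewrite (fdeg_mul (p := p) Kc Kg sr); last first.
  by apply: lmatch_sub lm _; rewrite /wide; lra.
congr (_ * arg (rot _)); rewrite hE /tip.
by rewrite -[tgt _]/(mulm g (tip s)) mulmA mulmKV.
Qed.

Lemma flux_act g v w : 0 <= r -> lmatch g v wide -> edge K v w ->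
  flux (act g v) (act g w) = flux v w.
Proof.
move=> r0 lm e; have d0 := diam_ge0.
have nr v' w' s : small r s -> count v' w' (s01 s) != 0 -> near v' far s.
  move=> sr /(count_near (small_comp _ sr)) h; exists (coface (inord 2) (@corner R 1 ord0)).
  by rewrite enormB /far; lra.
apply: (pair_mul (r' := far) (g := g) (x := v) ez).
- by apply: lmatch_sub lm _; rewrite subrr enorm0 /wide; lra.
- by move=> s sr; rewrite mulf_eq0 negb_or => /andP[fs _]; exact: nr sr fs.
- by move=> s sr; rewrite mulf_eq0 negb_or => /andP[fs _]; exact: nr sr fs.
move=> s sr [p sp].
rewrite -[s01 _]/(mulm g \o s01 s) -[s12 _]/(mulm g \o s12 s) theta_mul.
rewrite (count_mul _ _ (small_comp _ sr)) //; apply: (lmatch_corner (p := p) _ sr).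
by apply: lmatch_sub lm _; rewrite /wide; lra.
Qed.

Lemma edgechain_C1 : 0 <= r -> C1 T K edgechain.
Proof.
move=> r0; have d0 := diam_ge0; split; first exact: edgechainN.
  by move=> v w; rewrite /edgechain; case: asboolP => //; rewrite eqxx.
exists (wide + diam + 1); first by rewrite /wide /far; lra.
move=> g v w e eg; rewrite -act_oseg => /(lmatch_thicken (oseg_mid v w)) lm0.
have lm : lmatch g v wide.
  apply: lmatch_sub lm0 _; rewrite -{1}(pt0 v w) pt_dist subr0 sub0r.
  have := edge_diam e; rewrite enormB; have := enorm_ge0 (w - v).
  have : enorm ((- 2^-1, 0) : R * R) <= 1.
    by apply: le_trans (enorm_le _) _; rewrite /= normr0 addr0 normrN ger0_norm; lra.
  have := enorm_ge0 ((- 2^-1, 0) : R * R); set a := enorm _; set b := enorm _ => a0 a1 b0 b1.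
  have : a * b <= 1 * b by apply: ler_wpM2r.
  by lra.
have v0 : enorm (v - v) <= wide by rewrite subrr enorm0 /wide /far; lra.
apply/eqP; rewrite -(eqr_int R) -(inj_eq (mulfI pi2_neq0)) !edgechainP //.
rewrite /edgewind flux_act // (lmatch_cross lm e v0) (lmatch_lface lm e v0) (lmatch_rface lm e v0).
rewrite !(height_act r0 lm) //.
- exact: rface_face.
- exact: (closure_side pm2 e).
- exact: lface_face.
exact: (closure_side pm1 e).
Qed.

Lemma main_winding : 0 <= r -> exists2 b, C1 T K b &
  winding_numbers K (sbd z) (fun v => sigma v * mdeg z + bd1 K b v).
Proof.
move=> r0; exists edgechain; first exact: edgechain_C1; split=> [v nK|v Kv].
  rewrite /sigma asboolF // mul0r add0r /bd1 fsbig1 // => w /= e.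
  by have [] := nK; have [] := edge_vertex e.
exists theta; split=> [u zu _|]; first by apply: thetaP; exact: contz.
have fA : finite_set [set w | edge K w v].
  by apply: sub_finite_set (nbrs_finite v) => w; exact: edge_sym.
have bE : 2 * pi * (bd1 K edgechain v)%:~R = \sum_(w \in [set w | edge K w v]) edgewind w v.
  rewrite /bd1; have [l ul lE] := finite_uniq fA; rewrite lE -!fsbig_seq // rmorph_sum mulr_sumr.
  rewrite big_seq [RHS]big_seq; apply: eq_bigr => w wl; rewrite edgechainP //.
  by have : [set` l] w by []; rewrite -lE.
rewrite rmorphD rmorphM /= mulrDr bE edgewind_sum //.
transitivity (pair (sbd z) (vturn v)); first by ring.
rewrite /pair; apply/esym.
have nE u : sbd z u != 0 -> nu (src u) = trans (src u) by move=> zu; apply: nu_vertex; exact: oz.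
transitivity (\sum_(s \in [set s : smap R 1 | range s `<=` fibre v]) (sbd z s)%:~R * vturn v s).
  apply: eq_fsbigr => u /set_mem uf.
  have [->|zu] := eqVneq (sbd z u) 0; first by rewrite !mul0r.
  rewrite /vturn nE // (uf (src u)) ?eqxx ?mul1r //.
apply: fsbig_widen => // u [_ /= nf].
have [->|zu] := eqVneq (sbd z u) 0; first by rewrite mul0r.
rewrite /vturn nE //; case: eqP => [e|_]; last by rewrite mul0r mulr0.
case: nf => _ [p _ <-]; rewrite /fibre /= -e.
by apply: vertex_path_const; [exact: contz|exact: oz].
Qed.

End MainClaim.

Lemma winding_uniq (y : schain R 1) (w w' : chain0 R) :
  winding_numbers K y w -> winding_numbers K y w' -> w = w'.
Proof.
move=> [h0 h] [h0' h']; apply/funext => v; have [Kv|nK] := pselect (vertex K v); last first.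
  by rewrite h0 // h0'.
have [t [ht e]] := h _ Kv; have [t' [ht' e']] := h' _ Kv.
apply: (@intr_inj R); apply: (mulfI pi2_neq0); rewrite e e'; apply: eq_fsbigr => s /set_mem sf.
have [->|ys] := eqVneq (y s) 0; first by rewrite !mul0r.
by congr (_ * _); apply: (@turning_uniq s); [exact: ht|exact: ht'].
Qed.

(** * The winding of a boundary *)

Fact dirm_unit x f : (expi (arg (trans f - x))).1 ^+ 2 + (expi (arg (trans f - x))).2 ^+ 2 == 1.
Proof. by rewrite -enorm_sqr enorm_expi expr1n. Qed.

(* The direction of trans f seen from x, so that theta (dirm x \o u) is the angle swept
   by the projection of u around x. *)
Definition dirm x f : motion R := Motion 0 (dirm_unit x f).

Lemma expi_argE w : w != 0 -> expi (arg w) = rotate ((enorm w)^-1, 0) w.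
Proof.
move=> w0; have n0 : enorm w != 0 by rewrite gt_eqF // enorm_gt0.
transitivity (rotate (rotate ((enorm w)^-1, 0) (enorm w, 0)) (expi (arg w))).
  have -> : rotate ((enorm w)^-1, 0) (enorm w, 0) = (1, 0).
    by rewrite /rotate /= mulVf // !mulr0 mul0r subr0 addr0.
  by rewrite rotate1.
by rewrite -rotateA -argK.
Qed.

Lemma continuous_dirm n x (u : smap R n) : continuous u -> (forall i, trans (u i) != x) ->
  continuous (dirm x \o u).
Proof.
move=> cu ux i; apply: (@cvg_motion _ _ (nbhs_filter i)).
  exact: (@cvg_cst _ _ _ _ (nbhs_filter i)).
have wE : (fun j => rot ((dirm x \o u) j)) =
    (fun j => rotate ((enorm (trans (u j) - x))^-1, 0) (trans (u j) - x)).
  by apply/funext => j; rewrite -expi_argE // subr_eq0.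
rewrite wE -[rot _]/(expi (arg (trans (u i) - x))) expi_argE ?subr_eq0 //.
have ct : (fun j => trans (u j) - x) @ nbhs i --> trans (u i) - x.
  apply/(@cvg_enormP _ _ (nbhs_filter i)) => e e0.
  have := (@cvg_enormP _ _ (nbhs_filter i) _ _).1 (@cvg_trans_part _ _ (nbhs_filter i) _ _ (cu i)) e e0.
  by apply: (@filterS _ _ (nbhs_filter i)) => j; rewrite /= opprB addrA subrK.
apply: (@cvg_rotate _ _ _ (nbhs_filter i)); last exact: ct.
apply: (@cvg_pairP _ _ _ (nbhs_filter i)) => /=; last exact: (@cvg_cst _ _ _ _ (nbhs_filter i)).
apply: (@cvgV _ _ _ (nbhs_filter i)); last exact: (@cvg_enorm _ _ _ (nbhs_filter i)).
by rewrite gt_eqF // enorm_gt0 // subr_eq0.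
Qed.

Definition sweep x u : R := theta (dirm x \o u).

Definition tilt x f : R := ang x (trans f) (nu f).

Definition slack x u : R := if `[< continuous u >] then
  beta x u - sweep x u - (tilt x (tgt u) - tilt x (src u)) else 0.

Lemma sweep_far x y (u : smap R 1) : continuous u ->
  (forall i, enorm (trans (u i) - y) < enorm (y - x)) ->
  sweep x u = arg (rotate (trans (tgt u) - x) (conjp (y - x))) -
    arg (rotate (trans (src u) - x) (conjp (y - x))).
Proof.
move=> cu hu; have pos i := far_halfplane (hu i).
have yx : y - x != 0.
  apply/eqP => e; have := hu (@corner R 1 ord0); rewrite e enorm0.
  by rewrite ltNge enorm_ge0.
have ux i : trans (u i) - x != 0.
  by apply/eqP => e; have := pos i; rewrite e rotateC rotate0 ltxx.
apply: (@turning_uniq (dirm x \o u)).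
  by apply: thetaP; apply: continuous_dirm => // i; rewrite -subr_eq0.
exists (fun i => arg (rotate (trans (u i) - x) (conjp (y - x))) + arg (y - x)); split.
- move=> i; apply: (@cvgD _ _ _ _ (nbhs_filter i)); last exact: (@cvg_cst _ _ _ _ (nbhs_filter i)).
  apply: (@cvg_arg _ _ _ (nbhs_filter i)).
    by apply: lt_le_trans (pos i) _; rewrite lerDr; exact: enorm_ge0.
  apply: (@cvg_rotate _ _ _ (nbhs_filter i)); last exact: (@cvg_cst _ _ _ _ (nbhs_filter i)).
  apply/(@cvg_enormP _ _ (nbhs_filter i)) => e e0.
  have := (@cvg_enormP _ _ (nbhs_filter i) _ _).1 (@cvg_trans_part _ _ (nbhs_filter i) _ _ (cu i)) e e0.
  by apply: (@filterS _ _ (nbhs_filter i)) => j; rewrite /= opprB addrA subrK.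
- move=> i; rewrite -[LHS]/(expi (arg (trans (u i) - x))) -[RHS]/(expi _).
  apply/expi_cong; have := congD (cong_sym (arg_cong yx (ux i))) (cong_refl (arg (y - x))).
  by rewrite subrK.
by ring.
Qed.

Lemma slack_compactly x : compactly (slack x).
Proof.
move=> r; exists (enorm x + (2 * r + 4 * diam)) => u sr.
rewrite /slack; case: asboolP => [cu|_]; last by rewrite eqxx.
move=> s0; apply: (near_origin (p := @corner R 1 ord0)); move: s0; apply: contra_neqT.
rewrite -ltNge enormB -/(src u) => far; set y := trans (src u) in far *.
have r0 := small_ge0 sr; have d0 := diam_ge0.
have nr i : enorm (trans (u i) - y) <= r by exact: sr.
have nn i : enorm (nu (u i) - y) < enorm (y - x).
  by have := enorm_tri (nu (u i)) (trans (u i)) y; have := nu_near (u i); have := nr i; lra.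
have tE i : tilt x (u i) = arg (rotate (nu (u i) - x) (conjp (y - x))) -
    arg (rotate (trans (u i) - x) (conjp (y - x))).
  by apply: ang_halfplane; apply: far_halfplane => //; have := nr i; lra.
rewrite (beta_far sr far); last exact: nr.
rewrite (@sweep_far x y u cu); last by move=> i; have := nr i; lra.
by rewrite /src /tgt !tE; ring.
Qed.

Lemma slack_over0 x u : (forall i, vertex K (trans (u i))) -> ~ vertex K x -> slack x u = 0.
Proof.
move=> Ku nx; rewrite /slack; case: asboolP => // cu.
have tc i j := vertex_path_const i j cu Ku.
rewrite /beta (over0_epth cu Ku).1 /= /tilt !nu_vertex; [|exact: Ku|exact: Ku].
rewrite !angxx !subr0 sub0r; apply/eqP; rewrite oppr_eq0; apply/eqP.
apply: (@turning_uniq (dirm x \o u)).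
  by apply: thetaP; apply: continuous_dirm => // i; apply/eqP => e; apply: nx; rewrite -e.
exists (fun=> arg (trans (src u) - x)); split; first exact: cst_continuous.
  by move=> i; rewrite /= (tc i (@corner R 1 ord0)).
by rewrite subrr.
Qed.

Lemma mdeg_over1 (y : schain R 2) : tame y ->
  (forall s, y s != 0 -> forall i, skeleton K 1 (trans (s i))) -> over0 (sbd y) -> mdeg y = 0.
Proof.
move=> ty oy o0; apply: (@intr_inj R); rewrite mdegP //; have Kc := face0P.
set x := xget 0 face0; have cx : face0 x := xget_face Kc.
have sx s : y s != 0 -> forall i, trans (s i) != x.
  move=> ys i; apply/eqP => e; have [k [d Kd [k1 dx]]] := oy _ ys i.
  rewrite e in dx; have [k2 _] := cell_eq KCW Kd Kc dx cx.
  by rewrite k2 in k1.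
have nx : ~ vertex K x by exact: face_vertexN Kc cx.
apply: (mulfI pi2_neq0); rewrite mulr0 -pairZr //; last exact: fdeg_compactly.
transitivity (pair y (delta (slack x))); last first.
  rewrite -stokes //; last exact: slack_compactly.
  by apply: pair_eq0 => u yu; apply: slack_over0 => //; exact: o0.
apply: pair_eq => s ys; have cs : continuous s by case: ty => + _ _; exact.
have cf (i : 'I_3) : continuous (s \o coface i).
  by move=> p; apply: continuous_comp; [exact: continuous_coface|exact: cs].
rewrite -degE !delta2 /slack !asboolT //.
have : theta (s02 (dirm x \o s)) = theta (s01 (dirm x \o s)) + theta (s12 (dirm x \o s)).
  by apply: theta_add; apply: continuous_dirm => // i; exact: sx.
rewrite -[theta (s02 _)]/(sweep x (s02 s)) -[theta (s01 _)]/(sweep x (s01 s)).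
rewrite -[theta (s12 _)]/(sweep x (s12 s)) -/(s12 s) -/(s02 s) -/(s01 s) => ->.
by have [-> -> ->] := simplex_corners s; ring.
Qed.

(** * Singular simplices over vertices, edges and faces *)

Fact expi_unit (t : R) : (expi t).1 ^+ 2 + (expi t).2 ^+ 2 == 1.
Proof. by rewrite -enorm_sqr enorm_expi expr1n. Qed.

Definition wt n (x : @std_simplex R n) i : R := (val x : 'rV[R]_n.+1) 0 i.

Lemma wt_ge0 n (x : @std_simplex R n) i : 0 <= wt x i.
Proof. by have [h _] := simplexP x; exact: h. Qed.

Lemma wt_sum n (x : @std_simplex R n) : \sum_i wt x i = 1.
Proof. by have [_ h] := simplexP x. Qed.

Lemma rotate_realD y : {morph (fun a : R => rotate (a, 0) y) : a b / a + b}.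
Proof. by move=> a b /=; apply: injective_projections; rewrite /rotate /=; ring. Qed.

Lemma rotate_real0 y : rotate (0, 0) y = 0.
Proof. by rewrite /rotate /= !mul0r subr0 addr0. Qed.

Definition affm n (f : 'I_n.+1 -> R * R) (th : 'I_n.+1 -> R) : smap R n :=
  fun s => Motion (\sum_i rotate (wt s i, 0) (f i)) (expi_unit (\sum_i wt s i * th i)).

Lemma affm_face n (f : 'I_n.+2 -> R * R) th i :
  affm f th \o coface i = affm (f \o lift i) (th \o lift i).
Proof.
have w0 (x : @std_simplex R n) : wt (coface i x) i = 0 by rewrite /wt coface_val unlift_none.
have wl (x : @std_simplex R n) k : wt (coface i x) (lift i k) = wt x k.
  by rewrite /wt coface_val liftK.
apply/funext => x; apply: motion_eq => /=.
  rewrite (bigD1_ord i) //= w0 rotate_real0 add0r.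
  by apply: eq_bigr => k _; rewrite wl.
congr expi; rewrite (bigD1_ord i) //= w0 mul0r add0r.
by apply: eq_bigr => k _; rewrite wl.
Qed.

Lemma wt_shift n (x : @std_simplex R n) (th : 'I_n.+1 -> R) (t : R) :
  \sum_i wt x i * (th i + t) = \sum_i wt x i * th i + t.
Proof.
transitivity (\sum_i (wt x i * th i + wt x i * t)); first by apply: eq_bigr => i _; exact: mulrDr.
by rewrite big_split /= -mulr_suml wt_sum mul1r.
Qed.

Lemma affm_mul n g (t : R) (f : 'I_n.+1 -> R * R) th : expi t = rot g ->
  mulm g \o affm f th = affm (act g \o f) (fun i => th i + t).
Proof.
move=> tg; apply/funext => x; apply: motion_eq => /=.
  rewrite /act (big_morph (rotate (rot g)) (rotateDr (rot g)) (rotate0 (rot g))).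
  have {1}-> : trans g = \sum_i rotate (wt x i, 0) (trans g).
    rewrite -(big_morph (fun a : R => rotate (a, 0) (trans g)) (rotate_realD _) (rotate_real0 _)).
    by rewrite wt_sum rotate1.
  rewrite -big_split /=; apply: eq_bigr => i _.
  by rewrite rotateDr !rotateA (rotateC (rot g)).
by rewrite -tg -expiD wt_shift addrC.
Qed.

Lemma affm_cong n (f : 'I_n.+1 -> R * R) th th' (t : R) : cong t 0 ->
  (forall i, th' i = th i + t) -> affm f th' = affm f th.
Proof.
move=> [k]; rewrite subr0 => tk h; apply/funext => x; apply: motion_eq => //=.
by rewrite -[RHS](expi_period _ k) -tk -wt_shift; congr expi; apply: eq_bigr => i _; rewrite h.
Qed.

Lemma affm_corner n (f : 'I_n.+1 -> R * R) th i :
  trans (affm f th (@corner R n i)) = f i /\ rot (affm f th (@corner R n i)) = expi (th i).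
Proof.
have w j : wt (@corner R n i) j = (j == i)%:R by exact: corner_val.
split=> /=.
  rewrite (bigD1 i) //= w eqxx rotate1 big1 ?addr0 // => j ji.
  by rewrite w (negbTE ji) rotate_real0.
congr expi; rewrite (bigD1 i) //= w eqxx mul1r big1 ?addr0 // => j ji.
by rewrite w (negbTE ji) mul0r.
Qed.

Lemma cvg_sumr (X : Type) (F : set_system X) {FF : Filter F} (I : eqType) (l : seq I)
  (f : I -> X -> R) (a : I -> R) : (forall i, i \in l -> f i @ F --> a i) ->
  (fun k => \sum_(i <- l) f i k) @ F --> \sum_(i <- l) a i.
Proof.
elim: l => [|i l IH] h.
  rewrite big_nil (_ : (fun k => _) = fun=> 0); first exact: cvg_cst.
  by apply/funext => k; rewrite big_nil.
rewrite big_cons (_ : (fun k => _) = fun k => f i k + \sum_(j <- l) f j k); last first.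
  by apply/funext => k; rewrite big_cons.
apply: cvgD; first by apply: h; rewrite inE eqxx.
by apply: IH => j jl; apply: h; rewrite inE jl orbT.
Qed.

Lemma affm_continuous n (f : 'I_n.+1 -> R * R) th : continuous (affm f th).
Proof.
have cw i : continuous (fun x : @std_simplex R n => wt x i).
  move=> x; apply: (@continuous_cvg _ _ _ _ (nbhs_filter x) (fun p : @std_simplex R n => val p : 'rV[R]_n.+1)
    (fun v : 'rV[R]_n.+1 => v 0 i)); last exact: val_simplex_continuous.
  exact: coord_continuous.
have cs (a : 'I_n.+1 -> R) : continuous (fun x : @std_simplex R n => \sum_i wt x i * a i).
  move=> x; apply: (@cvg_sumr _ _ (nbhs_filter x)) => i _.
  apply: (@cvgM _ _ _ (nbhs_filter x)); first exact: cw.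
  exact: (@cvg_cst _ _ _ _ (nbhs_filter x)).
move=> x; apply: (@cvg_motion _ _ (nbhs_filter x)) => /=.
  have E (y : @std_simplex R n) : \sum_i rotate (wt y i, 0) (f i) = (\sum_i wt y i * (f i).1, \sum_i wt y i * (f i).2).
    apply: injective_projections => /=.
      rewrite (big_morph fst (id1 := 0) (op1 := +%R)) //.
      by apply: eq_bigr => i _; rewrite /rotate /= mul0r subr0.
    rewrite (big_morph snd (id1 := 0) (op1 := +%R)) //.
    by apply: eq_bigr => i _; rewrite /rotate /= mul0r add0r.
  rewrite E (funext E); apply: (@cvg_pairP _ _ _ (nbhs_filter x)); exact: cs.
apply: (@continuous_cvg _ _ _ _ (nbhs_filter x) (fun k : @std_simplex R n => \sum_i wt k i * th i) (@expi R)); last exact: cs.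
exact: expi_continuous.
Qed.

Lemma enorm_sum (I : Type) (l : seq I) (f : I -> R * R) :
  enorm (\sum_(i <- l) f i) <= \sum_(i <- l) enorm (f i).
Proof.
elim: l => [|i l IH]; first by rewrite !big_nil enorm0.
by rewrite !big_cons; apply: le_trans (enormD _ _) _; rewrite lerD2l.
Qed.

Lemma affm_near n (f : 'I_n.+1 -> R * R) th y (r : R) (x : @std_simplex R n) :
  (forall i, enorm (f i - y) <= r) -> enorm (trans (affm f th x) - y) <= r.
Proof.
move=> h; have -> : trans (affm f th x) - y = \sum_i rotate (wt x i, 0) (f i - y).
  rewrite (eq_bigr (fun i => rotate (wt x i, 0) (f i) - rotate (wt x i, 0) y)); last first.
    by move=> i _; exact: rotateBr.
  rewrite sumrB -(big_morph (fun a : R => rotate (a, 0) y) (rotate_realD _) (rotate_real0 _)).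
  by rewrite wt_sum rotate1.
apply: le_trans (enorm_sum _ _) _; rewrite -[leRHS]mul1r -(wt_sum x) mulr_suml.
apply: ler_sum => i _; rewrite enormM (_ : enorm (wt x i, 0) = wt x i).
  by apply: ler_wpM2l => //; exact: wt_ge0.
by rewrite /enorm /= expr0n addr0 sqrtr_sqr ger0_norm // wt_ge0.
Qed.

Definition tri (X : Type) (a b d : X) (i : 'I_3) : X :=
  match val i with 0%N => a | 1%N => b | _ => d end.

Definition duo (X : Type) (a b : X) (i : 'I_2) : X := if val i is 0%N then a else b.

Lemma tri_faces a b d (t1 t2 t3 : R) : [/\
  s12 (affm (tri a b d) (tri t1 t2 t3)) = affm (duo b d) (duo t2 t3),
  s02 (affm (tri a b d) (tri t1 t2 t3)) = affm (duo a d) (duo t1 t3) &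
  s01 (affm (tri a b d) (tri t1 t2 t3)) = affm (duo a b) (duo t1 t2)].
Proof.
by split; rewrite /s12 /s02 /s01 affm_face; congr affm; apply/funext => -[[|[|i]] hi] //=;
  rewrite /tri /duo /= /bump inordK.
Qed.

Lemma duo_src a b (t1 t2 : R) : trans (src (affm (duo a b) (duo t1 t2))) = a.
Proof. exact: (affm_corner _ _ ord0).1. Qed.

Lemma duo_tgt a b (t1 t2 : R) : trans (tgt (affm (duo a b) (duo t1 t2))) = b.
Proof. exact: (affm_corner _ _ ord_max).1. Qed.

Definition ind (P : Prop) : R := (`[< P >])%:R.

Section Families.
Variables (I : choiceType) (n : nat) (E : set I) (F : I -> smap R n) (r : R).
Hypotheses (Ects : forall i, E i -> continuous (F i)) (Esm : forall i, E i -> small r (F i)).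
Hypothesis Efin : forall d : R, finite_set [set i | E i /\ near 0 d (F i)].

Definition fam : schain R n := fun s => \sum_(i \in [set i | E i /\ F i = s]) (1 : int).

Lemma fam_neq0 s : fam s != 0 -> exists2 i, E i & F i = s.
Proof.
apply: contraPP => h; rewrite /fam fsbig1 ?eqxx // => i [Ei Fi].
by case: h; exists i.
Qed.

Lemma tame_fam : tame fam.
Proof.
split; first by move=> s /fam_neq0[i Ei <-]; exact: Ects.
  move=> d; apply: sub_finite_set (finite_image F (Efin d)) => s [/fam_neq0[i Ei <-] h].
  by exists i.
by exists r => s /fam_neq0[i Ei <-]; exact: Esm.
Qed.

Lemma fam_finsupp (eta : smap R n -> R) : compactly eta ->
  finsupp (fun i => ind (E i) * eta (F i)).
Proof.
move=> /(_ r)[d h]; apply: sub_finite_set (Efin d) => i /=.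
rewrite mulf_eq0 negb_or /ind; case: asboolP => [Ei /andP[_ e]|_]; last by rewrite eqxx.
by split=> //; apply: h => //; exact: Esm.
Qed.

Lemma pair_fam (eta : smap R n -> R) : compactly eta ->
  pair fam eta = \sum_(i \in [set: I]) ind (E i) * eta (F i).
Proof.
move=> h; rewrite -(fsumT_fibre F (fam_finsupp h)); apply: eq_fsbigr => s _.
have fs : finite_set [set i | E i /\ F i = s].
  apply: sub_finite_set (Efin (enorm (trans (s (@corner R n ord0))))) => i [Ei Fi].
  by split=> //; exists (@corner R n ord0); rewrite subr0 Fi.
rewrite (_ : \sum_(i \in [set i | F i = s]) _ = \sum_(i \in [set i | E i /\ F i = s]) eta s).
  have [l ul lE] := finite_uniq fs; rewrite /fam lE -!fsbig_seq // rmorph_sum mulr_suml.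
  by apply: eq_bigr => i _; rewrite mul1r.
transitivity (\sum_(i \in [set i | E i /\ F i = s]) ind (E i) * eta (F i)).
  apply/esym/fsbig_widen => [i []//|i [/= Fi nE]].
  by rewrite /ind asboolF ?mul0r // => Ei; apply: nE.
by apply: eq_fsbigr => i /set_mem[Ei ->]; rewrite /ind asboolT // mul1r.
Qed.

End Families.

(** * Winding around faces *)

Implicit Types i : (R * R) * (R * R).

Definition swap i : (R * R) * (R * R) := (i.2, i.1).

Lemma swapK : cancel swap swap. Proof. by case. Qed.

Lemma ind_edge_sym v w : ind (edge K v w) = ind (edge K w v).
Proof. by congr (ind _); apply: propext; split; exact: edge_sym. Qed.

Lemma finsupp_swap (F : (R * R) * (R * R) -> R) : finsupp F -> finsupp (fun i => F (swap i)).
Proof.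
move=> hF; apply: (@sub_finite_set _ _ _ _ (finite_image swap hF)) => i /= Fi.
by exists (swap i); [|exact: swapK].
Qed.

Lemma esum_nbrs (F : R * R -> R * R -> R) :
  finsupp (fun i => ind (edge K i.1 i.2) * F i.1 i.2) ->
  \sum_(i \in [set: (R * R) * (R * R)]) ind (edge K i.1 i.2) * F i.1 i.2 =
  \sum_(v \in [set: R * R]) \sum_(w \in [set w | edge K v w]) F v w.
Proof.
move=> hF; rewrite -(fsumT_fibre (fun i => i.1) hF); apply: eq_fsbigr => v _.
rewrite (_ : [set i | i.1 = v] = (fun w => (v, w)) @` [set: R * R]); last first.
  by apply/seteqP; split=> [[a b] /= <-|_ [w _ <-]] //; exists b.
rewrite fsbig_image; last by move=> a b _ _ [].
transitivity (\sum_(w \in [set w | edge K v w]) ind (edge K v w) * F v w).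
  apply/esym/fsbig_widen => // w [_ /= nw].
  by rewrite /ind asboolF ?mul0r.
by apply: eq_fsbigr => w /set_mem /= e; rewrite /ind asboolT // mul1r.
Qed.

Lemma balance (H : set (R * R) -> R * R -> R) :
  finsupp (fun i => ind (edge K i.1 i.2) * H (lface i.1 i.2) i.1) ->
  finsupp (fun i => ind (edge K i.1 i.2) * H (lface i.1 i.2) i.2) ->
  \sum_(i \in [set: (R * R) * (R * R)]) ind (edge K i.1 i.2) * H (lface i.1 i.2) i.1 =
  \sum_(i \in [set: (R * R) * (R * R)]) ind (edge K i.1 i.2) * H (lface i.1 i.2) i.2.
Proof.
move=> h1 h2; rewrite [RHS](fsumT_bij _ swapK swapK).
have h3 : finsupp (fun i => ind (edge K i.1 i.2) * H (lface i.2 i.1) i.1).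
  apply: sub_finite_set (finsupp_swap h2) => i /=.
  by rewrite (ind_edge_sym i.2).
apply: etrans (esum_nbrs (F := fun v w => H (lface v w) v) h1) _.
transitivity (\sum_(i \in [set: (R * R) * (R * R)]) ind (edge K i.1 i.2) * H (lface i.2 i.1) i.1); last first.
  by apply: eq_fsbigr => i _; rewrite /= ind_edge_sym.
apply/esym; apply: etrans (esum_nbrs (F := fun v w => H (lface w v) v) h3) _.
apply/esym; apply: eq_fsbigr => v _; have [Kv|nK] := pselect (vertex K v); last first.
  by rewrite !fsbig1 // => w /= e; case: nK; have [] := edge_vertex e.
rewrite (@tour_sum v R (fun c => H c v) Kv); apply: eq_fsbigr => w /set_mem e.
by rewrite rface_swap.
Qed.

Definition boundary c : set ((R * R) * (R * R)) :=
  [set i | edge K i.1 i.2 /\ lface i.1 i.2 = c].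

Lemma boundary_closure c i : boundary c i -> closure c i.1 /\ closure c i.2.
Proof.
move=> [e <-]; split; first exact: (closure_side pm1 e).
by rewrite lface_swap //; exact: (closure_side pm2 (edge_sym e)).
Qed.

Lemma boundary_finite c : K 2 c -> finite_set (boundary c).
Proof.
move=> Kc; pose V := [set v | vertex K v /\ enorm (v - xget 0 c) <= diam].
have fV : finite_set V := vertices_finite _ _.
apply: (@sub_finite_set _ _ (V `*` V)) (finite_setX fV fV) => i bi.
have [b1 b2] := boundary_closure bi; have [K1 K2] := edge_vertex bi.1.
have cx := subset_closure (xget_face Kc).
by split; split=> //; exact: (cell_diam Kc).
Qed.

Lemma boundary_sum c (F : (R * R) * (R * R) -> R) :
  \sum_(i \in [set: (R * R) * (R * R)]) ind (edge K i.1 i.2) * (ind (lface i.1 i.2 = c) * F i) =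
  \sum_(i \in boundary c) F i.
Proof.
transitivity (\sum_(i \in boundary c) ind (edge K i.1 i.2) * (ind (lface i.1 i.2 = c) * F i)).
  apply: fsumT => i; rewrite /ind; case: asboolP => [e|_]; last by rewrite mul0r eqxx.
  by case: asboolP => [|_] //; rewrite mul0r mulr0 eqxx.
by apply: eq_fsbigr => i /set_mem[e l]; rewrite /ind !asboolT // !mul1r.
Qed.

Lemma boundary_balance c (G : R * R -> R) : K 2 c ->
  \sum_(i \in boundary c) G i.1 = \sum_(i \in boundary c) G i.2.
Proof.
move=> Kc; rewrite -!boundary_sum; apply: (balance (H := fun c' v => ind (c' = c) * G v)).
  apply: sub_finite_set (boundary_finite Kc) => i /=; rewrite /ind.
  case: asboolP => [e|_]; last by rewrite mul0r eqxx.
  by case: asboolP => [|_] //; rewrite mul0r mulr0 eqxx.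
apply: sub_finite_set (boundary_finite Kc) => i /=; rewrite /ind.
case: asboolP => [e|_]; last by rewrite mul0r eqxx.
by case: asboolP => [|_] //; rewrite mul0r mulr0 eqxx.
Qed.

Definition polywind c x : R := \sum_(i \in boundary c) ang x i.1 i.2.

Lemma polywind_cong c d x : K 2 c -> K 2 d -> d x -> cong (polywind c x) 0.
Proof.
move=> Kc Kd dx; have fb := boundary_finite Kc.
have nv v : vertex K v -> v != x.
  by move=> Kv; apply/eqP => e; rewrite e in Kv; exact: face_vertexN Kd dx Kv.
have <- : \sum_(i \in boundary c) (arg (i.2 - x) - arg (i.1 - x)) = 0.
  by rewrite fsumB // (boundary_balance (fun v => arg (v - x)) Kc) subrr.
apply: fsum_cong => // i [e _]; have [K1 K2] := edge_vertex e.
by apply: ang_cong; exact: nv.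
Qed.

Lemma polywind_list c : K 2 c -> exists l, [/\ uniq l, boundary c = [set` l],
  (forall i, i \in l -> edge K i.1 i.2) &
  forall x, polywind c x = \sum_(i <- l) ang x i.1 i.2].
Proof.
move=> Kc; have [l ul lE] := finite_uniq (boundary_finite Kc); exists l; split=> //.
  by move=> i il; have : [set` l] i by []; rewrite -lE => -[].
by move=> x; rewrite /polywind lE -fsbig_seq.
Qed.

Lemma polywind_const c d x y : K 2 c -> K 2 d -> d x -> d y -> polywind c x = polywind c y.
Proof.
move=> Kc Kd dx dy; apply: (face_cong_const Kd) dx dy => z dz; last exact: polywind_cong Kc Kd dz.
have [l [_ _ el lE]] := polywind_list Kc; rewrite (funext lE) => A.
apply: (@cvg_sumr _ _ (nbhs_filter z)) => i il.
apply: (@cvg_ang _ _ _ (nbhs_filter z)); last exact: cvg_id.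
exact: face_csegN Kd dz (el _ il).
Qed.

Lemma sum_eq_mem (I : eqType) (l : seq I) (j : I) : uniq l ->
  \sum_(i <- l) (i == j)%:R = (j \in l)%:R :> R.
Proof.
elim: l => [|i l IH] /=; first by rewrite big_nil.
move=> /andP[nl ul]; rewrite big_cons IH // inE eq_sym.
by case: eqP => [->|_]; rewrite ?add0r // (negbTE nl) addr0.
Qed.

Lemma polywind_jump c v w : K 2 c -> edge K v w ->
  polywind c (xget 0 (lface v w)) - polywind c (xget 0 (rface v w)) =
  2 * pi * (ind (lface v w = c) - ind (rface v w = c)).
Proof.
move=> Kc e; have Kl := lface_face e; have Kr := rface_face e.
apply: (face_jump (f := polywind c) e) (xget_face Kl) (xget_face Kr).
- by move=> x y; exact: polywind_const.
- by move=> x y; exact: polywind_const.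
have [l [ul lb el lE]] := polywind_list Kc.
have ml v' w' : edge K v' w' -> ((v', w') \in l)%:R = ind (lface v' w' = c).
  move=> e'; rewrite /ind; congr (_%:R); congr nat_of_bool; apply/idP/asboolP => [il|h].
    by have : [set` l] (v', w') by []; rewrite -lb => -[].
  by have : boundary c (v', w') by []; rewrite lb.
rewrite -(ml _ _ e) (rface_swap e) -(ml _ _ (edge_sym e)).
have -> : ((v, w) \in l)%:R - ((w, v) \in l)%:R =
    \sum_(i <- l) (ecount v w i.1 [:: i.2])%:~R :> R.
  rewrite -!sum_eq_mem // -sumrB; apply: eq_bigr => -[a b] _ /=.
  by rewrite !xpair_eqE addr0 rmorphB !rmorph_nat.
rewrite mulr_sumr.
rewrite (_ : (fun n => _) = fun n => \sum_(i <- l)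
    (wind (pt v w 2^-1 n) i.1 [:: i.2] - wind (pt v w 2^-1 (- n)) i.1 [:: i.2])); last first.
  by apply/funext => n; rewrite !lE -sumrB; apply: eq_bigr => i _; rewrite /= !addr0.
apply: cvg_sumr => i il; apply: (@wind_jump setT) => //.
by split=> //; exact: el.
Qed.

Lemma polywind_face c d x : K 2 c -> K 2 d -> d x -> polywind c x = 2 * pi * ind (d = c).
Proof.
move=> Kc Kd dx; pose g d := polywind c (xget 0 d) - 2 * pi * ind (d = c).
have gE d' : K 2 d' -> g d' = g d.
  move=> Kd'; apply: (faces_eq (f := g)) Kd' Kd => v w e; rewrite /g.
  by have := polywind_jump Kc e; rewrite mulrBr; lra.
rewrite (polywind_const Kc Kd dx (xget_face Kd)); apply/eqP; rewrite -subr_eq0 -/(g d).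
pose p0 := xget 0 c; pose y : R * R := (p0.1 + (2 * diam + 1), p0.2).
have d0 := diam_ge0; have yp : enorm (y - p0) = 2 * diam + 1.
  rewrite /y /enorm /= subrr [_ ^+ 2 + _]addrC expr0n add0r addrAC subrr add0r.
  by rewrite sqrtr_sqr ger0_norm //; lra.
have [b Kb cb] := face_at y; have bx := xget_face Kb; set q0 := xget 0 b in bx.
have far : diam < enorm (p0 - q0).
  have := cell_diam Kb cb (subset_closure bx); have := enorm_tri y q0 p0.
  by rewrite yp (enormB p0); lra.
rewrite -(gE _ Kb) /g -/q0 /ind asboolF; last first.
  move=> e; rewrite e in bx; have := cell_diam Kc (subset_closure (xget_face Kc)) (subset_closure bx).
  by rewrite -/p0 leNgt far.
rewrite mulr0 subr0; apply/eqP; rewrite /polywind.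
have hp i : boundary c i -> 0 < (rotate (i.1 - q0) (conjp (p0 - q0))).1 /\
    0 < (rotate (i.2 - q0) (conjp (p0 - q0))).1.
  move=> /boundary_closure[b1 b2]; have cp := subset_closure (xget_face Kc).
  split; apply: far_halfplane; apply: le_lt_trans far; exact: (cell_diam Kc).
rewrite (eq_fsbigr (fun i => arg (rotate (i.2 - q0) (conjp (p0 - q0))) -
    arg (rotate (i.1 - q0) (conjp (p0 - q0))))); last first.
  by move=> i /set_mem/hp[h1 h2]; exact: ang_halfplane.
rewrite fsumB; last exact: boundary_finite.
by rewrite (boundary_balance (fun v => arg (rotate (v - q0) (conjp (p0 - q0)))) Kc) subrr.
Qed.

(** * Coning the faces *)

Lemma invmM g h : invm (mulm g h) = mulm (invm h) (invm g).
Proof. by apply: motion_ext => x; apply: (@act_inj (mulm g h)); rewrite act_invmK !act_mulm !act_invmK. Qed.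

Definition cpt c := act (invm (hmot c)) (xget 0 (act (hmot c) @` c)).

Definition ctheta c : R := arg (rot (invm (hmot c))).

Lemma cpt_face c : K 2 c -> c (cpt c).
Proof.
move=> Kc; have [x cx] := cell_nonempty KCW Kc.
have : (act (hmot c) @` c) (xget 0 (act (hmot c) @` c)).
  by apply: xgetPex; exists (act (hmot c) x); exists x.
by case=> y cy e; rewrite /cpt -e act_invm.
Qed.

Lemma cpt_mul g c v : lmatch g v 0 -> K 2 c -> closure c v ->
  cpt (act g @` c) = act g (cpt c) /\ cong (ctheta (act g @` c)) (ctheta c + arg (rot g)).
Proof.
move=> lm Kc cv; have hE : hmot (act g @` c) = mulm (hmot c) (invm g).
  by apply: (hmot_act lm Kc cv); rewrite subrr enorm0.
rewrite /cpt /ctheta hE invmM invmK act_mulm image_act_act mulmKV; split=> //.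
by rewrite addrC; exact: arg_rot_mulm.
Qed.

Lemma ctheta_turn c : cong (ctheta c) (- turn c).
Proof.
apply/expi_cong; rewrite expiN /ctheta /turn !expi_arg ?rot_norm //.
Qed.

Lemma ctheta_cross v w : edge K v w -> cong (ctheta (lface w v)) (ctheta (lface v w) - cross v w).
Proof.
move=> e; rewrite -(rface_swap e); apply: cong_trans (ctheta_turn _) _.
have := congB (ctheta_turn (lface v w)) (cross_cong e) => /cong_sym; congr cong; ring.
Qed.

Lemma affm_tri_mul g a b d (t1 t2 t3 t : R) : cong t (arg (rot g)) ->
  mulm g \o affm (tri a b d) (tri t1 t2 t3) =
  affm (tri (act g a) (act g b) (act g d)) (tri (t1 + t) (t2 + t) (t3 + t)).
Proof.
move=> /expi_cong; rewrite expi_arg ?rot_norm // => ht; rewrite (affm_mul _ _ ht).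
by congr affm; apply/funext => -[[|[|k]] hk].
Qed.

Definition cone i : smap R 2 := let c := lface i.1 i.2 in
  affm (tri (cpt c) i.1 i.2) (tri (ctheta c) (ctheta c) (ctheta c)).

(* cap1 and cap2 fill the rectangle over the edge between the rotations of its two sides. *)
Definition cap1 i : smap R 2 := let t := ctheta (lface i.1 i.2) in
  affm (tri i.1 i.2 i.1) (tri t t (t - cross i.1 i.2)).

Definition cap2 i : smap R 2 := let t := ctheta (lface i.1 i.2) in
  affm (tri i.2 i.2 i.1) (tri t (t - cross i.1 i.2) (t - cross i.1 i.2)).

Definition isedge i := edge K i.1 i.2.

Definition isleft i := edge K i.1 i.2 /\ c1 (oseg i.1 i.2) = lface i.1 i.2.

Definition mvedge g i := (act g i.1, act g i.2).

Definition tracks (E : set ((R * R) * (R * R))) (F : (R * R) * (R * R) -> smap R 2) := [/\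
  forall i, E i -> isedge i,
  forall i, continuous (F i),
  forall i, E i -> forall p : @std_simplex R 2, enorm (trans (F i p) - i.1) <= diam &
  forall g i, E i -> lmatch g i.1 0 -> E (mvedge g i) /\ F (mvedge g i) = mulm g \o F i].

Lemma edges_near_finite y (r : R) : finite_set [set i | isedge i /\ enorm (i.1 - y) <= r].
Proof.
have f1 := vertices_finite y r; have f2 := vertices_finite y (r + diam).
apply: sub_finite_set (finite_setX f1 f2) => i [e le]; have [K1 K2] := edge_vertex e.
split; split=> //=; have := enorm_tri i.2 i.1 y; have := edge_diam e; rewrite enormB; lra.
Qed.

Section Tracks.
Variables (E : set ((R * R) * (R * R))) (F : (R * R) * (R * R) -> smap R 2).
Hypothesis EF : tracks E F.

Let Esm i : E i -> small (2 * diam) (F i).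
Proof.
have [_ _ h _] := EF => Ei p q.
have := enorm_tri (trans (F i p)) i.1 (trans (F i q)).
by have := h _ Ei p; have := h _ Ei q; rewrite (enormB i.1); lra.
Qed.

Let Efin (d : R) : finite_set [set i | E i /\ near 0 d (F i)].
Proof.
have [he _ h _] := EF; apply: sub_finite_set (edges_near_finite 0 (d + diam)) => i [Ei [p hp]].
split; first exact: he.
by have := enorm_tri i.1 (trans (F i p)) 0; have := h _ Ei p; rewrite (enormB (trans _) i.1); lra.
Qed.

Lemma tracks_tame : tame (fam E F).
Proof. by have [_ hc _ _] := EF; apply: tame_fam Esm Efin => i _; exact: hc. Qed.

Lemma tracks_pair (eta : smap R 2 -> R) : compactly eta ->
  pair (fam E F) eta = \sum_(i \in [set: (R * R) * (R * R)]) ind (E i) * eta (F i).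
Proof. by move=> h; apply: (@pair_fam _ _ E F _ Esm Efin eta h). Qed.

Lemma tracks_finsupp (eta : smap R 2 -> R) : compactly eta ->
  finsupp (fun i => ind (E i) * eta (F i)).
Proof. by move=> h; apply: (@fam_finsupp _ _ E F _ Esm Efin eta h). Qed.

Lemma mvedgeK g : cancel (mvedge g) (mvedge (invm g)).
Proof. by case=> a b; rewrite /mvedge /= !act_invm. Qed.

Lemma mvedgeVK g : cancel (mvedge (invm g)) (mvedge g).
Proof. by case=> a b; rewrite /mvedge /= !act_invmK. Qed.

Lemma tracks_equiv : equiv (4 * diam + 6) (fam E F).
Proof.
have d0 := diam_ge0; have [he _ hn hg] := EF; split.
  move=> s /fam_neq0[i Ei <-]; exists (F i (@corner R 2 ord0)) => _ [p _ <-].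
  rewrite motion_ballE /=; apply: le_lt_trans (dE_le_rot _ _) _.
  have := Esm Ei (@corner R 2 ord0) p; have := enormD (rot (F i (@corner R 2 ord0))) (- rot (F i p)).
  by rewrite enormN !rot_norm; lra.
have sub g (s : smap R 2) (p : @std_simplex R 2) : lmatch g (trans (s p)) (4 * diam + 6) -> forall i, E i -> F i = s ->
    E (mvedge g i) /\ F (mvedge g i) = mulm g \o s.
  move=> lm i Ei Fi; rewrite -Fi; apply: hg => //; apply: lmatch_sub lm _.
  by rewrite -Fi enormB; have := hn _ Ei p; lra.
move=> g s p lm; rewrite /fam.
rewrite (_ : [set i | E i /\ F i = mulm g \o s] = mvedge g @` [set i | E i /\ F i = s]).
  by rewrite fsbig_image // => i j _ _ /(can_inj (mvedgeK g)).
apply/seteqP; split=> [i [Ei Fi]|_ [i [Ei Fi] <-]]; last exact: sub lm _ Ei Fi.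
exists (mvedge (invm g) i); last exact: mvedgeVK.
have [] := sub (invm g) (mulm g \o s) p _ i Ei Fi; first exact: lmatch_inv.
by rewrite mulm_compK.
Qed.

End Tracks.

Lemma lface_ends v w : edge K v w -> closure (lface v w) v /\ closure (lface v w) w.
Proof. by move=> e; apply: (@boundary_closure (lface v w) (v, w)). Qed.

Lemma tri_near a b d y (r : R) : enorm (a - y) <= r -> enorm (b - y) <= r -> enorm (d - y) <= r ->
  forall i : 'I_3, enorm (tri a b d i - y) <= r.
Proof. by move=> h1 h2 h3 [[|[|k]] hk]. Qed.

Lemma cone_tracks : tracks isedge cone.
Proof.
split=> // [i|i e p|g i e lm]; first exact: affm_continuous.
  have Kl := lface_face e; have [l1 l2] := lface_ends e.
  have cl := subset_closure (cpt_face Kl).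
  by apply: affm_near; apply: tri_near; exact: (cell_diam Kl).
have i0 : enorm (i.1 - i.1) <= 0 by rewrite subrr enorm0.
have Kl := lface_face e; have [l1 l2] := lface_ends e.
split; first exact: lmatch_edge lm e i0.
have [ce te] := cpt_mul lm Kl l1; rewrite /cone /= (lmatch_lface lm e i0) ce.
set t' := ctheta _ in te *.
have h : cong (t' - ctheta (lface i.1 i.2)) (arg (rot g)).
  have := congB te (cong_refl (ctheta (lface i.1 i.2))).
  by rewrite [X in cong _ X -> _]addrC addKr.
by rewrite (affm_tri_mul _ _ _ _ _ _ h) addrC subrK.
Qed.

Lemma left_mul g i : isleft i -> lmatch g i.1 0 -> isleft (mvedge g i).
Proof.
move=> [e l] lm; have i0 : enorm (i.1 - i.1) <= 0 by rewrite subrr enorm0.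
have eg := lmatch_edge lm e i0; split=> //.
have := Hedge.2 g _ e.2; rewrite act_oseg => /(_ eg.2); rewrite -act_oseg (lmatch_oseg lm e i0).
by move=> /(_ erefl)[-> _ _]; rewrite l (lmatch_lface lm e i0).
Qed.

Lemma cap_tracks : tracks isleft cap1 /\ tracks isleft cap2.
Proof.
have sh g i : isleft i -> lmatch g i.1 0 -> let t := ctheta (lface i.1 i.2) in
    let t' := ctheta (lface (mvedge g i).1 (mvedge g i).2) in
    cong (t' - t) (arg (rot g)) /\ cross (mvedge g i).1 (mvedge g i).2 = cross i.1 i.2.
  move=> [e _] lm t t'; have i0 : enorm (i.1 - i.1) <= 0 by rewrite subrr enorm0.
  have [l1 _] := lface_ends e; have [_ te] := cpt_mul lm (lface_face e) l1.
  rewrite (lmatch_cross lm e i0); split=> //; rewrite /t' (lmatch_lface lm e i0).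
  by have := congB te (cong_refl t); rewrite [X in cong _ X -> _]addrC addKr.
have d0 := diam_ge0; split; split=> [i []//|i|i [e _] p|g i l lm]; do ?exact: affm_continuous.
- apply: affm_near; apply: tri_near; rewrite ?subrr ?enorm0 //.
  by rewrite enormB; exact: edge_diam.
- split; first exact: left_mul.
  have [h ce] := sh g i l lm; rewrite /cap1 ce (affm_tri_mul _ _ _ _ _ _ h) /=.
  by congr (affm _ (tri _ _ _)); ring.
- apply: affm_near; apply: tri_near; rewrite ?subrr ?enorm0 //;
    by rewrite enormB; exact: edge_diam.
split; first exact: left_mul.
have [h ce] := sh g i l lm; rewrite /cap2 ce (affm_tri_mul _ _ _ _ _ _ h) /=.
by congr (affm _ (tri _ _ _)); ring.
Qed.
Lemma tameD n (z z' : schain R n) : tame z -> tame z' -> tame (fun s => z s + z' s).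
Proof.
have cs s : z s + z' s != 0 -> z s != 0 \/ z' s != 0.
  by have [->|] := eqVneq (z s) 0; [rewrite add0r; right|left].
move=> [c f [a sa]] [c' f' [b sb]]; split.
- by move=> s /cs[/c|/c'].
- move=> r; apply: (@sub_finite_set _ _ ([set s | z s != 0 /\ near 0 r s] `|`
    [set s | z' s != 0 /\ near 0 r s])); last by rewrite finite_setU.
  by move=> s [/cs[h|h] hn]; [left|right].
exists (Num.max a b) => s /cs[/sa h|/sb h] p q; rewrite le_max; first by rewrite h.
by rewrite (h p q) orbT.
Qed.

Definition scale n (k : int) (z : schain R n) : schain R n := fun s => z s * k.

Lemma scale_neq0 n k (z : schain R n) s : scale k z s != 0 -> z s != 0.
Proof. by rewrite mulf_eq0 negb_or => /andP[]. Qed.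

Lemma tame_scale n k (z : schain R n) : tame z -> tame (scale k z).
Proof.
move=> [c f [a sa]]; split; [by move=> s /scale_neq0/c| |by exists a => s /scale_neq0/sa].
by move=> r; apply: sub_finite_set (f r) => s [/scale_neq0].
Qed.

Lemma equiv_scale n (r : R) k (z : schain R n) : equiv r z -> equiv r (scale k z).
Proof.
move=> [h1 h2]; split; first by move=> s /scale_neq0/h1.
by move=> g s p lm; rewrite /scale (h2 _ _ p).
Qed.

Lemma sbd_scale n k (z : schain R n.+1) : tame z -> sbd (scale k z) = scale k (sbd z).
Proof.
move=> tz; apply/funext => u; rewrite /sbd /scale mulr_suml; apply: eq_bigr => i _.
have fz := tame_face_finite i u tz.
have sup (F : smap R n.+1 -> int) : (forall s, z s = 0 -> F s = 0) ->
    \sum_(s \in [set s : smap R n.+1 | s \o coface i = u]) F s =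
    \sum_(s \in [set s : smap R n.+1 | z s != 0 /\ s \o coface i = u]) F s.
  move=> h; apply/esym/fsbig_widen => [s []//|s [/= su]].
  by move=> ns; apply: h; apply: contra_notP ns => /eqP.
rewrite !sup; do ?by move=> s ->; rewrite ?mul0r mulr0.
by have [l ul ->] := finite_uniq fz; rewrite -!fsbig_seq // mulr_suml; apply: eq_bigr => s _; rewrite mulrA.
Qed.

Lemma pair_scale n k (z : schain R n) (eta : smap R n -> R) : tame z -> compactly eta ->
  pair (scale k z) eta = k%:~R * pair z eta.
Proof.
move=> tz h; rewrite /pair -fsumTZ; last exact: tame_finsupp.
by apply: eq_fsbigr => s _; rewrite /scale rmorphM /= mulrAC mulrC.
Qed.

Definition caps : schain R 2 := fun s => fam isleft cap1 s + fam isleft cap2 s.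

Definition disc : schain R 2 := fun s => fam isedge cone s + scale (-1) caps s.

Lemma caps_tame : tame caps.
Proof. by have [t1 t2] := cap_tracks; apply: tameD; exact: tracks_tame. Qed.

Lemma disc_tame : tame disc.
Proof. by apply: tameD; [exact: tracks_tame cone_tracks|exact: tame_scale caps_tame]. Qed.

Lemma disc_equiv : equiv (4 * diam + 6) disc.
Proof.
have [t1 t2] := cap_tracks; apply: equivD; first exact: tracks_equiv cone_tracks.
by apply: equiv_scale; apply: equivD; exact: tracks_equiv.
Qed.

Lemma disc_pair (eta : smap R 2 -> R) : compactly eta -> pair disc eta =
  \sum_(i \in [set: (R * R) * (R * R)]) ind (isedge i) * eta (cone i) -
  \sum_(i \in [set: (R * R) * (R * R)]) ind (isleft i) * (eta (cap1 i) + eta (cap2 i)).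
Proof.
move=> h; have [t1 t2] := cap_tracks; rewrite /disc pairDl //; last 2 first.
- exact: tracks_tame cone_tracks.
- exact: tame_scale caps_tame.
rewrite pair_scale //; last exact: caps_tame.
rewrite mulN1r /caps pairDl //; [|exact: tracks_tame t1|exact: tracks_tame t2].
rewrite (tracks_pair cone_tracks h) (tracks_pair t1 h) (tracks_pair t2 h) -fsumTD; last 2 first.
- exact: tracks_finsupp t1 _ h.
- exact: tracks_finsupp t2 _ h.
by congr (_ - _); apply: eq_fsbigr => i _; rewrite mulrDr.
Qed.

Lemma beta_edge x u : edge K (trans (src u)) (trans (tgt u)) ->
  beta x u = ang x (trans (src u)) (trans (tgt u)).
Proof.
move=> e; have [K1 K2] := edge_vertex e; have [_ _ _ h] := epthP u.
rewrite -{1}(nu_vertex K1) -{1}(nu_vertex K2) in e; rewrite /beta h // /= addr0.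
by rewrite !nu_vertex.
Qed.

Lemma beta_same x u : vertex K (trans (src u)) -> trans (tgt u) = trans (src u) -> beta x u = 0.
Proof.
move=> Kv e; have [_ _ h _] := epthP u.
by rewrite /beta h // (nu_vertex Kv) nu_vertex e.
Qed.

Lemma fdeg_caps c i : K 2 c -> isleft i -> fdeg c (cap1 i) = 0 /\ fdeg c (cap2 i) = 0.
Proof.
move=> Kc [e _]; have e' := edge_sym e; have [K1 K2] := edge_vertex e.
have cx := xget_face Kc; rewrite /fdeg /deg !delta2.
have [f1 f2 f3] := tri_faces i.1 i.2 i.1 (ctheta (lface i.1 i.2)) (ctheta (lface i.1 i.2))
  (ctheta (lface i.1 i.2) - cross i.1 i.2).
have [g1 g2 g3] := tri_faces i.2 i.2 i.1 (ctheta (lface i.1 i.2))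
  (ctheta (lface i.1 i.2) - cross i.1 i.2) (ctheta (lface i.1 i.2) - cross i.1 i.2).
rewrite -/(s12 (cap1 i)) -/(s02 (cap1 i)) -/(s01 (cap1 i)).
rewrite -/(s12 (cap2 i)) -/(s02 (cap2 i)) -/(s01 (cap2 i)) f1 f2 f3 g1 g2 g3; split.
  rewrite beta_edge ?duo_src ?duo_tgt // beta_same ?duo_src ?duo_tgt //.
  rewrite beta_edge ?duo_src ?duo_tgt // (angN (face_csegN Kc cx e)).
  by rewrite subr0 addNr mul0r.
rewrite beta_edge ?duo_src ?duo_tgt // beta_edge ?duo_src ?duo_tgt //.
by rewrite beta_same ?duo_src ?duo_tgt // subrr addr0 mul0r.
Qed.

Definition spoke x c v : R := beta x (affm (duo (cpt c) v) (duo (ctheta c) (ctheta c))).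

Lemma deg_cone x i : isedge i -> deg x (cone i) =
  (ang x i.1 i.2 - (spoke x (lface i.1 i.2) i.2 - spoke x (lface i.1 i.2) i.1)) / (2 * pi).
Proof.
move=> e; rewrite /deg delta2 -/(s12 (cone i)) -/(s02 (cone i)) -/(s01 (cone i)).
have [-> -> ->] := tri_faces (cpt (lface i.1 i.2)) i.1 i.2 (ctheta (lface i.1 i.2))
  (ctheta (lface i.1 i.2)) (ctheta (lface i.1 i.2)).
rewrite beta_edge ?duo_src ?duo_tgt //; congr (_ / _).
by rewrite /spoke opprB addrA addrAC.
Qed.

Lemma disc_mdeg : mdeg disc = 1.
Proof.
apply: (@intr_inj R); rewrite (mdegP disc_tame); have Kf := face0P; have fx := xget_face Kf.
rewrite disc_pair; last exact: fdeg_compactly.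
rewrite [X in _ - X]fsbig1 ?subr0 => [|i _]; last first.
  rewrite /ind; case: asboolP => [l|_]; last by rewrite mul0r.
  by have [-> ->] := fdeg_caps Kf l; rewrite addr0 mulr0.
have fs := tracks_finsupp cone_tracks (fdeg_compactly face0).
rewrite -(fsumT_fibre (fun i => lface i.1 i.2) fs).
transitivity (\sum_(c \in [set: set (R * R)]) ind (face0 = c)); last first.
  rewrite (@fsumT _ _ [set face0]) ?fsbig_set1 /ind ?asboolT // => c.
  by case: asboolP => [<- //|_]; rewrite eqxx.
apply: eq_fsbigr => c _; have [Kc|nK] := pselect (K 2 c); last first.
  rewrite /ind asboolF => [|e]; last by case: nK; rewrite -e.
  rewrite fsbig1 // => i /= ic; case: asboolP => [e|_]; last by rewrite mul0r.
  by case: nK; rewrite -ic; exact: lface_face.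
transitivity (\sum_(i \in boundary c) fdeg face0 (cone i)).
  transitivity (\sum_(i \in boundary c) ind (isedge i) * fdeg face0 (cone i)).
    apply/esym/fsbig_widen => [i []//|i [/= ic nb]].
    by rewrite /ind asboolF ?mul0r // => e; apply: nb.
  by apply: eq_fsbigr => i /set_mem[e _]; rewrite /ind asboolT // mul1r.
have fb := boundary_finite Kc.
transitivity ((polywind c (xget 0 face0) - (\sum_(i \in boundary c) spoke (xget 0 face0) c i.2 -
    \sum_(i \in boundary c) spoke (xget 0 face0) c i.1)) / (2 * pi)).
  rewrite /polywind -fsumB // -fsumB //; have [l ul lE] := finite_uniq fb.
  rewrite lE -!fsbig_seq // mulr_suml big_seq [RHS]big_seq; apply: eq_bigr => i il.
  have [e ic] : boundary c i by rewrite lE.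
  by rewrite /fdeg deg_cone // ic.
rewrite (boundary_balance (spoke (xget 0 face0) c) Kc) subrr subr0.
by rewrite (polywind_face Kc Kf fx) mulrAC divff ?mul1r // pi2_neq0.
Qed.

Lemma affm_same (v : R * R) (t1 t2 : R) (p : @std_simplex R 1) : trans (affm (duo v v) (duo t1 t2) p) = v.
Proof.
apply/eqP; rewrite -subr_eq0; apply/eqP; apply: enorm_eq0; apply/eqP.
rewrite eq_le enorm_ge0 andbT; apply: affm_near => -[[|k] hk]; by rewrite /duo /= subrr enorm0.
Qed.

Lemma left_sum (J : (R * R) * (R * R) -> R) : finsupp (fun i => ind (isedge i) * J i) ->
  \sum_(i \in [set: (R * R) * (R * R)]) ind (isleft i) * (J i + J (swap i)) =
  \sum_(i \in [set: (R * R) * (R * R)]) ind (isedge i) * J i.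
Proof.
move=> fJ.
have indE i : ind (isedge i) = ind (isleft i) + ind (isleft (swap i)).
  have [e|ne] := pselect (isedge i); last first.
    by rewrite /ind !asboolF ?addr0 // => -[] // /edge_sym.
  have e' := edge_sym e.
  rewrite [LHS]/ind asboolT //; have [[h1 [_ ne]]|[h1 [_ ne]]] := edge_sides e.
    have l1 : isleft i by [].
    have l2 : ~ isleft (swap i) by move=> [_]; rewrite /= (oseg_sym i.2) h1 -(rface_swap e).
    by rewrite /ind (asboolT l1) (asboolF l2) addr0.
  have l1 : ~ isleft i by move=> [_]; rewrite h1; exact: nesym.
  have l2 : isleft (swap i) by split=> //=; rewrite (oseg_sym i.2) h1 (rface_swap e).
  by rewrite /ind (asboolF l1) (asboolT l2) add0r.
have ls i (F : (R * R) * (R * R) -> R) : ind (isleft i) * F i != 0 -> ind (isedge i) * F i != 0.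
  rewrite indE !mulf_eq0 !negb_or => /andP[il ->]; rewrite andbT; move: il; rewrite /ind.
  case: asboolP => _; last by rewrite eqxx.
  by move=> _; rewrite -natrD pnatr_eq0 addn_eq0.
have fL : finsupp (fun i => ind (isleft i) * J i).
  by apply: sub_finite_set fJ => i; exact: ls.
have fL' : finsupp (fun i => ind (isleft i) * J (swap i)).
  apply: (@sub_finite_set _ _ _ _ (finsupp_swap fJ)) => i h.
  have /= := ls i (fun i => J (swap i)) h.
  by rewrite /isedge [in X in _ -> X]ind_edge_sym.
have fL2 : finsupp (fun i => ind (isleft (swap i)) * J i).
  by apply: (@sub_finite_set _ _ _ _ (finsupp_swap fL')) => i /=; rewrite swapK.
transitivity (\sum_(i \in [set: (R * R) * (R * R)]) ind (isleft i) * J i +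
    \sum_(i \in [set: (R * R) * (R * R)]) ind (isleft i) * J (swap i)).
  apply: etrans _ (fsumTD fL fL'); apply: eq_fsbigr => i _; exact: mulrDr.
transitivity (\sum_(i \in [set: (R * R) * (R * R)]) ind (isleft i) * J i +
    \sum_(i \in [set: (R * R) * (R * R)]) ind (isleft (swap i)) * J i).
  congr (_ + _); rewrite (fsumT_bij (fun i => ind (isleft i) * J (swap i)) swapK swapK).
  by apply: eq_fsbigr => i _; rewrite swapK.
apply: etrans (esym (fsumTD fL fL2)) _; apply: eq_fsbigr => i _.
by rewrite indE mulrDl.
Qed.

Lemma disc_over0 : over0 (sbd disc).
Proof.
move=> u su; apply: contrapT => nu0; case/negP: su; rewrite -(intr_eq0 R) sbd_pair.
have c1u := @compactly1 1 u; have cd := delta_compactly c1u.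
rewrite stokes //; last exact: disc_tame.
rewrite disc_pair //.
pose T1 (a b : R * R) (t1 t2 : R) : R := (affm (duo a b) (duo t1 t2) == u)%:R.
pose J i : R := T1 i.1 i.2 (ctheta (lface i.1 i.2)) (ctheta (lface i.1 i.2)).
pose H c v : R := T1 (cpt c) v (ctheta c) (ctheta c).
have same v t1 t2 : vertex K v -> T1 v v t1 t2 = 0.
  move=> Kv; rewrite /T1; case: eqP => // e; case: nu0 => k; rewrite -e.
  by rewrite affm_same.
have coneE i : delta (fun u' => (u' == u)%:R) (cone i) =
    J i + (H (lface i.1 i.2) i.1 - H (lface i.1 i.2) i.2).
  rewrite delta2 -/(s12 (cone i)) -/(s02 (cone i)) -/(s01 (cone i)).
  have [-> -> ->] := tri_faces (cpt (lface i.1 i.2)) i.1 i.2 (ctheta (lface i.1 i.2))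
    (ctheta (lface i.1 i.2)) (ctheta (lface i.1 i.2)).
  by rewrite /J /H /T1 addrAC addrA.
have capE i : ind (isleft i) * (delta (fun u' => (u' == u)%:R) (cap1 i) +
    delta (fun u' => (u' == u)%:R) (cap2 i)) = ind (isleft i) * (J i + J (swap i)).
  rewrite /ind; case: asboolP => [[e _]|_]; last by rewrite !mul0r.
  congr (_ * _); have [K1 K2] := edge_vertex e; rewrite !delta2.
  rewrite -/(s12 (cap1 i)) -/(s02 (cap1 i)) -/(s01 (cap1 i)).
  rewrite -/(s12 (cap2 i)) -/(s02 (cap2 i)) -/(s01 (cap2 i)).
  have [-> -> ->] := tri_faces i.1 i.2 i.1 (ctheta (lface i.1 i.2)) (ctheta (lface i.1 i.2))
    (ctheta (lface i.1 i.2) - cross i.1 i.2).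
  have [-> -> ->] := tri_faces i.2 i.2 i.1 (ctheta (lface i.1 i.2))
    (ctheta (lface i.1 i.2) - cross i.1 i.2) (ctheta (lface i.1 i.2) - cross i.1 i.2).
  have JE : J (swap i) = T1 i.2 i.1 (ctheta (lface i.1 i.2) - cross i.1 i.2)
      (ctheta (lface i.1 i.2) - cross i.1 i.2).
    have := ctheta_cross e; set t := ctheta (lface i.2 i.1); set t' := _ - _ => tt.
    rewrite /J /T1 /= -/t (@affm_cong _ _ (duo t' t') (duo t t) (t - t')) //.
      by have := congB tt (cong_refl t'); rewrite subrr.
    by move=> [[|k] hk]; rewrite /duo /= addrC subrK.
  rewrite -!/(T1 _ _ _ _) !same // -JE -[T1 i.1 i.2 _ _]/(J i).
  by ring.
rewrite [X in _ - X](eq_fsbigr (fun i => ind (isleft i) * (J i + J (swap i)))); last first.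
  by move=> i _; exact: capE.
have near_u F : (forall i, isedge i -> F i != 0 -> enorm (i.1 - trans (src u)) <= diam) ->
    finsupp (fun i => ind (isedge i) * F i).
  move=> h; apply: sub_finite_set (edges_near_finite (trans (src u)) diam) => i /=.
  rewrite mulf_eq0 negb_or /ind; case: asboolP => [e /andP[_ f]|_]; last by rewrite eqxx.
  by split=> //; exact: h.
have T1E a b t1 t2 : T1 a b t1 t2 != 0 -> trans (src u) = a.
  by rewrite /T1; have [<- _|_] := eqVneq (affm (duo a b) (duo t1 t2)) u; [rewrite duo_src|rewrite eqxx].
have fJ : finsupp (fun i => ind (isedge i) * J i).
  by apply: near_u => i e /T1E ->; rewrite subrr enorm0 diam_ge0.
have fH (v : (R * R) * (R * R) -> R * R) : finsupp (fun i => ind (isedge i) * H (lface i.1 i.2) (v i)).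
  apply: near_u => i e /T1E ->; have [l1 _] := lface_ends e; have Kl := lface_face e.
  by apply: (cell_diam Kl) => //; apply: subset_closure; exact: cpt_face.
have fB (F G : (R * R) * (R * R) -> R) : finsupp F -> finsupp G -> finsupp (fun i => F i - G i).
  by move=> hF hG; apply: finsuppD => //; exact: finsuppN.
apply/eqP; transitivity (\sum_(i \in [set: (R * R) * (R * R)]) ind (isedge i) * J i -
   \sum_(i \in [set: (R * R) * (R * R)]) ind (isleft i) * (J i + J (swap i))).
  congr (_ - _); transitivity (\sum_(i \in [set: (R * R) * (R * R)]) (ind (isedge i) * J i +
     (ind (isedge i) * H (lface i.1 i.2) i.1 - ind (isedge i) * H (lface i.1 i.2) i.2))).
    by apply: eq_fsbigr => i _; rewrite coneE mulrDr mulrBr.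
  rewrite fsumTD //; last exact: fB.
  rewrite fsumTB //; have -> := balance (fH (fun i => i.1)) (fH (fun i => i.2)).
  by rewrite subrr addr0.
by rewrite (left_sum fJ) subrr.
Qed.
Lemma skeleton2 x : skeleton K 2 x.
Proof.
have [k [e Ke ex]] := cell_cover KCW x; exists k, e => //; split=> //.
by rewrite lez_nat; exact: (cell_dim KCW Ke).
Qed.

Lemma skeleton0 x : skeleton K 0 x <-> vertex K x.
Proof.
split=> [[k [e Ke [k0 ex]]]|Kx]; last by exists 0%N, [set x].
have /eqP k0' : k == 0%N by rewrite -leqn0 -lez_nat.
by rewrite k0' in Ke; have [v Kv ev] := cell0 KCW Ke; rewrite ev in ex; rewrite ex.
Qed.

Lemma Frot_tame (p : int) n (z : schain R n) : Frot T K p z -> exists2 r : R, 0 < r & tame z /\ equiv r z.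
Proof.
by move=> [bz /equivariantE[r r0 ez] _]; exists r => //; split=> //; exact: bm_tame bz ez.
Qed.

Lemma Frot_build (p : int) n (r : R) (z : schain R n) : 0 < r -> tame z -> equiv r z ->
  (forall s, z s != 0 -> forall k, skeleton K p (trans (s k))) -> Frot T K p z.
Proof.
move=> r0 tz ez h; split; [exact: tame_bm|by apply/equivariantE; exists r|].
by move=> s zs _ [i _ <-]; exact: h.
Qed.

Definition good (z : schain R 2) :=
  exists2 r : R, 0 < r & [/\ tame z, equiv r z & over0 (sbd z)].

Lemma goodE (z : schain R 2) : good z <-> Frot T K 2 z /\ Frot T K 0 (sbd z).
Proof.
split=> [[r r0 [tz ez oz]]|[f2 f0]].
  split; first by apply: (Frot_build r0) => // s _ i; exact: skeleton2.
  apply: (Frot_build r0); [exact: tame_sbd|exact: equiv_sbd|].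
  by move=> u su i; apply/skeleton0; exact: oz.
have [r r0 [tz ez]] := Frot_tame f2; exists r => //; split=> // u su i.
by apply/skeleton0; have [_ _ h] := f0; apply: (h _ su); exists i.
Qed.

Lemma goodD (z z' : schain R 2) : good z -> good z' -> good (fun s => z s + z' s).
Proof.
move=> [r r0 [tz ez oz]] [r' r0' [tz' ez' oz']]; exists (Num.max r r').
  by rewrite lt_max r0.
split; first exact: tameD.
  by apply: equivD; [apply: equiv_mono ez|apply: equiv_mono ez']; rewrite le_max lexx ?orbT.
rewrite sbdD // => u; have [->|/oz//] := eqVneq (sbd z u) 0.
by rewrite add0r => /oz'.
Qed.

Lemma good_scale k (z : schain R 2) : good z -> good (scale k z).
Proof.
move=> [r r0 [tz ez oz]]; exists r => //; split; [exact: tame_scale|exact: equiv_scale|].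
by rewrite sbd_scale // => u /scale_neq0/oz.
Qed.

Lemma good_disc : good disc.
Proof.
exists (4 * diam + 6); first by have := diam_ge0; lra.
split; [exact: disc_tame|exact: disc_equiv|exact: disc_over0].
Qed.

Lemma mdegD (z z' : schain R 2) : tame z -> tame z' ->
  mdeg (fun s => z s + z' s) = mdeg z + mdeg z'.
Proof.
move=> tz tz'; apply: (@intr_inj R); rewrite rmorphD /= !mdegP //; last exact: tameD.
by rewrite pairDl //; exact: fdeg_compactly.
Qed.

Lemma mdeg_scale k (z : schain R 2) : tame z -> mdeg (scale k z) = k * mdeg z.
Proof.
move=> tz; apply: (@intr_inj R); rewrite rmorphM /= !mdegP //; last exact: tame_scale.
by rewrite pair_scale //; exact: fdeg_compactly.
Qed.

Lemma patch_mono r r' (U : set (R * R)) g : r <= r' :> R ->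
  mtile g @` patch T (thicken U r') = patch T (thicken (act g @` U) r') ->
  mtile g @` patch T (thicken U r) = patch T (thicken (act g @` U) r).
Proof.
move=> le e; have lm y : U y -> lmatch g y r.
  by move=> Uy; apply: lmatch_mono le _; exact: lmatch_thicken Uy e.
apply/seteqP; split=> [_ [t [Tt [x [tx [y Uy xy]]]] <-]|t [Tt [x [tx [_ [y Uy <-] xy]]]]].
  split; first by apply: (lm _ Uy).1 => //; exists x.
  exists (act g x); split; first by exists x.
  by exists (act g y); [exists y|rewrite enorm_act].
exists (mtile (invm g) t); last exact: mtile_Kinv.
split; first by apply: (lm _ Uy).2 => //; exists x.
exists (act (invm g) x); split; first by exists x.
by exists y => //; rewrite -(act_invm g y) enorm_act.
Qed.

Lemma C1_lin (b b' : chain1 R) k : C1 T K b -> C1 T K b' ->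
  C1 T K (fun v w => b v w + k * b' v w).
Proof.
move=> [h1 h2 [r r0 h3]] [h1' h2' [r' r0' h3']]; split.
- by move=> v w; rewrite h1 h1' mulrN opprD.
- move=> v w; have [->|/h2//] := eqVneq (b v w) 0.
  by rewrite add0r mulf_eq0 negb_or => /andP[_ /h2'].
exists (Num.max r r'); first by rewrite lt_max r0.
move=> g v w e eg; rewrite -act_oseg => h; congr (_ + _ * _).
  by apply: h3 => //; rewrite -act_oseg; apply: patch_mono h; rewrite le_max lexx.
by apply: h3' => //; rewrite -act_oseg; apply: patch_mono h; rewrite le_max lexx orbT.
Qed.

Lemma bd1_lin (b b' : chain1 R) k v :
  bd1 K (fun v w => b v w + k * b' v w) v = bd1 K b v + k * bd1 K b' v.
Proof.
have fA : finite_set [set w | edge K w v].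
  by apply: sub_finite_set (nbrs_finite v) => w; exact: edge_sym.
by rewrite /bd1; have [l ul ->] := finite_uniq fA; rewrite -!fsbig_seq // big_split mulr_sumr.
Qed.

Lemma chain0_mulz (a : chain0 R) (k : int) v : (a *~ k) v = a v * k.
Proof.
have nat_mul n : (a *+ n) v = a v *+ n by elim: n => [|n IH]; rewrite ?mulr0n // !mulrS -IH.
rewrite -mulrzz; case: k => n; first exact: nat_mul.
by rewrite -[LHS]/(- ((a *+ n.+1) v)) nat_mul.
Qed.
Lemma H0_classE (a d : chain0 R) : H0_class T K a d <->
  exists2 b, C1 T K b & forall v, d v = a v + bd1 K b v.
Proof.
split=> -[b Cb h]; exists b => //.
  by move=> v; have := congr1 (fun f : chain0 R => f v) h; rewrite -[LHS]/(d v - a v) => <-; rewrite addrC subrK.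
by apply/funext => v; rewrite -[LHS]/(d v - a v) h addrAC subrr add0r.
Qed.

Lemma good_winding (z : schain R 2) : good z -> exists2 b, C1 T K b &
  winding_numbers K (sbd z) (fun v => sigma v * mdeg z + bd1 K b v).
Proof.
move=> [r r0 [tz ez oz]]; exact: main_winding tz ez oz (ltW r0).
Qed.

Lemma zero_Frot (p : int) n : Frot T K p (fun _ : smap R n => 0 : int).
Proof.
have z0 : tame (fun _ : smap R n => 0 : int).
  split; [by move=> s; rewrite eqxx| |by exists 0 => s; rewrite eqxx].
  by move=> r; apply: sub_finite_set (finite_set0 (smap R n)) => s []; rewrite eqxx.
have e0 : equiv 1 (fun _ : smap R n => 0 : int) by split=> [s|//]; rewrite eqxx.
by apply: (Frot_build ltr01 z0 e0) => s; rewrite eqxx.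
Qed.

Lemma sbd0 n : sbd (fun _ : smap R n.+1 => 0 : int) = (fun=> 0).
Proof.
apply/funext => u; rewrite /sbd big1 // => i _; rewrite fsbig1 // => s _.
by rewrite mulr0.
Qed.

Definition E2class (z : schain R 2) : set (schain R 2) :=
  @coset_mod (@schain_zmod R 2) (@Bterm (@schain_zmod R) (@sbd R) (@Frot R L T K) 2 2 2) z.

Lemma over1_good (y : schain R 2) : Frot T K 1 y -> Frot T K 0 (sbd y) -> good y /\ mdeg y = 0.
Proof.
move=> f1 f0; have [r r0 [ty ey]] := Frot_tame f1.
have oy : over0 (sbd y).
  by move=> u su k; apply/skeleton0; have [_ _ h] := f0; apply: (h _ su); exists k.
split; first by exists r.
by apply: mdeg_over1 => // s ys k; have [_ _ h] := f1; apply: (h _ ys); exists k.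
Qed.

Lemma drot_boundary (z : schain R 2) (y : schain R 1) : good z ->
  drot T K 2 2 2 (E2class z) y -> exists z' : schain R 2, [/\ good z', mdeg z' = mdeg z & y = sbd z'].
Proof.
move=> gz [z' [y3 [z1 [[f3 f3'] [f1 f1'] e1]]] [y1 [u1 [[g1 g1'] [g0 _] e2]]]].
have [r3 _ [t3 _]] := Frot_tame f3.
have [gz1 m1] := over1_good f1 f1'; have [gy1 my1] := over1_good g1 g1'.
have [r _ [tz _ _]] := gz; have [r1 _ [tz1 _ _]] := gz1; have [r2 _ [ty1 _ _]] := gy1.
exists (fun s => z s + (z1 s + y1 s)); split.
- by apply: goodD => //; exact: goodD.
- by rewrite !mdegD //; [rewrite m1 my1 !addr0|exact: tameD].
have u0 : u1 = (fun=> 0).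
  apply/funext => u; apply/eqP; apply: contrapT => /negP nu1; have [_ _ h] := g0.
  have [k [d _ [/= kneg _]]] := h _ nu1 _ (imageT u (@corner R 1 ord0)).
  by have : k%:Z <= Negz 0 := kneg.
have zE : z' = (fun s => z s + (sbd y3 s + z1 s)).
  apply/funext => s; have := congr1 (fun f : schain R 2 => f s) e1.
  by rewrite -[LHS]/(z' s - z s) -[RHS]/(sbd y3 s + z1 s) => <-; rewrite addrC subrK.
have ts := tame_sbd t3.
have bE : sbd z' = (fun u => sbd z u + sbd z1 u).
  rewrite zE sbdD //; last exact: tameD.
  rewrite sbdD // (sbd_sbd t3); apply/funext => u.
  by rewrite -[(0 : schain_zmod R 1) u]/(0 : int) add0r.
apply/funext => u; have := congr1 (fun f : schain R 1 => f u) e2.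
rewrite -[LHS]/(y u - sbd z' u) -[RHS]/(sbd y1 u + u1 u) u0 addr0 bE => e.
rewrite sbdD //; last exact: tameD.
by rewrite sbdD // addrA -e addrC subrK.
Qed.

Lemma drot_sbd (z : schain R 2) : drot T K 2 2 2 (E2class z) (sbd z).
Proof.
have zz (p : int) n : @Zterm (@schain_zmod R) (@sbd R) (@Frot R L T K) 1 p n.+1 (fun=> 0).
  by split; [exact: zero_Frot|rewrite /= sbd0; exact: zero_Frot].
have b0 n : (fun _ : smap R n.+1 => 0 : int) =
    sbd (fun _ : smap R n.+2 => 0 : int) + (fun _ : smap R n.+1 => 0 : int) :> schain_zmod R n.+1.
  by rewrite sbd0; apply/funext => s; exact: esym (addr0 0).
exists z.
  exists (fun=> 0), (fun=> 0); split; [exact: zz|exact: zz|].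
  by rewrite -b0; apply/funext => s; exact: subrr.
exists (fun=> 0), (fun=> 0); split; [exact: zz|exact: zz|].
by rewrite -b0; apply/funext => s; exact: subrr.
Qed.

Lemma winding_iso_class (z : schain R 2) : good z ->
  winding_iso T K (drot T K 2 2 2 (E2class z)) = H0_class T K (sigma *~ mdeg z).
Proof.
move=> gz; apply/seteqP; split=> a.
  move=> [y [w [/(drot_boundary gz)[z' [gz' mz' ->]] ww /H0_classE[b Cb h]]]].
  have [b' Cb' hw] := good_winding gz'; have wE := winding_uniq ww hw.
  apply/H0_classE; exists (fun v v' => b v v' + 1 * b' v v'); first exact: C1_lin.
  by move=> v; rewrite h wE chain0_mulz mz' bd1_lin mul1r -addrA (addrC (bd1 K b' v)).
move=> /H0_classE[b Cb h]; have [b' Cb' hw] := good_winding gz.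
exists (sbd z), (fun v => sigma v * mdeg z + bd1 K b' v); split=> //; first exact: drot_sbd.
apply/H0_classE; exists (fun v v' => b v v' + -1 * b' v v'); first exact: C1_lin.
by move=> v; rewrite h chain0_mulz bd1_lin mulN1r addrACA subrr addr0.
Qed.

Lemma image_classes : [set winding_iso T K (drot T K 2 2 2 X) | X in Erot T K 2 2 2] =
  [set H0_class T K (sigma *~ m) | m in [set: int]].
Proof.
apply/seteqP; split=> [_ [_ [z [f2 f0] <-] <-]|_ [m _ <-]].
  have gz : good z by apply/goodE.
  by exists (mdeg z) => //; rewrite -winding_iso_class.
have gd := good_scale m good_disc; exists (E2class (scale m disc)).
  by exists (scale m disc) => //; have /goodE[f2 f0] := gd; split.
by rewrite winding_iso_class // mdeg_scale ?disc_mdeg ?mulr1 //; exact: disc_tame.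
Qed.

End Edges.

Theorem proposition6p2p2 (R : realType) (L : Type) (P : L -> prototile R)
    (T : set (tile R L)) (K : cells R)
    (Ttiling : is_tiling P T)
    (Tcellular : cellular P T K)
    (Tflc : rigid_flc T)
    (Kpolygonal : polygonal_faces K)
    (Kstraight : straight_edges K)
    (Tsym : forall x, local_symmetry T x -> vertex K x)
    (dir : facet R L -> facet R L)
    (c1 c2 : set (R * R) -> set (R * R)) (rho : set (R * R) -> R)
    (Hdir : face_directions T K dir)
    (Hedge : edge_choices T K dir c1 c2 rho) :
  exists sigma : chain0 R,
    [/\ winding_chain K c1 rho sigma,
        C0 T K sigma &
        [set winding_iso T K (drot T K 2 2 2 X) | X in Erot T K 2 2 2] =
        [set H0_class T K (sigma *~ m) | m in [set: int]]].
Proof.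
have [KCW _ _ _] := Tcellular.
exists (sigma K c1 rho); split.
- exact: (sigma_winding KCW Kstraight Kpolygonal Ttiling Tcellular Tsym Hdir Hedge).
- exact: (sigma_C0 KCW Kstraight Kpolygonal Ttiling Tcellular Tsym Hdir Hedge).
exact: (image_classes KCW Kstraight Kpolygonal Ttiling Tcellular Tsym Hdir Hedge).
Qed.
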